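(* Let $\mathcal{P}(q,h,H,H_1,H_2)$ and $\mathcal{P}(\widetilde q,\widetilde h,\widetilde H,\widetilde H_1,\widetilde H_2)$ be two boundary-value problems with $q,\widetilde q\in L_2(0,\pi)$ real-valued, all the other coefficients real, and $HH_1-H_2>0$, $\widetilde H\widetilde H_1-\widetilde H_2>0$. Let $\{\lambda_n,\gamma_n\}_{n\ge0}$ and $\{\widetilde\lambda_n,\widetilde\gamma_n\}_{n\ge0}$ be their eigenvalues and norming constants. If $$\lambda_n=\widetilde\lambda_n,\qquad \gamma_n=\widetilde\gamma_n,\qquad n\ge 0,$$ then $$q(x)=\widetilde q(x)\ \text{a.e. on }(0,\pi),\quad h=\widetilde h,\quad H=\widetilde H,\quad H_1=\widetilde H_1,\quad H_2=\widetilde H_2.$$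
   Context: For a real-valued $q\in L_2(0,\pi)$ and $h,H,H_1,H_2\in\mathbb{R}$ with $\rho:=HH_1-H_2>0$, let $\mathcal{P}(q,h,H,H_1,H_2)$ denote the eigenvalue problem $$-y''(x)+q(x)y(x)=\lambda y(x),\quad x\in[0,\pi],$$ $$y'(0)-hy(0)=0,\qquad \lambda\,(y'(\pi)+Hy(\pi))=H_1y'(\pi)+H_2y(\pi).$$ Its eigenvalues form a countably infinite set of real numbers, all simple, numbered increasingly $\lambda_0<\lambda_1<\dots$. Let $\varphi(x,\lambda)$ be the solution of the equation with $\varphi(0,\lambda)=1$, $\varphi'(0,\lambda)=h$. The norming constants are $$\gamma_n:=\int_0^\pi\varphi^2(x,\lambda_n)\,dx+\frac{(\varphi'(\pi,\lambda_n)+H\varphi(\pi,\lambda_n))^2}{\rho}.$$ The corresponding quantities for the second problem are marked with a tilde. *)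

(* Defs.v *)
From mathcomp Require Import all_boot all_order all_algebra.
From mathcomp Require Import all_classical all_reals all_analysis.

Set Implicit Arguments.
Unset Strict Implicit.
Unset Printing Implicit Defensive.

Import Order.TTheory GRing.Theory Num.Theory.
Import numFieldNormedType.Exports.

Local Open Scope classical_set_scope.
Local Open Scope ring_scope.

Section BoundaryValueProblem.
Context {R : realType}.
Implicit Types (q y phi : R -> R) (h H lam g : R).

Local Notation mu := (@lebesgue_measure R).

(* A function on the interval is represented by a function on R whose values
   outside the interval are irrelevant. *)
Definition L2_0pi (f : R -> R) : Prop := (f \_ `]0, pi[) \in Lfun mu 2%:E.

(* The derivative is taken along [0, pi], hence is one-sided at 0 and pi. *)
Definition derivative_0pi (f f' : R -> R) : Prop :=
  forall x, x \in `[0, pi] ->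
    (f t - f x) / (t - x) @[t --> within `[0, pi] x^'] --> f' x.

(* y belongs to the Sobolev space W_2^2[0, pi], with first derivative y1
   (defined everywhere) and second derivative y2 (defined up to a null set):
   y1 is absolutely continuous with density y2 in L_2(0, pi). *)
Definition W22_0pi y y1 y2 : Prop :=
  [/\ derivative_0pi y y1,
      L2_0pi y2
    & forall x, x \in `[0, pi] ->
        y1 x = y1 0 + \int[mu]_(t in `[0, x]) y2 t].

(* y solves - y'' + q y = lam y on [0, pi], and y1 is its first derivative. *)
Definition solution q lam y y1 : Prop :=
  exists2 y2, W22_0pi y y1 y2 &
    {ae mu, forall x, x \in `]0, pi[ -> - y2 x + q x * y x = lam * y x}.

Definition bvp_eigenvalue q h H H1 H2 lam : Prop :=
  exists y y1,
    [/\ solution q lam y y1,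
        exists2 x, x \in `[0, pi] & y x != 0,
        y1 0 - h * y 0 = 0
      & lam * (y1 pi + H * y pi) = H1 * y1 pi + H2 * y pi].

Definition phi_solution q h lam phi phi1 : Prop :=
  [/\ solution q lam phi phi1, phi 0 = 1 & phi1 0 = h].

(* By uniqueness for the Cauchy problem there is exactly one such g. *)
Definition norming_constant q h H H1 H2 lam g : Prop :=
  exists phi phi1, phi_solution q h lam phi phi1 /\
    g = (\int[mu]_(x in `[0, pi]) (phi x ^+ 2))
        + (phi1 pi + H * phi pi) ^+ 2 / (H * H1 - H2).

(* All eigenvalues of the problem are real when H * H1 - H2 > 0, so only real
   spectral parameters (and real eigenfunctions) are considered. *)
Definition spectral_data q h H H1 H2 (lam gam : nat -> R) : Prop :=
  [/\ {homo lam : m n / (m < n)%N >-> m < n},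
      forall l, bvp_eigenvalue q h H H1 H2 l <-> exists n, l = lam n
    & forall n, norming_constant q h H H1 H2 (lam n) (gam n)].

End BoundaryValueProblem.

(* Main.v *)
Require Import Defs.
From mathcomp Require Import all_boot all_order all_algebra.
From mathcomp Require Import all_classical all_reals all_analysis.
From mathcomp Require Import measurable_realfun ring lra.

Set Implicit Arguments.
Unset Strict Implicit.
Unset Printing Implicit Defensive.

Import Order.TTheory GRing.Theory Num.Theory.
Import numFieldNormedType.Exports.

Local Open Scope classical_set_scope.
Local Open Scope ring_scope.

(* With C_n = C(., lam_n) the solution of - C'' = lam_n C, C 0 = 1, C' 0 = 0, there are operators X, X'
   of the form "identity + Volterra" that carry C_n to phi(., lam_n) and to phi~(., lam_n).  The vectors
   (phi_n, phi_n' pi + H phi_n pi) are orthogonal and complete in L_2 (+) R weighted by 1 / rho,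
   and their squared norms are the norming constants; so equality of the spectral data
   makes X' X^-1 an isometry of L_2.  Being of Volterra type it does not move supports to the left, and
   an isometry of this kind is also local in the other direction; as it is the identity up to a
   Volterra term, it is the identity.  Hence phi_n = phi~_n for all n, which gives q and h by
   completeness, and the boundary condition at pi for three values of lam_n gives H, H1, H2. *)

(** The potentials are only in L_2, so X is obtained from the wave equation u_xx - u_ss = q u and is
    known through a single estimate: at x, X f differs from f by at most M times the integral of |f|
    over [0, x]. This estimate carries the inversion, the preservation of supports and the final
    localization. The obstacle is that the two families of vectors live in spaces with different
    weights and different H, and that X does not see the scalar component. So only vectors (X a, 0)
    are approximated by finite sums of eigenvectors. The sum with the same coefficients for the
    other problem has the same norm, and dropping its scalar component merely shows that the L_2
    norm of X' a is at most that of X a; exchanging the two problems gives equality. Completeness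
    comes from the compact symmetric inverse of the problem shifted by a number below all
    eigenvalues. Three eigenvalues are used at the end because H enters through the square of a
    function affine in lam, which leaves a sign open at each n. *)

(** * Integrals with oriented limits of locally integrable functions *)

Section OrientedIntegral.
Context {R : realType}.
Local Notation mu := (@lebesgue_measure R).
Implicit Types (f g : R -> R) (a b c x k : R).

Definition locint f := forall a b, mu.-integrable `[a, b] (EFin \o f).

(** With orientation, additivity in the limits holds for end points in any order, so that shifted,
    reflected and moving limits cause no case distinction. *)
Definition itg f a b : R :=
  if a <= b then \int[mu]_(t in `[a, b]) f t else - \int[mu]_(t in `[b, a]) f t.

Lemma itgE f a b : a <= b -> itg f a b = \int[mu]_(t in `[a, b]) f t.
Proof. by rewrite /itg => ->. Qed.

Lemma itgC f a b : itg f b a = - itg f a b.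
Proof.
rewrite /itg; case: (ltgtP a b) => [||->]; rewrite ?opprK//.
by rewrite set_itv1 Rintegral_set1 oppr0.
Qed.

Lemma itgxx f a : itg f a a = 0.
Proof. by rewrite /itg lexx set_itv1 Rintegral_set1. Qed.

Lemma locint_cont f : continuous f -> locint f.
Proof.
move=> cf a b; apply: continuous_compact_integrable; first exact: segment_compact.
exact: continuous_subspaceT.
Qed.

Lemma locint_measurable f : locint f -> measurable_fun setT f.
Proof.
move=> lf.
rewrite -(bigcup_itvT true false).
apply/measurable_fun_bigcup => // n.
by have := measurable_int _ (lf (- n%:R) n%:R) => /measurable_EFinP.
Qed.

Lemma le_locint f g : measurable_fun setT f -> (forall x, `|f x| <= `|g x|) ->
  locint g -> locint f.
Proof.
move=> mf fg lg a b; apply: le_integrable (lg a b) => //.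
  by apply/measurable_EFinP; exact: measurable_funS mf.
by move=> x _ /=; rewrite lee_fin.
Qed.

Lemma locintD f g : locint f -> locint g -> locint (f \+ g).
Proof.
move=> lf lg a b; have : mu.-integrable `[a, b] ((EFin \o f) \+ (EFin \o g))%E.
  by apply: integrableD.
by apply: eq_integrable.
Qed.

Lemma locintZ k f : locint f -> locint (fun x => k * f x).
Proof.
move=> lf a b; have : mu.-integrable `[a, b] (fun x => (k%:E * (EFin \o f) x)%E).
  by apply: integrableZl.
by apply: eq_integrable.
Qed.

Lemma locintN f : locint f -> locint (fun x => - f x).
Proof.
by move=> /(locintZ (-1)); under eq_fun do rewrite mulN1r.
Qed.

Lemma locintB f g : locint f -> locint g -> locint (f \- g).
Proof. by move=> lf /locintN lg; exact: locintD lf lg. Qed.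

Lemma locint_norm f : locint f -> locint (fun x => `|f x|).
Proof.
move=> lf; apply: (le_locint _ _ lf); last by move=> x; rewrite normr_id.
by apply: measurableT_comp; [exact: normr_measurable | exact: locint_measurable].
Qed.

Lemma continuous_itv_bounded f a b : continuous f ->
  exists2 M, 0 <= M & forall x, a <= x <= b -> `|f x| <= M.
Proof.
move=> cf; case: (leP a b) => ab; last first.
  by exists 0 => // x /andP[/le_trans h /h]; rewrite leNgt ab.
have cf' : {within `[a, b], continuous (fun x => `|f x|)}.
  apply: continuous_subspaceT => x; exact: (continuous_comp (cf x) (@norm_continuous _ _ (f x))).
have [c _ h] := EVT_max ab cf'.
by exists `|f c| => // x; exact: h.
Qed.

Lemma locintM f g : locint f -> continuous g -> locint (f \* g).
Proof.
move=> lf cg a b.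
have [M _ hM] := continuous_itv_bounded a b cg.
suff: mu.-integrable `[a, b] ((EFin \o g) \* (EFin \o f))%E.
  by apply: eq_integrable => // x _ /=; rewrite -EFinM mulrC.
apply: integrableMr => //.
  by apply: measurable_funS (continuous_measurable_fun cg).
exists M; split; first exact: num_real.
by move=> z Mz x /= xab; apply: le_trans (hM x _) (ltW Mz); move: xab; rewrite in_itv.
Qed.

Lemma locintMl f g : continuous g -> locint f -> locint (g \* f).
Proof.
by move=> cg lf; rewrite (_ : g \* f = f \* g); [exact: locintM | apply/funext => x; exact: mulrC].
Qed.

Lemma locint_cst k : locint (fun=> k).
Proof. by apply: locint_cont => x; exact: cvg_cst. Qed.

Lemma itgD f g a b : locint f -> locint g ->
  itg (fun x => f x + g x) a b = itg f a b + itg g a b.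
Proof.
by move=> lf lg; rewrite /itg; case: ifP => _; rewrite RintegralD// opprD.
Qed.

Lemma itgB f g a b : locint f -> locint g ->
  itg (fun x => f x - g x) a b = itg f a b - itg g a b.
Proof.
by move=> lf lg; rewrite /itg; case: ifP => _; rewrite RintegralB// opprB addrC opprK.
Qed.

Lemma itgZ k f a b : locint f -> itg (fun x => k * f x) a b = k * itg f a b.
Proof.
by move=> lf; rewrite /itg; case: ifP => _; rewrite RintegralZl// mulrN.
Qed.

Lemma itgN f a b : locint f -> itg (fun x => - f x) a b = - itg f a b.
Proof.
by move=> lf; under eq_fun do rewrite -mulN1r; rewrite itgZ// mulN1r.
Qed.

Lemma eq_itg f g a b : a <= b -> (forall x, a <= x <= b -> f x = g x) ->
  itg f a b = itg g a b.
Proof.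
move=> ab fg; rewrite !itgE//; apply: eq_Rintegral => x.
by rewrite inE/= in_itv/=; exact: fg.
Qed.

Lemma itg_le f g a b : locint f -> locint g -> a <= b ->
  (forall x, a <= x <= b -> f x <= g x) -> itg f a b <= itg g a b.
Proof.
move=> lf lg ab fg; rewrite !itgE//; apply: le_Rintegral => // x.
Qed.

Lemma itg_ge0 f a b : a <= b -> (forall x, a <= x <= b -> 0 <= f x) ->
  0 <= itg f a b.
Proof.
move=> ab f0; rewrite itgE//; apply: Rintegral_ge0 => x.
by rewrite /= in_itv/=; exact: f0.
Qed.

Lemma itg_norm f a b : locint f -> a <= b ->
  `|itg f a b| <= itg (fun x => `|f x|) a b.
Proof. by move=> lf ab; rewrite !itgE//; exact: le_normr_Rintegral. Qed.

Lemma itg_cst k a b : itg (fun=> k) a b = k * (b - a).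
Proof.
have h x y : x <= y -> \int[mu]_(t in `[x, y]) k = k * (y - x).
  move=> xy; rewrite Rintegral_cst//= lebesgue_measure_itv/= lte_fin.
  by move: xy; rewrite le_eqVlt => /predU1P[->|->]; rewrite ?ltxx ?subrr.

rewrite /itg; case: leP => ab; rewrite h// ?ltW//; lra.
Qed.

Lemma itg_split f a b c : locint f -> itg f a b + itg f b c = itg f a c.
Proof.
move=> lf.
have H x y z : x <= y -> y <= z -> itg f x y + itg f y z = itg f x z.
  move=> xy yz; rewrite !itgE// ?(le_trans xy)//; apply/esym/eqP.
  rewrite addrC -subr_eq; apply/eqP.
  rewrite -[RHS]Rintegral_itv_obnd_cbnd; last first.
    by apply: integrableS (lf y z) => //; exact: subset_itv_oc_cc.
  by apply: Rintegral_itvB; [exact: lf | rewrite bnd_simp | rewrite bnd_simp].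
have [ab|/ltW ba] := leP a b; have [bc|/ltW cb] := leP b c; have [ac|/ltW ca] := leP a c.
- exact: H.
- by have := H _ _ _ ab bc; have := H _ _ _ bc ca; have := itgC f c a;
    have := itgC f a b; have := itgC f b c; lra.
- by have := H _ _ _ ac cb; have := itgC f c b; lra.
- by have := H _ _ _ ca ab; have := itgC f c b; have := itgC f c a; lra.
- by have := H _ _ _ ba ac; have := itgC f a b; lra.
- by have := H _ _ _ bc ca; have := itgC f a b; have := itgC f a c; lra.
- by have := H _ _ _ ac cb; have := H _ _ _ cb ba; have := itgC f b c; have := itgC f a b;
    have := itgC f a c;  lra.
- by have := H _ _ _ cb ba; have := itgC f a b; have := itgC f a c; have := itgC f b c; lra.
Qed.

Lemma itg_mono f a b c : locint f -> (forall x, 0 <= f x) -> a <= b -> b <= c ->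
  itg f a b <= itg f a c.
Proof.
by move=> lf f0 ab bc; rewrite -(itg_split a b c lf) lerDl; apply: itg_ge0.
Qed.

Lemma itg_sub f a b c d : locint f -> (forall x, 0 <= f x) -> c <= a -> a <= b -> b <= d ->
  itg f a b <= itg f c d.
Proof.
move=> lf f0 ca ab bd.
rewrite -(itg_split c a d lf) -(itg_split a b d lf) addrCA lerDl addr_ge0//; exact: itg_ge0.
Qed.

Lemma itg_bound f a b M : locint f -> a <= b -> (forall x, a <= x <= b -> `|f x| <= M) ->
  `|itg f a b| <= M * (b - a).
Proof.
move=> lf ab fM; apply: le_trans (itg_norm lf ab) _; rewrite -itg_cst.
by apply: itg_le => //; [exact: locint_norm|exact: locint_cst].
Qed.

Lemma itg_bound2 f a b M : locint f ->
  (forall x, `|f x| <= M) -> `|itg f a b| <= M * `|b - a|.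
Proof.
move=> lf fM; case: (leP a b) => ab.
  by rewrite [`|b - a|]ger0_norm ?subr_ge0//; apply: itg_bound.
rewrite itgC normrN [`|b - a|]distrC [`|a - b|]gtr0_norm ?subr_gt0//; apply: itg_bound => //; exact: ltW.
Qed.

End OrientedIntegral.

(** * Primitives, differentiation and integration by parts *)

Section Calculus.
Context {R : realType}.
Local Notation mu := (@lebesgue_measure R).
Implicit Types (f g F G : R -> R) (a b c x k : R).

Lemma continuous_addf f g : continuous f -> continuous g ->
  continuous (fun x => f x + g x).
Proof. by move=> cf cg x; apply: cvgD; [exact: cf | exact: cg]. Qed.

Lemma continuous_subf f g : continuous f -> continuous g ->
  continuous (fun x => f x - g x).
Proof. by move=> cf cg x; apply: cvgB; [exact: cf | exact: cg]. Qed.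

Lemma continuous_mulf f g : continuous f -> continuous g ->
  continuous (fun x => f x * g x).
Proof. by move=> cf cg x; apply: cvgM; [exact: cf | exact: cg]. Qed.

Lemma continuous_cstf k : continuous (fun _ : R => k).
Proof. by move=> x; exact: cvg_cst. Qed.

Lemma continuous_idf : continuous (fun x : R => x).
Proof. by move=> x; exact: cvg_id. Qed.

Lemma continuous_compf f g : continuous f -> continuous g -> continuous (fun x => f (g x)).
Proof. by move=> cf cg x; apply: continuous_comp; [exact: cg | exact: cf]. Qed.

Lemma is_derive_continuous f f' : (forall x, is_derive x 1 f (f' x)) -> continuous f.
Proof.
move=> df x; apply/differentiable_continuous/derivable1_diffP.
by have := df x; case.
Qed.

Lemma is_derive_itg f a x : continuous f -> is_derive x 1 (itg f a) (f x).
Proof.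
(* A base point strictly left of [a] and [x]: the fundamental theorem is applied with lower limit
   [c], and passing to the lower limit [a] only subtracts a constant. *)
move=> cf; set c := Num.min a x - 1.
have ca : c <= a by rewrite /c lerBlDr ge_min lerDl ler01.
have cx : c < x by rewrite /c ltrBlDr gt_min ltrDl ltr01 orbT.
have xx1 : x < x + 1 by rewrite ltrDl.
have [d e] := continuous_FTC1_closed xx1
  (locint_cont cf c (x + 1)) cx (cf x).
have h : is_derive x 1 (fun y => itg f c y - itg f c a) (f x).
  apply: (@near_eq_is_derive _ _ _ (fun y => \int[mu]_(t in `[c, y]) f t - itg f c a)).
    near=> y; rewrite [itg f c y]itgE//; apply: ltW.
    by near: y; exact: lt_nbhsr.
  rewrite -[f x]subr0; apply: is_deriveB.
  by rewrite -e derive1E; exact: derivableP.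
apply: near_eq_is_derive h; near=> y.
by rewrite -(itg_split c a y (locint_cont cf)) addrC addKr.
Unshelve. all: by end_near. Qed.

Lemma itg_FTC2 F f a b : (forall x, is_derive x 1 F (f x)) -> continuous f ->
  itg f a b = F b - F a.
Proof.
move=> dF cf.
have h : forall x, is_derive x (1 : R) (fun x => F x - itg f a x) 0.
  move=> x; rewrite -(subrr (f x)); apply: is_deriveB.
  exact: is_derive_itg.
have := is_derive_0_is_cst a b h; rewrite itgxx subr0 => ->.
by rewrite opprB addrC subrK.
Qed.

Lemma continuousPe f : continuous f <-> (forall x e, 0 < e ->
  exists2 d, 0 < d & forall y, `|y - x| < d -> `|f y - f x| < e).
Proof.
split=> [cf x e e0|h x].
  have /cvgrPdist_lt/(_ e e0) := cf x.
  move=> /nbhs_ballP[d /= d0 hd]; exists d => // y xy.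
  by rewrite distrC; apply: hd; rewrite /ball/= distrC.
apply/cvgrPdist_lt => e e0; have [d d0 hd] := h x e e0.
apply/nbhs_ballP; exists d => //= y xy; rewrite distrC; apply: hd.
by move: xy; rewrite /ball/= distrC.
Qed.

Lemma lipschitz_continuous_fun f k : (forall x y, `|f x - f y| <= k * `|x - y|) ->
  continuous f.
Proof.
move=> h; apply/continuousPe => x e e0.
have k0 : 0 < `|k| + 1 by rewrite ltr_wpDl.
exists (e / (`|k| + 1)); first exact: divr_gt0.
move=> y; rewrite ltr_pdivlMr// => xy; apply: le_lt_trans (h _ _) _.
apply: le_lt_trans xy; rewrite mulrC ler_wpM2l// (le_trans (ler_norm k))// lerDl//.
Qed.

Lemma itg_continuous f a : locint f -> continuous (itg f a).
Proof.
move=> lf x; set c := x - 1; set d := x + 1.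
have cd : c < d by rewrite /c /d; lra.
have /(continuous_within_itvP _ cd)[h _ _] :=
  parameterized_integral_continuous (ltW cd) (lf c d).
have {}h := h x ltac:(rewrite in_itv/= /c /d; lra).
have E : {near x, (fun y => \int[mu]_(t in `[c, y]) f t - itg f c a) =1 itg f a}.
  near=> y; rewrite -itgE; last first.
    by apply: ltW; near: y; apply: lt_nbhsr; rewrite /c; lra.
  by rewrite -(itg_split c a y lf) addrC addKr.
have Ex : \int[mu]_(t in `[c, x]) f t - itg f c a = itg f a x.
  by rewrite -itgE ?/c; [rewrite -(itg_split c a x lf) addrC addKr|lra].
have H : (\int[mu]_(t in `[c, y]) f t - itg f c a) @[y --> x] --> itg f a x.
  by rewrite -Ex; apply: cvgB; [exact: h|exact: cvg_cst].
by apply: cvg_trans H; exact: near_eq_cvg E.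
Unshelve. all: by end_near. Qed.

Lemma itg_shift f c a b : continuous f -> itg (fun t => f (t + c)) a b = itg f (a + c) (b + c).
Proof.
move=> cf.
have cs : continuous (fun t : R => t + c).
  by apply: continuous_addf; [exact: continuous_idf|exact: continuous_cstf].
have df x : is_derive x (1:R) (fun t => itg f 0 (t + c)) (f (x + c)).
  rewrite -[f _]mulr1.
  apply: (@is_derive1_comp _ (itg f 0) (fun t => t + c)); first exact: is_derive_itg.
  by rewrite -[X in is_derive _ _ _ X]addr0; apply: is_deriveD.
rewrite (itg_FTC2 _ _ df); last exact: continuous_compf.
by rewrite -(itg_split 0 (a + c) (b + c) (locint_cont cf)) addrC addKr.
Qed.

Lemma itg_opp f a b : continuous f -> itg (fun t => f (- t)) a b = - itg f (- a) (- b).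
Proof.
move=> cf.
have cs : continuous (fun t : R => - t) by exact: opp_continuous.
have df x : is_derive x (1:R) (fun t => - itg f 0 (- t)) (f (- x)).
  rewrite -[f _]opprK; apply: is_deriveN; rewrite -mulrN1.
  by apply: (@is_derive1_comp _ (itg f 0) (fun t => - t)); exact: is_derive_itg.
rewrite (itg_FTC2 _ _ df); last exact: continuous_compf.
by rewrite -(itg_split 0 (- a) (- b) (locint_cont cf)); ring.
Qed.

(* Both sides are bilinear and bounded by the L1 norms, so that it suffices to treat continuous f and g. *)
Lemma itg_by_parts f g a b : locint f -> locint g -> a <= b ->
  itg (fun t => f t * itg g a t + itg f a t * g t) a b = itg f a b * itg g a b.
Proof.
move=> lf lg ab.
pose N f := itg (fun t => `|f t|) a b.
pose D f g := itg (fun t => f t * itg g a t + itg f a t * g t) a b - itg f a b * itg g a b.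
have N0 h : 0 <= N h by apply: itg_ge0.
have bnd h t : locint h -> a <= t <= b -> `|itg h a t| <= N h.
  move=> lh /andP[at_ tb]; apply: le_trans (itg_norm lh at_) _.
  by apply: itg_mono => //; exact: locint_norm.
have li h1 h2 : locint h1 -> locint h2 -> locint (fun t => h1 t * itg h2 a t).
  by move=> l1 l2; apply: locintM => //; exact: itg_continuous.
have li' h1 h2 : locint h1 -> locint h2 -> locint (fun t => itg h1 a t * h2 t).
  by move=> l1 l2; apply: locintMl => //; exact: itg_continuous.
have Dbnd h1 h2 : locint h1 -> locint h2 -> `|D h1 h2| <= 3 * (N h1 * N h2).
  move=> l1 l2; rewrite /D (itgD _ _ (li _ _ l1 l2) (li' _ _ l1 l2)).
  have B1 : `|itg (fun t => h1 t * itg h2 a t) a b| <= N h1 * N h2.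
    apply: le_trans (itg_norm (li _ _ l1 l2) ab) _.
    rewrite mulrC -itgZ; last exact: locint_norm.
    apply: itg_le => //; [exact/locint_norm/li|exact/locintZ/locint_norm|].
    by move=> t tab; rewrite normrM mulrC ler_wpM2r// bnd.
  have B2 : `|itg (fun t => itg h1 a t * h2 t) a b| <= N h1 * N h2.
    apply: le_trans (itg_norm (li' _ _ l1 l2) ab) _.
    rewrite -itgZ; last exact: locint_norm.
    apply: itg_le => //; [exact/locint_norm/li'|exact/locintZ/locint_norm|].
    by move=> t tab; rewrite normrM ler_wpM2r// bnd.
  have B3 : `|itg h1 a b * itg h2 a b| <= N h1 * N h2.
    by rewrite normrM ler_pM// bnd// ab lexx.
  apply: le_trans (ler_normB _ _) _.
  have := ler_normD (itg (fun t => h1 t * itg h2 a t) a b) (itg (fun t => itg h1 a t * h2 t) a b).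
  lra.
have Dl h1 h2 h3 : locint h1 -> locint h2 -> locint h3 -> D (h1 \- h2) h3 = D h1 h3 - D h2 h3.
  move=> l1 l2 l3; have l12 := locintB l1 l2.
  rewrite /D !(itgD _ _ (li _ _ _ _) (li' _ _ _ _))//.
  have -> : itg (fun t => (h1 \- h2) t * itg h3 a t) a b =
    itg (fun t => h1 t * itg h3 a t) a b - itg (fun t => h2 t * itg h3 a t) a b.
    by rewrite -itgB; [congr itg; apply/funext => t /=; ring|exact: li..].
  have -> : itg (fun t => itg (h1 \- h2) a t * h3 t) a b =
    itg (fun t => itg h1 a t * h3 t) a b - itg (fun t => itg h2 a t * h3 t) a b.
    rewrite -itgB; [|exact: li'..]; congr itg; apply/funext => t /=.
    by rewrite itgB//; ring.
  by rewrite itgB//; ring.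
have DC h1 h2 : D h1 h2 = D h2 h1.
  by rewrite /D mulrC; congr (itg _ _ _ - _); apply/funext => t; ring.
have Dcont h1 h2 : continuous h1 -> continuous h2 -> D h1 h2 = 0.
  move=> c1 c2; rewrite /D.
  have c1' : continuous (itg h1 a) by apply/itg_continuous/locint_cont.
  have c2' : continuous (itg h2 a) by apply/itg_continuous/locint_cont.
  have dd x : is_derive x (1 : R) (fun t => itg h1 a t * itg h2 a t)
      (h1 x * itg h2 a x + itg h1 a x * h2 x).
    have d1 := is_derive_itg a x c1; have d2 := is_derive_itg a x c2.
    have -> : h1 x * itg h2 a x + itg h1 a x * h2 x = itg h1 a x *: h2 x + itg h2 a x *: h1 x.
      by rewrite /GRing.scale/=; ring.
    exact: is_deriveM.
  rewrite (itg_FTC2 _ _ dd); last by apply: continuous_addf; apply: continuous_mulf.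
  by rewrite !itgxx mulr0 subr0 subrr.
have approx h e : locint h -> 0 < e -> exists2 k, continuous k & N (h \- k) < e.
  move=> lh e0.
  have [] := @approximation_continuous_integrable R `[a, b] h _ _ (lh a b) => //.
    by rewrite /= lebesgue_measure_itv/=; case: ifP; rewrite ltry.
  move=> k_ [ck ik /fine_cvgP[_ /cvgrPdist_lt/(_ e e0)[n _ /(_ n (leqnn n))]]].
  rewrite sub0r normrN => hn; exists (k_ n) => //.
  by rewrite /N itgE//; apply: le_lt_trans hn; rewrite ler_norm.
suff : D f g = 0 by move/eqP; rewrite subr_eq0 => /eqP.
have Z x : (forall e, 0 < e -> `|x| <= e) -> x = 0.
  move=> hx; apply/eqP; rewrite -normr_eq0 eq_le normr_ge0 andbT.
  by apply/ler_addgt0Pr => e e0; rewrite add0r hx.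
have step h1 h2 : continuous h1 -> locint h2 -> D h1 h2 = 0.
  move=> c1 l2; have l1 := locint_cont c1.
  apply: Z => e e0.
  have M0 : 0 < 3 * (N h1 + 1) by have := N0 h1; lra.
  have [k ck Nk] := approx h2 (e / (3 * (N h1 + 1))) l2 (divr_gt0 e0 M0).
  have -> : D h1 h2 = D (h2 \- k) h1 - 0.
    by rewrite Dl//; [rewrite DC (DC k) (Dcont h1 k)// !subr0|exact: locint_cont].
  rewrite subr0; apply: le_trans (Dbnd _ _ (locintB l2 (locint_cont ck)) l1) _.
  move: Nk; rewrite ltr_pdivlMr//; have := N0 h1; have := N0 (h2 \- k); nra.
apply: Z => e e0.
have M0 : 0 < 3 * (N g + 1) by have := N0 g; lra.
have [k ck Nk] := approx f (e / (3 * (N g + 1))) lf (divr_gt0 e0 M0).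
have -> : D f g = D (f \- k) g.
  by rewrite Dl//; [rewrite (step k g)// subr0|exact: locint_cont].
apply: le_trans (Dbnd _ _ (locintB lf (locint_cont ck)) lg) _.
by move: Nk; rewrite ltr_pdivlMr//; have := N0 g; have := N0 (f \- k); nra.
Qed.
End Calculus.

(** * Locally square-integrable functions *)

Section SquareIntegrable.
Context {R : realType}.
Local Notation mu := (@lebesgue_measure R).
Implicit Types (f g F G : R -> R) (a b c x k : R).

(** Absolute continuity enters as a representation by a primitive. Splitting off the constants [F a]
    and [G a] leaves the product of two primitives. *)
Lemma itg_by_parts_ac F G f g a b : locint f -> locint g -> a <= b ->
  (forall x, a <= x <= b -> F x = F a + itg f a x) ->
  (forall x, a <= x <= b -> G x = G a + itg g a x) ->
  itg (fun t => f t * G t + F t * g t) a b = F b * G b - F a * G a.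
Proof.
move=> lf lg ab hF hG.
have -> : itg (fun t => f t * G t + F t * g t) a b =
    itg (fun t => (G a * f t + F a * g t) + (f t * itg g a t + itg f a t * g t)) a b.
  by apply: eq_itg => // x xab; rewrite hF// hG//; ring.
have l1 : locint (fun t => G a * f t + F a * g t) by apply: locintD; exact: locintZ.
have l2 : locint (fun t => f t * itg g a t + itg f a t * g t).
  by apply: locintD; [apply: locintM|apply: locintMl] => //; exact: itg_continuous.
rewrite (itgD _ _ l1 l2) itg_by_parts// itgD ?itgZ//; try exact: locintZ.
by rewrite (hF b) ?(hG b) ?ab ?lexx//; ring.
Qed.

Lemma ae_itg f g a b : measurable_fun setT f -> measurable_fun setT g -> a <= b ->
  {ae mu, forall x, x \in `]a, b[ -> f x = g x} -> itg f a b = itg g a b.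
Proof.
move=> mf mg ab fg; rewrite !itgE// /Rintegral; congr fine.
have mE (h : R -> R) : measurable_fun setT h -> measurable_fun `]a, b[ (EFin \o h).
  by move=> mh; apply/measurable_EFinP; exact: measurable_funS mh.
have oc h : measurable_fun setT h ->
    (\int[mu]_(x in `[a, b]) (h x)%:E = \int[mu]_(x in `]a, b[) (h x)%:E)%E.
  move=> mh; rewrite -integral_itv_obnd_cbnd; last first.
    by apply/measurable_EFinP; exact: measurable_funS mh.
  rewrite -integral_itv_bndo_bndc//; exact: mE.
rewrite !oc//; apply: ae_eq_integral => //; [exact: mE..|].
by apply: (@filterS _ _ (ae_filter_ringOfSetsType mu) _ _ _ fg) => x h xab /=; rewrite h.
Qed.

(** Lebesgue differentiation: after [f] is cut off to [0, b], it is at almost every point the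
    derivative of its primitive, and this primitive vanishes near each interior point. *)
Lemma itg_eq0_ae f b : locint f -> (forall x, 0 <= x <= b -> itg f 0 x = 0) ->
  {ae mu, forall x, x \in `]0, b[ -> f x = 0}.
Proof.
move=> lf f0.
have lfb : locally_integrable setT (f \_ `[0, b]).
  exact: integrable_locally.
have int y : mu.-integrable `[0, y] (EFin \o (f \_ `[0, b])).
  rewrite -restrict_EFin; apply/integrable_restrict => //.
  apply: integrableS (lf 0 b) => //.
    exact: measurableI.
apply: (@filterS _ _ (ae_filter_ringOfSetsType mu) _ _ _ (FTC1 int lfb)) => x hx; rewrite in_itv/= => /andP[x0 xb].
have [_] := hx x0.
rewrite patchE mem_set/=; last by rewrite in_itv/= !ltW.
move=> <-; rewrite derive1E (near_eq_derive (g := cst 0)) ?derive_cst//.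
near=> y.
have y0 : 0 <= y by apply: ltW; near: y; exact: lt_nbhsr.
have yb : y <= b by apply: ltW; near: y; exact: lt_nbhsl.
transitivity (itg f 0 y); last by rewrite f0 ?y0.
rewrite itgE//; apply: eq_Rintegral => z.
rewrite inE/= in_itv/= => /andP[z0 zy]; rewrite patchE mem_set//= in_itv/= z0.
exact: le_trans yb.
Unshelve. all: by end_near. Qed.

(** Square integrability on every compact interval of the line. A coefficient in L_2(0, pi) meets it
    after extension by zero, a continuous function without any growth condition. *)
Definition sqint f := measurable_fun setT f /\ locint (fun x => f x ^+ 2).

Lemma sqint_locintM f g : sqint f -> sqint g -> locint (fun x => f x * g x).
Proof.
move=> [mf lf] [mg lg].
apply: (@le_locint _ _ (fun x => f x ^+ 2 + g x ^+ 2)).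
- exact: measurable_funM.
- move=> x; rewrite normrM [leRHS]ger0_norm ?addr_ge0 ?sqr_ge0//.
  rewrite -(real_normK (num_real (f x))) -(real_normK (num_real (g x))).
  have := normr_ge0 (f x); have := normr_ge0 (g x); nra.
- exact: locintD.
Qed.

Lemma sqint_continuous f : continuous f -> sqint f.
Proof.
move=> cf; split; first exact: continuous_measurable_fun.
by apply: locint_cont; apply: continuous_mulf.
Qed.

Lemma sqint_locint f : sqint f -> locint f.
Proof.
move=> sf; have := sqint_locintM sf (sqint_continuous (@continuous_cstf R 1)).
by under eq_fun do rewrite mulr1.
Qed.

Lemma sqintD f g : sqint f -> sqint g -> sqint (fun x => f x + g x).
Proof.
move=> sf sg; split; first by apply: measurable_funD; [case: sf|case: sg].
have -> : (fun x => (f x + g x) ^+ 2) = (fun x => (f x ^+ 2 + 2 * (f x * g x)) + g x ^+ 2).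
  by apply/funext => x; ring.
apply: locintD; last by case: sg.
by apply: locintD; [case: sf|apply: locintZ; exact: sqint_locintM].
Qed.

Lemma sqintZ k f : sqint f -> sqint (fun x => k * f x).
Proof.
move=> [mf lf]; split; first exact: measurable_funM.
have -> : (fun x => (k * f x) ^+ 2) = (fun x => k ^+ 2 * f x ^+ 2).
  by apply/funext => x; ring.
exact: locintZ.
Qed.

Lemma sqintMl f g : sqint f -> continuous g -> sqint (fun x => g x * f x).
Proof.
move=> [mf lf] cg; split.
  by apply: measurable_funM => //; exact: continuous_measurable_fun.
have -> : (fun x => (g x * f x) ^+ 2) = (fun x => (g x * g x) * f x ^+ 2).
  by apply/funext => x; ring.
by apply: locintMl => //; exact: continuous_mulf.
Qed.

Lemma itg_expR k x : 0 < k -> itg (fun t => expR (k * t)) 0 x = (expR (k * x) - 1) / k.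
Proof.
move=> k0.
have ck : continuous (fun t : R => k * t).
  by apply: continuous_mulf; [exact: continuous_cstf|exact: continuous_idf].
have dd y : is_derive y (1 : R) (fun t => k^-1 * expR (k * t)) (expR (k * y)).
  have d1 : is_derive y (1 : R) (fun t => k * t) k.
    by rewrite -[X in is_derive _ _ _ X]mulr1; apply: is_deriveZ.
  have d2 : is_derive y (1:R) (fun t => expR (k * t)) (expR (k * y) * k).
    by apply: (@is_derive1_comp _ expR (fun t => k * t)).
  have -> : expR (k * y) = k^-1 * (expR (k * y) * k) by field; rewrite gt_eqF.
  exact: is_deriveZ.
rewrite (itg_FTC2 _ _ dd); last by apply: continuous_compf => //; exact: continuous_expR.
by rewrite mulr0 expR0; field; rewrite gt_eqF.
Qed.

(* AM-GM: [|q| <= d q^2 + 1 / (4 d)] *)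
Lemma itg_weighted_small f b e : sqint f -> 0 <= b -> 0 < e -> exists2 k, 0 < k &
  forall x, 0 <= x <= b -> itg (fun t => `|f t| * expR (k * t)) 0 x <= e * expR (k * x).
Proof.
move=> sf b0 e0; have [mf lf] := sf.
pose Q := itg (fun t => f t ^+ 2) 0 b.
have Q0 : 0 <= Q by apply: itg_ge0 => // x _; exact: sqr_ge0.
(* [d] keeps the quadratic term below half of the target, since [d * Q <= e / 2]; [k] is then chosen
   so that the other term, with factor [1 / (4 * d * k)], has exactly [e / 2]. *)
pose d := e / (2 * (Q + 1)); pose k := (2 * d * e)^-1.
have d0 : 0 < d by rewrite divr_gt0//; lra.
have k0 : 0 < k by rewrite /k invr_gt0; apply: mulr_gt0 => //; apply: mulr_gt0.
exists k => // x /andP[x0 xb].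
have ce : continuous (fun t => expR (k * t)).
  apply: continuous_compf; first exact: continuous_expR.
  by apply: continuous_mulf; [exact: continuous_cstf|exact: continuous_idf].
have le := locint_cont ce.
apply: (@le_trans _ _ (itg (fun t => d * expR (k * x) * f t ^+ 2 + (4 * d)^-1 * expR (k * t)) 0 x)).
  apply: itg_le => //.
  - by apply: locintM => //; apply/locint_norm/sqint_locint.
  - by apply: locintD; exact: locintZ.
  - move=> t /andP[t0 tx].
    have ex : expR (k * t) <= expR (k * x) by rewrite ler_expR ler_pM2l.
    have et := expR_gt0 (k * t).
    apply: (@le_trans _ _ ((d * f t ^+ 2 + (4 * d)^-1) * expR (k * t))).
      rewrite ler_pM2r//.
      rewrite -subr_ge0 -(real_normK (num_real (f t))).
      have -> : d * `|f t| ^+ 2 + (4 * d)^-1 - `|f t| = (2 * d * `|f t| - 1) ^+ 2 / (4 * d).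
        by field; rewrite gt_eqF.
      by apply: divr_ge0; [exact: sqr_ge0|apply: mulr_ge0 => //; exact: ltW].
    rewrite mulrDl lerD2r -mulrA [_ * expR (k * t)]mulrC mulrA ler_wpM2r ?sqr_ge0//.
    by rewrite ler_pM2l.
rewrite itgD ?itgZ//; try exact: locintZ.
rewrite itg_expR//.
have hQ : itg (fun t => f t ^+ 2) 0 x <= Q.
  by apply: itg_mono => // t; exact: sqr_ge0.
have ex := expR_gt0 (k * x).
have h1 : d * expR (k * x) * itg (fun t => f t ^+ 2) 0 x <= e / 2 * expR (k * x).
  rewrite mulrAC ler_pM2r//; apply: le_trans (ler_wpM2l (ltW d0) hQ) _.
  rewrite /d mulrAC ler_pdivrMr; last by lra.
  by nra.
have h2 : (4 * d)^-1 * ((expR (k * x) - 1) / k) <= e / 2 * expR (k * x).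
  have -> : (4 * d)^-1 * ((expR (k * x) - 1) / k) = e / 2 * (expR (k * x) - 1).
    by rewrite /k; field; rewrite !gt_eqF.
  by apply: ler_wpM2l; [rewrite divr_ge0// ltW|rewrite lerBlDr lerDl].
lra.
Qed.
End SquareIntegrable.

(** * Contractions measured pointwise against a weight *)

Section Contraction.
Context {R : realType}.

(** The gain can be iterated, so [|d|] is at most [theta ^+ n * N * w] for every n. The weight
    varies with the point and may vanish, hence the pointwise formulation instead of a norm. *)
Lemma contraction_zero (T : Type) (d w : T -> R) (theta N : R) :
  0 <= theta < 1 -> (forall x, 0 <= w x) ->
  (forall N, 0 <= N -> (forall x, `|d x| <= N * w x) -> forall x, `|d x| <= theta * N * w x) ->
  0 <= N -> (forall x, `|d x| <= N * w x) -> forall x, d x = 0.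
Proof.
move=> /andP[t0 t1] w0 h N0 dN x.
have H n : forall x, `|d x| <= theta ^+ n * N * w x.
  elim: n => [|n IH]; first by rewrite expr0 mul1r.
  have -> : theta ^+ n.+1 * N = theta * (theta ^+ n * N) by rewrite exprS mulrA.
  by apply: h => //; apply: mulr_ge0 => //; exact: exprn_ge0.
have cv : (fun n => theta ^+ n * N * w x) @ \oo --> (0 : R).
  rewrite -(mul0r (w x)) -(mul0r N); apply: cvgM; last exact: cvg_cst.
  apply: cvgM; last exact: cvg_cst.
  by apply: cvg_expr; rewrite ger0_norm.
apply/eqP; rewrite -normr_eq0 eq_le normr_ge0 andbT.
rewrite -(cvg_lim (@Rhausdorff R) cv).
by apply: limr_ge; [apply/cvg_ex; exists 0|near=> n; exact: H].
Unshelve. all: by end_near. Qed.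

(* The iterates [u n] of [u |-> f + V u] satisfy [u n - K theta^n w] increasing and
   [u n + K theta^n w] decreasing, with [K = N / (1 - theta)]. *)
Lemma contraction_fixpoint (T : Type) (C : (T -> R) -> Prop) (V : (T -> R) -> T -> R)
    (w f : T -> R) (theta N B : R) :
  0 <= theta < 1 -> (forall x, 0 <= w x <= B) -> 0 <= N ->
  C f -> (forall x, `|f x| <= N * w x) ->
  C (fun=> 0) -> (forall x, V (fun=> 0) x = 0) ->
  (forall u v, C u -> C v -> C (fun x => u x + v x)) ->
  (forall u, (forall e, 0 < e -> exists2 v, C v & forall x, `|u x - v x| <= e) -> C u) ->
  (forall u, C u -> C (V u)) ->
  (forall u v N, 0 <= N -> C u -> C v -> (forall x, `|u x - v x| <= N * w x) ->
    forall x, `|V u x - V v x| <= theta * N * w x) ->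
  exists u, [/\ C u, forall x, u x = f x + V u x & forall x, `|u x| <= N / (1 - theta) * w x].
Proof.
move=> /andP[t0 t1] w0 N0 Cf fN C0 V0 CD Clim CV Vc.
pose U n := iter n (fun u x => f x + V u x) (fun=> 0).
have CU n : C (U n) by elim: n => //= n IH; apply: CD => //; exact: CV.
pose K := N / (1 - theta).
have K0 : 0 <= K by rewrite divr_ge0// subr_ge0 ltW.
have KN : N + theta * K = K by rewrite /K; field; rewrite subr_eq0 eq_sym; apply: contraTneq t1 => ->; rewrite ltxx.
have dU n x : `|U n.+1 x - U n x| <= theta ^+ n * N * w x.
  elim: n x => [|n IH] x; first by rewrite /U /= V0 addr0 subr0 expr0 mul1r.
  have -> : U n.+2 x - U n.+1 x = V (U n.+1) x - V (U n) x by rewrite /U /=; ring.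
  have -> : theta ^+ n.+1 * N = theta * (theta ^+ n * N) by rewrite exprS mulrA.
  apply: Vc => //.
  by apply: mulr_ge0 => //; exact: exprn_ge0.
pose E n x := theta ^+ n * K * w x.
have mono n x : U n x - E n x <= U n.+1 x - E n.+1 x /\ U n.+1 x + E n.+1 x <= U n x + E n x.
  have := dU n x; rewrite ler_norml => /andP[h1 h2].
  have -> : E n x = theta ^+ n * N * w x + E n.+1 x.
    by rewrite /E -[in LHS]KN exprS; ring.
  by split; lra.
have monom n m x : U n x - E n x <= U (n + m)%N x - E (n + m)%N x /\
    U (n + m)%N x + E (n + m)%N x <= U n x + E n x.
  elim: m => [|m [IH1 IH2]]; first by rewrite addn0.
  rewrite addnS; have [h1 h2] := mono (n + m)%N x; split; [exact: le_trans h1|exact: le_trans IH2].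
have E0 n x : 0 <= E n x.
  apply: mulr_ge0; last by have /andP[] := w0 x.
  by apply: mulr_ge0 => //; exact: exprn_ge0.
have cross n m x : U n x - E n x <= U m x + E m x.
  have [h1 _] := monom n m x; have [_ h2] := monom m n x; rewrite addnC in h2.
  have := E0 (n + m)%N x; lra.
pose u x := sup [set U n x - E n x | n in [set: nat]].
have uU n x : `|u x - U n x| <= E n x.
  rewrite ler_distl; apply/andP; split.
    apply: ub_le_sup; last by exists n.
    by exists (U 0%N x + E 0%N x) => _ [m _ <-].
  apply: ge_sup; first by exists (U 0%N x - E 0%N x); exists 0%N.
  by move=> _ [m _ <-].
(* The bound [B] on the weight makes the pointwise error uniform, which is what closure of [C] under
   uniform limits asks for. *)
have EB n x : E n x <= theta ^+ n * K * B.
  rewrite ler_wpM2l//; last by have /andP[] := w0 x.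
  by apply: mulr_ge0 => //; exact: exprn_ge0.
have small e c : 0 < e -> exists n, theta ^+ n * c < e.
  move=> e0.
  have cv : (fun n => theta ^+ n * c) @ \oo --> (0 : R).
    rewrite -(mul0r c); apply: cvgM; last exact: cvg_cst.
    by apply: cvg_expr; rewrite ger0_norm.
  move/cvgrPdist_lt : cv => /(_ e e0)[n _ /(_ n (leqnn n))].
  by rewrite sub0r normrN => h; exists n; apply: le_lt_trans h; exact: ler_norm.
have Cu : C u.
  apply: Clim => e e0; have [n hn] := small e (K * B) e0.
  exists (U n) => // x; apply: le_trans (uU n x) _; apply: le_trans (EB n x) _.
  by rewrite -mulrA ltW.
exists u; split => //.
- move=> x; apply/eqP; rewrite -subr_eq0 -normr_eq0 eq_le normr_ge0 andbT.
  apply/ler_addgt0Pr => e e0; rewrite add0r.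
  (* The defect of [u] is [u - U n.+1] plus [V (U n) - V u]; each part is at most [E n], whence the
     factor 2. *)
  have [n hn] := small e (2 * K * w x) e0.
  have := Vc (U n) u (theta ^+ n * K) (mulr_ge0 (exprn_ge0 n t0) K0) (CU n) Cu.
  move=> /(_ (fun y => _) x) h.
  have {}h := h ltac:(by move=> y; rewrite distrC; exact: uU).
  have h2 := uU n.+1 x.
  have -> : u x - (f x + V u x) = (u x - U n.+1 x) + (V (U n) x - V u x).
    by rewrite /U /=; ring.
  apply: le_trans (ler_normD _ _) _; apply: le_trans (ltW hn).
  have h3 : E n.+1 x <= E n x.
    have -> : E n.+1 x = theta * E n x by rewrite /E exprS; ring.
    by apply: ler_piMl; [exact: E0|exact: ltW].
  have h4 : theta * (theta ^+ n * K) * w x <= E n x.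
    by move: h3; rewrite /E exprS mulrA.
  have -> : theta ^+ n * (2 * K * w x) = E n x + E n x by rewrite /E; ring.
  by apply: lerD; [exact: le_trans h3|exact: le_trans h4].
- by move=> x; have := uU 0%N x; rewrite /U/= subr0 /E expr0 mul1r.
Qed.

End Contraction.

(** * The Cauchy problem with a square-integrable potential *)

Section CauchyProblem.
Context {R : realType}.
Local Notation mu := (@lebesgue_measure R).
Implicit Types (f g p q : R -> R) (a b c x k : R).

(** Clamping to [0, pi]. Functions on the interval are composed with [cl], which makes them
    continuous on the whole line and lets agreement on the interval become equality of functions. *)
Definition cl x : R := Num.max 0 (Num.min x pi).

Lemma cl_itv x : 0 <= cl x <= pi.
Proof. by rewrite /cl le_max lexx/= ge_max pi_ge0 ge_min lexx orbT. Qed.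

Lemma cl_id x : 0 <= x <= pi -> cl x = x.
Proof.
by move=> /andP[x0 xp]; rewrite /cl [Num.min _ _]min_l// max_r.
Qed.

Lemma clcl x : cl (cl x) = cl x. Proof. by rewrite cl_id// cl_itv. Qed.

Lemma cl_le x y : x <= y -> cl x <= cl y.
Proof.
move=> xy; rewrite /cl ge_max le_max lexx/= le_max; apply/orP; right.
by rewrite le_min !ge_min xy lexx/= orbT.
Qed.

Lemma cl_lip x y : `|cl x - cl y| <= `|x - y|.
Proof.
wlog yx : x y / y <= x.
  move=> H; case: (leP y x) => [/H //|/ltW /H]; by rewrite distrC [leRHS]distrC.
rewrite !ger0_norm ?subr_ge0 ?cl_le// /cl.
have := @pi_ge0 R; case: (leP x pi) => ?; case: (leP y pi) => ?; try case: (leP 0 x) => ?;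
  try case: (leP 0 y) => ?; try case: (leP 0 pi) => ?; lra.
Qed.

Lemma cl_continuous : continuous cl.
Proof.
by apply: (@lipschitz_continuous_fun _ _ 1) => x y; rewrite mul1r cl_lip.
Qed.

Lemma continuous_uniform_limit f :
  (forall e, 0 < e -> exists2 g, continuous g & forall x, `|f x - g x| <= e) -> continuous f.
Proof.
move=> h; apply/continuousPe => x e e0.
have e4 : 0 < e / 4 by apply: divr_gt0.
have [g cg hg] := h _ e4.
have [d d0 hd] := (continuousPe g).1 cg x _ e4; exists d => // y /hd xy.
have := hg x; have := hg y; rewrite !ler_distl; move: xy; rewrite !ltr_distl; lra.
Qed.

(* The solutions of [y'' = p y - f] on [0, pi] with derivative y1, extended to the line by constants. *)
Definition sl_sol p f (y y1 : R -> R) :=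
  [/\ continuous y, continuous y1, forall x, y (cl x) = y x, forall x, y1 (cl x) = y1 x &
   forall x, 0 <= x <= pi -> y x = y 0 + itg y1 0 x /\
     y1 x = y1 0 + itg (fun t => p t * y t - f t) 0 x].

Lemma cl_continuous_bounded f : continuous f -> (forall x, f (cl x) = f x) ->
  exists2 M, 0 <= M & forall x, `|f x| <= M.
Proof.
move=> cf fcl; have [M M0 h] := continuous_itv_bounded 0 pi cf.
by exists M => // x; rewrite -fcl h// cl_itv.
Qed.

Lemma expR_ge1 k x : 0 <= k -> 0 <= x -> 1 <= expR (k * x).
Proof. by move=> k0 x0; rewrite -expR0 ler_expR mulr_ge0. Qed.

Lemma expR_cl_bounds k x : 0 < k -> 1 <= expR (k * cl x) <= expR (k * pi).
Proof.
move=> k0; have /andP[c0 c1] := cl_itv x.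
by rewrite expR_ge1 ?(ltW k0)//= ler_expR ler_pM2l.
Qed.

Lemma continuous_expRM k : continuous (fun t => expR (k * t)).
Proof.
apply: continuous_compf; first exact: continuous_expR.
by apply: continuous_mulf; [exact: continuous_cstf|exact: continuous_idf].
Qed.

Lemma itg_le_weight k (u : R -> R) N x : 0 < k -> 0 <= x <= pi -> continuous u -> 0 <= N ->
  (forall t, 0 <= t <= pi -> `|u t| <= N * expR (k * t)) -> `|itg u 0 x| <= N * pi * expR (k * x).
Proof.
move=> k0 /andP[x0 xpi] cu N0 hu.
apply: (@le_trans _ _ (N * expR (k * x) * (x - 0))).
  apply: itg_bound => //; first exact: locint_cont.
  move=> t /andP[t0 tx]; apply: le_trans (hu t _) _; first by rewrite t0 (le_trans tx).
  by apply: ler_wpM2l => //; rewrite ler_expR ler_pM2l.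
rewrite subr0 mulrAC ler_wpM2r ?expR_ge0//.
exact: ler_wpM2l.
Qed.

(** The problem is solved for the derivative [u = y1], with [y] recovered as [y 0 + itg u 0]; this
    is the resulting Volterra operator acting on [u]. *)
Definition potint p (u : R -> R) x := itg (fun t => p t * itg u 0 t) 0 (cl x).

Lemma locint_potint p (u : R -> R) : locint p -> continuous u ->
  locint (fun t => p t * itg u 0 t).
Proof. by move=> lp cu; apply: locintM => //; apply/itg_continuous/locint_cont. Qed.

(** The inner integral costs a factor [pi] against the weight [expR (k * x)]. Since [p] is only
    square integrable, [k] is taken from [itg_weighted_small] with [e = 1 / (2 * pi)], which leaves
    the factor one half. *)
Lemma potint_contraction p : sqint p -> exists2 k, 0 < k &
  forall (u v : R -> R) N, 0 <= N -> continuous u -> continuous v ->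
    (forall x, `|u x - v x| <= N * expR (k * cl x)) ->
  forall x, `|potint p u x - potint p v x| <= 2^-1 * N * expR (k * cl x).
Proof.
move=> sp; have lp := sqint_locint sp.
have pi0 : 0 < pi :> R by exact: pi_gt0.
have [k k0 hk] := itg_weighted_small sp (ltW pi0) (divr_gt0 (@ltr01 R) (mulr_gt0 (@ltr0n R 2) pi0)).
exists k => // u v N N0 cu cv uv x.
rewrite /potint -itgB; [|exact: locint_potint..].
have /andP[c0 c1] := cl_itv x.
have cuv : continuous (fun t => u t - v t) by exact: continuous_subf.
have -> : itg (fun t => p t * itg u 0 t - p t * itg v 0 t) 0 (cl x) =
    itg (fun t => p t * itg (fun t => u t - v t) 0 t) 0 (cl x).
  by congr itg; apply/funext => t; rewrite -mulrBr itgB//; exact: locint_cont.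
apply: le_trans (itg_norm (locint_potint lp cuv) c0) _.
apply: (@le_trans _ _ (itg (fun t => N * pi * (`|p t| * expR (k * t))) 0 (cl x))).
  have lw : locint (fun t => `|p t| * expR (k * t)).
    by apply: locintM; [exact: locint_norm|exact: continuous_expRM].
  apply: itg_le => //; [exact/locint_norm/locint_potint|exact: locintZ|].
  move=> t /andP[t0 tc]; have tpi : 0 <= t <= pi by rewrite t0 (le_trans tc).
  rewrite normrM mulrCA ler_wpM2l//; apply: itg_le_weight => // s spi.
  by have := uv s; rewrite cl_id.
rewrite itgZ; last by apply: locintM; [exact: locint_norm|exact: continuous_expRM].
apply: le_trans (ler_wpM2l _ (hk _ _)) _; rewrite ?c0//.
  by rewrite mulr_ge0// ltW.
have gen (P E : R) : 0 < P -> N * P * (1 / (2 * P) * E) = 2^-1 * N * E by move=> P0; field; rewrite gt_eqF.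
by rewrite gen.
Qed.

Lemma potint_continuous p (u : R -> R) : locint p -> continuous u -> continuous (potint p u).
Proof.
move=> lp cu; apply: continuous_compf; last exact: cl_continuous.
by apply: itg_continuous; exact: locint_potint.
Qed.

(** The constant depends on [p] alone, and [f] enters by its L1 norm only. This uniformity is what
    later yields boundedness and compactness of the resolvent. *)
Lemma sl_exists p : sqint p -> exists2 K, 0 <= K &
  forall f a b, locint f -> exists y y1, [/\ sl_sol p f y y1, y 0 = a, y1 0 = b &
    forall x, `|y x| <= K * (`|a| + `|b| + itg (fun t => `|f t|) 0 pi) /\
              `|y1 x| <= K * (`|a| + `|b| + itg (fun t => `|f t|) 0 pi)].
Proof.
move=> sp; have lp := sqint_locint sp.
have pi0 : 0 < pi :> R by exact: pi_gt0.
have [k k0 hk] := potint_contraction sp.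
pose P := itg (fun t => `|p t|) 0 pi.
have P0 : 0 <= P by apply: itg_ge0 => //; exact: ltW.
pose L := 2 * (1 + P) * expR (k * pi).
have e1 : 1 <= expR (k * pi) by apply: expR_ge1; exact: ltW.
have L0 : 0 <= L by rewrite /L; apply: mulr_ge0; lra.
exists (1 + L + L * pi).
  by rewrite addr_ge0 ?addr_ge0// mulr_ge0// ltW.
move=> f a b lf.
set S := `|a| + `|b| + itg _ 0 pi.
(* Inserting [y = a + itg u 0] into the equation for [u = y1] gives [u = F + potint p u]. *)
pose F x := b + itg (fun t => p t * a - f t) 0 (cl x).
have lpa : locint (fun t => p t * a) by under eq_fun do rewrite mulrC; exact: locintZ.
have lF : locint (fun t => p t * a - f t) by exact: locintB.
have cF : continuous F.
  apply: continuous_addf; first exact: continuous_cstf.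
  by apply: continuous_compf; [exact: itg_continuous|exact: cl_continuous].
have Nf0 : 0 <= itg (fun t => `|f t|) 0 pi by apply: itg_ge0 => //; exact: ltW.
have N0 : 0 <= (1 + P) * S.
  by rewrite mulr_ge0// addr_ge0// addr_ge0.
have Fb x : `|F x| <= (1 + P) * S * expR (k * cl x).
  have /andP[ce _] := expR_cl_bounds x k0.
  have /andP[c0 c1] := cl_itv x.
  apply: (@le_trans _ _ ((1 + P) * S)); last by rewrite ler_peMr.
  have h1 : `|itg (fun t => p t * a) 0 (cl x)| <= P * `|a|.
    apply: le_trans (itg_norm lpa c0) _.
    under eq_fun do rewrite normrM mulrC; rewrite itgZ; last exact: locint_norm.
    rewrite mulrC ler_wpM2r// itg_mono//; exact: locint_norm.
  have h2 : `|itg f 0 (cl x)| <= itg (fun t => `|f t|) 0 pi.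
    by apply: le_trans (itg_norm lf c0) _; apply: itg_mono => //; exact: locint_norm.
  rewrite /F itgB//.
  apply: le_trans (ler_normD _ _) _; have := ler_normB (itg (fun t => p t * a) 0 (cl x)) (itg f 0 (cl x)).
  have := normr_ge0 a; have := normr_ge0 b; rewrite /S; nra.
have [] := @contraction_fixpoint R R (fun u => continuous u /\ forall x, u (cl x) = u x) (potint p)
  (fun x => expR (k * cl x)) F 2^-1 ((1 + P) * S) (expR (k * pi)) _ _ N0 _ Fb.
- lra.
- by move=> x; have /andP[h ->] := expR_cl_bounds x k0; rewrite andbT expR_ge0.
- by split=> // x; rewrite /F clcl.
- by split=> //; exact: continuous_cstf.
- move=> x; rewrite /potint.
  have -> : (fun t => p t * itg (fun=> 0) 0 t) = (fun=> 0).
    by apply/funext => t; rewrite itg_cst mul0r mulr0.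
  by rewrite itg_cst mul0r.
- move=> u v [cu ucl] [cv vcl]; split; first exact: continuous_addf.
  by move=> x; rewrite ucl vcl.
- move=> u h; split.
    by apply: continuous_uniform_limit => e /h[v [cv _] hv]; exists v.
  move=> x; apply/eqP; rewrite -subr_eq0 -normr_eq0 eq_le normr_ge0 andbT.
  apply/ler_addgt0Pr => e e0; rewrite add0r.
  have [v [_ vcl] hv] := h (e / 2) (divr_gt0 e0 (@ltr0n R 2)).
  have := hv x; have := hv (cl x); rewrite vcl !ler_norml; lra.
- move=> u [cu _]; split; first exact: potint_continuous.
  by move=> x; rewrite /potint clcl.
- by move=> u v N HN [cu _] [cv _]; exact: hk.
move=> u [[cu ucl] eu bu].
have lu := locint_cont cu.
pose y x := a + itg u 0 (cl x).
have cy : continuous y.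
  apply: continuous_addf; first exact: continuous_cstf.
  by apply: continuous_compf; [exact: itg_continuous|exact: cl_continuous].
have cl0 : cl 0 = 0 by rewrite cl_id// lexx ltW.
have y0 : y 0 = a by rewrite /y cl0 itgxx addr0.
have u0 : u 0 = b by rewrite eu /F /potint cl0 !itgxx !addr0.
have bu' x : `|u x| <= L * S.
  apply: le_trans (bu x) _; have /andP[_ h] := expR_cl_bounds x k0.
  apply: le_trans (ler_wpM2l _ h) _; first by apply: divr_ge0 => //; lra.
  by rewrite le_eqVlt; apply/orP; left; apply/eqP; rewrite /L; field.
have S0 : 0 <= S by rewrite !addr_ge0.
exists y, u; split => //.
  split => //; first by move=> x; rewrite /y clcl.
  move=> x x0; rewrite y0 u0 {1}/y cl_id//; split => //.
  rewrite eu /F /potint cl_id// -addrA; congr (_ + _).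
  rewrite -itgD//; last exact: locint_potint.
  have /andP[h0 h1] := x0.
  apply: eq_itg => // t /andP[t0 tx]; rewrite /y cl_id ?t0 ?(le_trans tx)//; ring.
move=> x; split; last first.
  apply: le_trans (bu' x) _; apply: ler_wpM2r => //.
  by rewrite addrAC lerDr addr_ge0// mulr_ge0// ltW.
have /andP[c0 c1] := cl_itv x.
apply: le_trans (ler_normD _ _) _.
have h1 : `|itg u 0 (cl x)| <= L * S * (cl x - 0) by apply: itg_bound.
have h2 : L * S * (cl x - 0) <= L * S * pi by rewrite subr0 ler_wpM2l// mulr_ge0.
have h3 : `|a| <= S by rewrite /S -addrA lerDl addr_ge0.
have : 0 <= L * S by exact: mulr_ge0.
lra.
Qed.

Lemma sl_lin p f g y y1 z z1 c : locint p -> locint f -> locint g ->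
  sl_sol p f y y1 -> sl_sol p g z z1 ->
  sl_sol p (fun t => f t + c * g t) (fun t => y t + c * z t) (fun t => y1 t + c * z1 t).
Proof.
move=> lp lf lg [cy cy1 ycl y1cl ye] [cz cz1 zcl z1cl ze].
have cc (h : R -> R) : continuous h -> continuous (fun t => c * h t).
  by move=> ch; apply: continuous_mulf => //; exact: continuous_cstf.
split; try by apply: continuous_addf => //; exact: cc.
- by move=> x; rewrite ycl zcl.
- by move=> x; rewrite y1cl z1cl.
move=> x x0; have [e1 e2] := ye x x0; have [e3 e4] := ze x x0; split.
  rewrite itgD ?itgZ//; try exact: locint_cont; last exact/locint_cont/cc.
  by rewrite e1 e3; ring.
have -> : (fun t => p t * (y t + c * z t) - (f t + c * g t)) =
  (fun t => (p t * y t - f t) + c * (p t * z t - g t)) by apply/funext => t; ring.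
have l1 : locint (fun t => p t * y t - f t) by apply: locintB => //; exact: locintM.
have l2 : locint (fun t => p t * z t - g t) by apply: locintB => //; exact: locintM.
rewrite itgD ?itgZ//; last exact: locintZ.
by rewrite e2 e4; ring.
Qed.

(** With zero Cauchy data [y1] is a fixed point of the linear contraction [potint p], hence zero. *)
Lemma sl_zero p f y y1 : sqint p -> locint f -> (forall x, 0 <= x <= pi -> itg f 0 x = 0) ->
  sl_sol p f y y1 -> y 0 = 0 -> y1 0 = 0 -> (forall x, y x = 0) /\ (forall x, y1 x = 0).
Proof.
move=> sp lf f0 [cy cy1 ycl y1cl ye] y0 y10; have lp := sqint_locint sp.
have [k k0 hk] := potint_contraction sp.
have [M M0 hM] := cl_continuous_bounded cy1 y1cl.
have e1 x : y1 x = potint p y1 x.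
  have cx := cl_itv x; have /andP[c0 c1] := cx; rewrite -y1cl; have [_ ->] := ye _ cx; rewrite y10 add0r /potint.
  rewrite itgB//; last exact: locintM.
  rewrite f0// subr0; apply: eq_itg => // t /andP[t0 tx].
  by have [-> _] := ye t ltac:(by rewrite t0 (le_trans tx)); rewrite y0 add0r.
have z0 x : potint p (fun=> 0) x = 0.
  rewrite /potint.
  have -> : (fun t => p t * itg (fun=> 0) 0 t) = (fun=> 0).
    by apply/funext => t; rewrite itg_cst mul0r mulr0.
  by rewrite itg_cst mul0r.
have y1z x : y1 x = 0.
  apply: (@contraction_zero R R y1 (fun x => expR (k * cl x)) 2^-1 M) => //.
  - lra.
  - move=> N N0 hN t; rewrite {1}e1 -[potint _ _ _]subr0 -(z0 t); apply: hk => //.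
    + exact: continuous_cstf.
    + by move=> s; rewrite subr0.
  - move=> t; apply: le_trans (hM t) _; have /andP[h _] := expR_cl_bounds t k0.
    by rewrite ler_peMr.
split=> // x; rewrite -ycl; have cx := cl_itv x; have [-> _] := ye _ cx; rewrite y0 add0r.
have -> : y1 = (fun=> 0) by apply/funext.
by rewrite itg_cst mul0r.
Qed.

End CauchyProblem.

(** * Density of eigenvectors in the range of a compact symmetric operator *)

Section CompactSymmetric.
Context {R : realType} (V : lmodType R) (E : V -> Prop) (ip : V -> V -> R) (A : V -> V).
Hypothesis ED : forall u v, E u -> E v -> E (u + v).
Hypothesis EZ : forall k u, E u -> E (k *: u).
Hypothesis ipC : forall u v, ip u v = ip v u.
Hypothesis ipDl : forall u v w, E u -> E v -> E w -> ip (u + v) w = ip u w + ip v w.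
Hypothesis ipZl : forall k u w, E u -> E w -> ip (k *: u) w = k * ip u w.
Hypothesis ip_ge0 : forall u, 0 <= ip u u.
Hypothesis AE : forall u, E u -> E (A u).
Hypothesis AD : forall u v, E u -> E v -> A (u + v) = A u + A v.
Hypothesis AZ : forall k u, E u -> A (k *: u) = k *: A u.
Hypothesis Asym : forall u v, E u -> E v -> ip (A u) v = ip u (A v).
Variable K : R.
Hypothesis Abnd : forall u, E u -> ip (A u) (A u) <= K * ip u u.
Hypothesis Acomp : forall (F : nat -> V) B, (forall n, E (F n)) -> (forall n, ip (F n) (F n) <= B) ->
  exists2 G, E G & forall e n0, 0 < e -> exists2 n, (n0 <= n)%N & ip (A (F n) - G) (A (F n) - G) < e.
(** The product is only semidefinite, because functions that agree almost everywhere are not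
    identified. This and the next hypothesis say that [A] sends null vectors to zero exactly and
    that only null vectors have null images. *)
Hypothesis Anull : forall u, E u -> ip u u = 0 -> A u = 0.
Hypothesis Ainj : forall u, E u -> ip (A u) (A u) = 0 -> ip u u = 0.
Variables (U : nat -> V) (mu : nat -> R).
Hypothesis UE : forall n, E (U n).
Hypothesis AU : forall n, A (U n) = mu n *: U n.
Hypothesis Uorth : forall m n, m != n -> ip (U m) (U n) = 0.
Hypothesis Upos : forall n, 0 < ip (U n) (U n).
Hypothesis Umax : forall w l, E w -> l != 0 -> A w = l *: w -> (forall n, ip w (U n) = 0) -> ip w w = 0.

Let nq u := ip u u.

Let E0 : E 0.
Proof. by rewrite -(scale0r (U 0%N)); exact: EZ. Qed.

Let EB u v : E u -> E v -> E (u - v).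
Proof. by move=> Eu Ev; rewrite -scaleN1r; apply: ED => //; exact: EZ. Qed.

Let AB u v : E u -> E v -> A (u - v) = A u - A v.
Proof.
move=> Eu Ev; have EN := EZ (-1) Ev.
by rewrite -scaleN1r (AD Eu EN) (AZ _ Ev) scaleN1r.
Qed.

Let ipDr u v w : E u -> E v -> E w -> ip w (u + v) = ip w u + ip w v.
Proof. by move=> *; rewrite ipC ipDl// ipC [ip v w]ipC. Qed.

Let ipZr k u w : E u -> E w -> ip w (k *: u) = k * ip w u.
Proof. by move=> *; rewrite ipC ipZl// ipC. Qed.

Let ipBl u v w : E u -> E v -> E w -> ip (u - v) w = ip u w - ip v w.
Proof.
move=> Eu Ev Ew; have EN := EZ (-1) Ev.
by rewrite -scaleN1r (ipDl Eu EN Ew) ipZl// mulN1r.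
Qed.

Let nqD u v : E u -> E v -> nq (u + v) = nq u + 2 * ip u v + nq v.
Proof.
move=> Eu Ev; have Euv := ED Eu Ev.
rewrite /nq ipDl ?ipDr// [ip v u]ipC; ring.
Qed.

Let nqZ k u : E u -> nq (k *: u) = k ^+ 2 * nq u.
Proof.
by move=> Eu; have Ek := EZ k Eu; rewrite /nq (ipZl _ Eu Ek) (ipZr _ Eu Eu); ring.
Qed.

Let nqB u v : E u -> E v -> nq (u - v) = nq u - 2 * ip u v + nq v.
Proof.
move=> Eu Ev; have EN := EZ (-1) Ev.
by rewrite -scaleN1r (nqD Eu EN) (ipZr _ Ev Eu) (nqZ _ Ev); ring.
Qed.

Let nqD2 u v : E u -> E v -> nq (u + v) <= 2 * nq u + 2 * nq v.
Proof.
move=> Eu Ev; have := ip_ge0 (u - v); rewrite -/(nq _) nqB// nqD//; lra.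
Qed.

Let nqBC u v : E u -> E v -> nq (u - v) = nq (v - u).
Proof. by move=> Eu Ev; rewrite !nqB// [ip v u]ipC; ring. Qed.

Let CS u v : E u -> E v -> 0 < nq v -> ip u v ^+ 2 <= nq u * nq v.
Proof.
move=> Eu Ev v0.
have := ip_ge0 (u - (ip u v / nq v) *: v); rewrite -/(nq _) (nqB Eu (EZ _ Ev)) (ipZr _ Ev Eu) (nqZ _ Ev).
have -> : nq u - 2 * (ip u v / nq v * ip u v) + (ip u v / nq v) ^+ 2 * nq v =
  (nq u * nq v - ip u v ^+ 2) / nq v by field; rewrite gt_eqF.
by rewrite pmulr_lge0 ?invr_gt0// subr_ge0.
Qed.

Let smallE (x : R) : 0 <= x -> (forall e, 0 < e -> x <= e) -> x = 0.
Proof.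
move=> x0 h; apply/eqP; rewrite eq_le x0 andbT.
by apply/ler_addgt0Pr => e e0; rewrite add0r h.
Qed.

Let N w := E w /\ forall n, ip w (U n) = 0.

Let NA w : N w -> N (A w).
Proof.
move=> [Ew w0]; split; first exact: AE.
by move=> n; rewrite Asym// AU ipZr// w0 mulr0.
Qed.

Let ND u v : N u -> N v -> N (u + v).
Proof.
by move=> [Eu u0] [Ev v0]; split=> [|n]; [exact: ED|rewrite ipDl// u0 v0 addr0].
Qed.

Let NZ k u : N u -> N (k *: u).
Proof.
by move=> [Eu u0]; split=> [|n]; [exact: EZ|rewrite ipZl// u0 mulr0].
Qed.

(** By the Cauchy-Schwarz inequality [(ip G (U n)) ^+ 2] is at most [nq (H k - G) * nq (U n)] for
    large k in the cluster, which is arbitrarily small. *)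
Let cluster_orth (H : nat -> V) G n : E G -> (forall k, E (H k)) ->
  (forall e n0, 0 < e -> exists2 k, (n0 <= k)%N & nq (H k - G) < e) ->
  (exists n0, forall k, (n0 <= k)%N -> ip (H k) (U n) = 0) -> ip G (U n) = 0.
Proof.
move=> EG EH cl [n0 h0].
apply/eqP; rewrite -sqrf_eq0; apply/eqP; apply: smallE; first exact: sqr_ge0.
move=> e e0; have [k kn hk] := cl (e / nq (U n)) n0 (divr_gt0 e0 (Upos n)).
have := CS (EB (EH k) EG) (UE n) (Upos n).
rewrite ipBl// h0// sub0r sqrrN => /le_trans; apply.
by rewrite -ler_pdivlMr ?ltW//; exact: Upos.
Qed.

Let nq0 : nq 0 = 0.
Proof. by rewrite -(scale0r (0 : V)) nqZ// expr0n/= mul0r. Qed.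

(** [W = A G + s *: G] satisfies [A W = s *: W] up to a null vector. One more application of [A]
    removes it, so [A W] is an exact eigenvector to which [Umax] applies, and [Ainj] brings the
    conclusion back to [W]. *)
Let eig_zero G s : N G -> s != 0 -> nq (A (A G) - s ^+ 2 *: G) = 0 -> nq (A G + s *: G) = 0.
Proof.
move=> NG s0 Z0; have EG := NG.1; have EAG := AE EG; have EAAG := AE EAG.
have NW : N (A G + s *: G) by apply: ND; [exact: NA|exact: NZ].
have AWs : A (A G + s *: G) = s *: (A G + s *: G) + (A (A G) - s ^+ 2 *: G).
  rewrite AD ?AZ//; last exact: EZ.
  by rewrite scalerDr scalerA -expr2 -addrA [s ^+ 2 *: G + _]addrC subrK addrC.
apply: Ainj => //; first exact: NW.1.
apply: (@Umax _ s) => //.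
- exact: AE NW.1.
- have EW := NW.1; have EZ' := EB EAAG (EZ (s ^+ 2) EG).
  by rewrite {1}AWs (AD (EZ s EW) EZ') (AZ _ EW) (Anull EZ' Z0) addr0.
- by have [] := NA NW.
Qed.

(* A maximizing sequence for [nq (A v)] on the unit ball of [N] gives a [G] with [A^2 G = M G],
   hence an eigenvector [A G +- sqrt M G] in [N], against [Umax]. *)
Let orth_zero w : N w -> nq w = 0.
Proof.
move=> Nw; apply/eqP; apply/negPn/negP => w_neq0.
have w0 : 0 < nq w by rewrite lt_def w_neq0 ip_ge0.
pose S := [set nq (A v) | v in [set v | N v /\ nq v <= 1]].
have unit_scale v : N v -> 0 < nq v -> N ((Num.sqrt (nq v))^-1 *: v) /\ nq ((Num.sqrt (nq v))^-1 *: v) = 1.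
  move=> Nv v0; split; first exact: NZ.
  by rewrite (nqZ _ Nv.1) exprVn sqr_sqrtr ?(ltW v0)// mulVf// gt_eqF.
have supS : has_sup S.
  split; first by exists (nq (A 0)), 0 => //; split; [split=> // n; rewrite -(scale0r (U n)) ipZl// mul0r|rewrite nq0].
  exists `|K| => _ [v [Nv v1] <-]; apply: le_trans (Abnd Nv.1) _.
  apply: (@le_trans _ _ (`|K| * nq v)); first by apply: ler_wpM2r; [exact: ip_ge0|exact: ler_norm].
  by rewrite ler_piMr.
pose M := sup S.
have MS v : N v -> nq v <= 1 -> nq (A v) <= M.
  by move=> Nv v1; apply: ub_le_sup; [case: supS|exists v].
have MA v : N v -> nq (A v) <= M * nq v.
  move=> Nv; have [v0|v0] := eqVneq (nq v) 0.
    by rewrite (Anull Nv.1 v0) v0 mulr0 nq0.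
  have vp : 0 < nq v by rewrite lt_def v0 ip_ge0.
  have [N1 q1] := unit_scale v Nv vp.
  have := MS _ N1; rewrite q1 lexx => /(_ isT).
  rewrite (AZ _ Nv.1) (nqZ _ (AE Nv.1)).
  by rewrite exprVn sqr_sqrtr ?(ltW vp)// mulrC ler_pdivrMr.
have M0 : 0 < M.
  have wA : 0 < nq (A w).
    rewrite lt_def ip_ge0 andbT; apply/eqP => /Ainj -/(_ Nw.1) h.
    by move: w0; rewrite /nq h ltxx.
  by have := lt_le_trans wA (MA w Nw); rewrite pmulr_lgt0.
have /choice[F hF] : forall k, exists v, [/\ N v, nq v <= 1 & M - k.+1%:R^-1 < nq (A v)].
  move=> k.
  have k0 : 0 < k.+1%:R^-1 :> R by rewrite invr_gt0 ltr0n.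
  by have [_ [v [Nv v1] <-] h] := sup_adherent k0 supS; exists v.
have EF k : E (F k) by have [[]] := hF k.
have F1 k : ip (F k) (F k) <= 1 by have [] := hF k.
have [G EG clG] := Acomp EF F1.
have NG : N G.
  split=> // n; apply: (@cluster_orth (fun k => A (F k))) => //; first by move=> k; exact/AE/EF.
  by exists 0%N => k _; have [+ _ _] := hF k => /NA[].
have EAG := AE EG; have EAAG := AE EAG.
have harm e : 0 < e -> exists n0, forall k, (n0 <= k)%N -> k.+1%:R^-1 < e :> R.
  move=> e0; have [n _ hn] := near_infty_natSinv_lt (PosNum e0).
  by exists n => k nk; exact: hn.
have Z0 : nq (A (A G) - M *: G) = 0.
  apply: smallE; first exact: ip_ge0.
  move=> e e0.
  have [d d0 hd] : exists2 d, 0 < d & 4 * (`|K| ^+ 2 + `|K| * M + M ^+ 2) * d <= e.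
    have c0 : 0 < 4 * (`|K| ^+ 2 + `|K| * M + M ^+ 2 + 1) by have := normr_ge0 K; nra.
    exists (e / (4 * (`|K| ^+ 2 + `|K| * M + M ^+ 2 + 1))); first exact: divr_gt0.
    by rewrite mulrA ler_pdivrMr// mulrC ler_pM2l//; lra.
  have [n0 hn0] := harm _ d0.
  have [k kn hk] := clG _ n0 d0.
  have [Nk k1 Mk] := hF k; have {Mk} : M < nq (A (F k)) + d.
    by move: Mk; rewrite ltrBlDr => /lt_trans; apply; rewrite ltrD2l; exact: hn0.
  rewrite -ltrBlDl => /ltW Mk.
  have EAF := AE (EF k); have EAAF := AE EAF; have EAAAF := AE EAAF.
  (* A splitting of [A (A G) - M *: G]. [X] and [W] are small because [A (F k)] is close to [G]. [Y]
     is small because [F k] nearly maximizes: expanding the square and using the bound [M] on [A]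
     gives at most [M * (M - nq (A (F k)))] before the last application of [A]. *)
  set X := A (A (G - A (F k))); set Y := A (A (A (F k)) - M *: F k); set W := M *: (A (F k) - G).
  have EX : E X by apply/AE/AE/EB.
  have EY : E Y by apply/AE/EB => //; exact: EZ.
  have EW : E W by apply/EZ/EB.
  have -> : A (A G) - M *: G = X + (Y + W).
    rewrite /X /Y /W (AB EG EAF) (AB EAG EAAF) (AB EAAF (EZ M (EF k))) (AZ _ (EF k)).
    by rewrite scalerBr !subrKA.
  have qX : nq X <= `|K| ^+ 2 * d.
    apply: le_trans (Abnd (AE (EB EG EAF))) _.
    apply: (@le_trans _ _ (`|K| * ip (A (G - A (F k))) (A (G - A (F k))))).
      by apply: ler_wpM2r; [exact: ip_ge0|exact: ler_norm].
    have := Abnd (EB EG EAF); rewrite -/(nq (G - _)) nqBC// => h.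
    apply: (@le_trans _ _ (`|K| * (`|K| * nq (A (F k) - G)))).
      apply: ler_wpM2l => //; apply: le_trans h _; apply: ler_wpM2r; [exact: ip_ge0|exact: ler_norm].
    rewrite mulrA -expr2.
    by apply: ler_wpM2l; [exact: sqr_ge0|exact: ltW].
  have qY : nq Y <= `|K| * (M * d).
    apply: le_trans (Abnd (EB EAAF (EZ _ (EF k)))) _.
    have h : nq (A (A (F k)) - M *: F k) <= M * d.
      rewrite (nqB EAAF (EZ M (EF k))) (ipZr _ (EF k) EAAF) (nqZ _ (EF k)).
      have := MA _ (NA Nk); rewrite (Asym EAF (EF k)) -/(nq (A (F k))) => h1.
      have h2 := @ler_pM _ (M ^+ 2) (M ^+ 2) (nq (F k)) 1 (sqr_ge0 _) (ip_ge0 _) (lexx _) k1.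
      have : M * (M - nq (A (F k))) <= M * d.
        by apply: ler_wpM2l; [exact: ltW|].
      lra.
    apply: (@le_trans _ _ (`|K| * nq (A (A (F k)) - M *: F k))).
      by apply: ler_wpM2r; [exact: ip_ge0|exact: ler_norm].
    exact: ler_wpM2l.
  have qW : nq W <= M ^+ 2 * d.
    by rewrite /W nqZ; [apply: ler_wpM2l; [exact: sqr_ge0|exact: ltW]|exact: EB].
  have := nqD2 EX (ED EY EW); have := nqD2 EY EW => h1 h2.
  rewrite -/(nq _).
  have := ip_ge0 X; rewrite -/(nq X); lra.
(* [G] is close to vectors [A (F k)] whose square norms approach [M > 0]. *)
have G0 : 0 < nq G.
  have M4 : 0 < M / 4 by apply: divr_gt0.
  have [n0 hn0] := harm _ M4.
  have [k kn hk] := clG _ n0 M4; have [_ _ Mk] := hF k; have {Mk} : M < nq (A (F k)) + M / 4.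
    by move: Mk; rewrite ltrBlDr => /lt_trans; apply; rewrite ltrD2l; exact: hn0.
  move=> Mk.
  have EAF := AE (EF k).
  have := nqD2 (EB EAF EG) EG; rewrite subrK; rewrite -/(nq _) in hk; lra.
pose s := Num.sqrt M.
have s0 : s != 0 by rewrite gt_eqF// sqrtr_gt0.
have sM : s ^+ 2 = M by rewrite sqr_sqrtr// ltW.
have q1 : nq (A G + s *: G) = 0 by apply: eig_zero => //; rewrite sM.
have q2 : nq (A G + (- s) *: G) = 0.
  by apply: eig_zero => //; [rewrite oppr_eq0|rewrite sqrrN sM].
have E1 : E (A G + s *: G) by apply: ED => //; exact: EZ.
have E2 : E (A G + (- s) *: G) by apply: ED => //; exact: EZ.
(* Both eigenvectors are null, yet their difference is [(2 * s) *: G], of positive square norm. *)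
have := nqD2 E1 (EZ (-1) E2); rewrite nqZ// q1 q2 !mulr0 addr0.
have -> : A G + s *: G + -1 *: (A G + - s *: G) = (2 * s) *: G.
  rewrite scalerDr scalerA mulN1r opprK scaleN1r addrACA subrr add0r -scalerDl; congr (_ *: _); ring.
rewrite nqZ//; have : 0 < (2 * s) ^+ 2 by rewrite exprn_even_gt0//= mulf_neq0.
by move=> h1; rewrite leNgt mulr_gt0.
Qed.

(** The remainders [Rn n] of the orthogonal expansion of [F] are bounded by Bessel's inequality, so
    their images under [A] have a cluster point. It is orthogonal to every [U i], hence null by
    [orth_zero], and some [A (Rn n)] is small. *)
Lemma eigenvectors_dense_range F e : E F -> 0 < e ->
  exists n (c : nat -> R), ip (A F - \sum_(i < n) c i *: U i) (A F - \sum_(i < n) c i *: U i) < e.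
Proof.
move=> EF e0.
pose c i := ip F (U i) / nq (U i).
pose P n := \sum_(i < n) c i *: U i.
have EP n : E (P n).
  by rewrite /P; elim/big_ind: _ => // i _; exact: EZ.
pose Rn n := F - P n.
have ERn n : E (Rn n) by exact: EB.
have ipP n w : E w -> ip (P n) w = \sum_(i < n) c i * ip (U i) w.
  move=> Ew; rewrite /P; elim: n => [|n IH].
    by rewrite !big_ord0 -(scale0r w) ipZl// mul0r.
  rewrite !big_ord_recr/= ipDl ?ipZl ?IH//; last exact: EZ.
  exact: EP.
have PU n i : (i < n)%N -> ip (P n) (U i) = ip F (U i).
  move=> ni; rewrite ipP// (bigD1 (Ordinal ni))//= big1 ?addr0.
    by rewrite /c mulfVK// gt_eqF// Upos.
  by move=> j ji; rewrite Uorth ?mulr0//; apply: contraNneq ji => ji; apply/eqP/val_inj.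
have RU n i : (i < n)%N -> ip (Rn n) (U i) = 0.
  by move=> ni; rewrite ipBl// PU// subrr.
have RP n : ip (Rn n) (P n) = 0.
  rewrite ipC ipP// big1// => i _.
  by rewrite ipC RU ?mulr0.
have Rb n : ip (Rn n) (Rn n) <= nq F.
  have -> : nq F = nq (Rn n) + nq (P n).
    by rewrite -[in LHS](subrK (P n) F) -/(Rn n) (nqD (ERn n) (EP n)) RP mulr0 addr0.
  by rewrite lerDl; exact: ip_ge0.
have [G EG clG] := Acomp ERn Rb.
have NG : N G.
  split=> // i; apply: (@cluster_orth (fun k => A (Rn k))) => //; first by move=> k; exact/AE.
  by exists i.+1 => k ik; rewrite Asym// AU ipZr// RU// mulr0.
have [n _ hn] := clG _ 0%N (divr_gt0 e0 (@ltr0n R 4)).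
(* [A] multiplies the i-th term of the partial sum by its eigenvalue. *)
exists n, (fun i => c i * mu i).
have -> : A F - \sum_(i < n) (c i * mu i) *: U i = A (Rn n).
  rewrite (AB EF (EP n)); congr (_ - _).
  rewrite /P; elim: n {hn} => [|n IH].
    by rewrite !big_ord0 -(scale0r (U 0%N)) AZ ?UE// !scale0r.
  rewrite !big_ord_recr/= (AD (EP n) (EZ _ (UE n))) (AZ _ (UE n)) AU scalerA.
  by congr (_ + _).
have := nqD2 (EB (AE (ERn n)) EG) EG; rewrite subrK (orth_zero NG) mulr0 addr0.
by rewrite -/(nq _) in hn; rewrite -/(nq _); move: hn; set x := nq _; set y := nq _; lra.
Qed.

End CompactSymmetric.

(** * Compactness of bounded equi-Lipschitz sequences *)

Section Ascoli.
Context {R : realType}.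

(** Along an ultrafilter finer than the filter of large indices all values [y n x] and [b n]
    converge at once, which replaces a diagonal extraction. The common Lipschitz constant turns
    closeness on a finite grid into uniform closeness. *)
Lemma ascoli_lipschitz (y : nat -> R -> R) (b : nat -> R) (B L : R) :
  (forall n x, `|y n x| <= B) -> (forall n, `|b n| <= B) ->
  (forall n x x', `|y n x - y n x'| <= L * `|x - x'|) -> (forall n x, y n (cl x) = y n x) ->
  exists g c, [/\ continuous g, forall x, g (cl x) = g x &
    forall e n0, 0 < e -> exists n, [/\ (n0 <= n)%N, `|b n - c| < e & forall x, `|y n x - g x| < e]].
Proof.
move=> yB bB yL ycl.
have [G [UG infG]] := ultraFilterLemma (@eventually_filter : ProperFilter \oo).
have PG : ProperFilter G by exact: ultra_proper.
have lim (z : nat -> R) : (forall n, `|z n| <= B) ->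
    exists l, forall e, 0 < e -> G [set n | `|z n - l| < e].
  move=> zB; have [|l [_ hl]] := @segment_compact R (- B) B (z @ G).
    have -> : (z @ G) `[- B, B]%classic = G setT; last exact: filterT.
    congr G; apply/seteqP; split=> // n _; by rewrite /= in_itv/= -ler_norml.
  exists l => e e0.
  have [//|hn] := in_ultra_setVsetC [set n | `|z n - l| < e] UG.
  have hb : nbhs l (ball l e) by exact: nbhsx_ballx.
  have hc : (z @ G) (~` ball l e).
    have -> : (z @ G) (~` ball l e) = G (~` [set n | `|z n - l| < e]); last by [].
    by congr G; apply/funext => n; rewrite /preimage /setC /ball/= distrC.
  by have [x [/= x1 x2]] := hl _ _ hc hb.
have /choice[g hg] : forall x, exists l, forall e, 0 < e -> G [set n | `|y n x - l| < e].
  by move=> x; exact: lim.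
have [c hc] := lim b bB.
have gL x x' : `|g x - g x'| <= `|L| * `|x - x'|.
  apply/ler_addgt0Pr => e e0.
  have e2 : 0 < e / 2 by exact: divr_gt0.
  have [n [h1 h2]] := filter_ex (filterI (hg x _ e2) (hg x' _ e2)).
  have := yL n x x'; have : L * `|x - x'| <= `|L| * `|x - x'| by apply: ler_wpM2r => //; exact: ler_norm.
  move: h1 h2; rewrite /= !ltr_norml !ler_norml; lra.
exists g, c; split.
- exact: lipschitz_continuous_fun gL.
- move=> x; apply/eqP; rewrite -subr_eq0 -normr_eq0 eq_le normr_ge0 andbT.
  apply/ler_addgt0Pr => e e0; rewrite add0r.
  have e2 : 0 < e / 2 by exact: divr_gt0.
  have [n [h1 h2]] := filter_ex (filterI (hg x _ e2) (hg (cl x) _ e2)).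
  by move: h1 h2; rewrite /= ycl !ltr_norml !ler_norml; lra.
move=> e n0 e0.
have e4 : 0 < e / 4 by exact: divr_gt0.
(* Mesh of the grid: the two Lipschitz errors and the error at the grid point are each at most
   [e / 4]. Adding 1 to [|L|] keeps the divisor positive. *)
pose h := e / 4 / (`|L| + 1).
have L1 : 0 < `|L| + 1 by rewrite ltr_wpDl.
have h0 : 0 < h by exact: divr_gt0.
have hL : `|L| * h <= e / 4.
  by rewrite /h mulrA ler_pdivrMr// mulrC ler_pM2l// lerDl.
pose m := (Num.truncn (pi / h)).+1.
have ev : G [set n | [/\ (n0 <= n)%N, `|b n - c| < e &
    forall i : 'I_m, `|y n (i%:R * h) - g (i%:R * h)| < e / 4]].
  have h1 : G [set n | (n0 <= n)%N] by apply: infG; exact: nbhs_infty_ge.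
  have h2 := hc e e0.
  have h3 : G [set n | forall i : 'I_m, `|y n (i%:R * h) - g (i%:R * h)| < e / 4].
    by apply: filter_forall => i; exact: hg.
  by apply: filterS3 h1 h2 h3 => n.
have [n [nn0 bn hn]] := filter_ex ev.
exists n; split => //.
have gcl x : g (cl x) = g x.
  apply/eqP; rewrite -subr_eq0 -normr_eq0 eq_le normr_ge0 andbT.
  apply/ler_addgt0Pr => d d0; rewrite add0r.
  have e2 : 0 < d / 2 by exact: divr_gt0.
  have [k [h1 h2]] := filter_ex (filterI (hg x _ e2) (hg (cl x) _ e2)).
  by move: h1 h2; rewrite /= ycl !ltr_norml !ler_norml; lra.
move=> x0; rewrite -ycl -gcl; set x := cl x0.
have /andP[x0' xpi] := cl_itv x0; rewrite -/x in x0' xpi.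
have xh : 0 <= x / h by rewrite divr_ge0// ltW.
have /andP[i1 i2] := truncn_itv xh.
have im : (Num.truncn (x / h) < m)%N.
  rewrite ltnS; apply: le_truncn; by rewrite ler_pM2r ?invr_gt0.
have := hn (Ordinal im); rewrite /=; set i := Num.truncn _ in i1 i2 *.
have dx : `|x - i%:R * h| <= h.
  move: i1 i2; rewrite ler_pdivlMr// ltr_pdivrMr// -natr1 mulrDl mul1r => i1 i2.
  by rewrite ger0_norm ?subr_ge0//; lra.
have k1 := yL n x (i%:R * h); have k2 := gL x (i%:R * h).
have k3 : L * `|x - i%:R * h| <= e / 4.
  apply: (@le_trans _ _ (`|L| * h)) => //; apply: (@le_trans _ _ (`|L| * `|x - i%:R * h|)).
    by apply: ler_wpM2r => //; exact: ler_norm.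
  exact: ler_wpM2l.
have k4 : `|L| * `|x - i%:R * h| <= e / 4.
  by apply: le_trans hL; exact: ler_wpM2l.
have {k1} := le_trans k1 k3; have {k2} := le_trans k2 k4.
rewrite !ltr_norml !ler_norml; lra.
Qed.

End Ascoli.

(** * Functions with vanishing integrals, and a Cauchy-Schwarz inequality *)

Section ZeroIntegrals.
Context {R : realType}.
Local Notation mu := (@lebesgue_measure R).
Implicit Types (f g y : R -> R).

Lemma continuous_itg_eq0 f b : 0 < b -> continuous f -> (forall x, 0 <= x <= b -> itg f 0 x = 0) ->
  forall x, 0 <= x <= b -> f x = 0.
Proof.
move=> b0 cf f0 x /andP[x0 xb]; apply/eqP; apply/negPn/negP => fx.
have fp : 0 < `|f x| by rewrite normr_gt0.
have f2 : 0 < `|f x| / 2 by exact: divr_gt0.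
have [d d0 hd] := (continuousPe f).1 cf x _ f2.
(* The interval of radius [d / 2] around [x], clipped to [0, b]; since [0 < b] it is nondegenerate
   even when [x] is an end point. *)
pose u := Num.max 0 (x - d / 2); pose v := Num.min b (x + d / 2).
have [u0 uv vb] : [/\ 0 <= u, u < v & v <= b].
  by rewrite /u /v; split; case: (leP 0 (x - d / 2)) => ?; case: (leP b (x + d / 2)) => ?; lra.
have near_x t : u <= t <= v -> `|t - x| < d.
  rewrite /u /v ltr_norml; case: (leP 0 (x - d / 2)) => ?; case: (leP b (x + d / 2)) => ?; lra.
have lf := locint_cont cf; have lc := @locint_cst R (f x).
have h1 : itg f u v = 0.
  by have := itg_split 0 u v lf; rewrite !f0 ?add0r//; apply/andP; split; lra.
have h2 : `|itg (fun t => f t - f x) u v| <= `|f x| / 2 * (v - u).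
  apply: itg_bound; [exact: locintB|exact: ltW|].
  by move=> t /near_x /hd /ltW.
move: h2; rewrite itgB// h1 itg_cst sub0r normrN normrM [`|v - u|]gtr0_norm ?subr_gt0//.
rewrite ler_pM2r ?subr_gt0//; lra.
Qed.

Lemma itg_sqr_eq0_continuous y b : 0 < b -> continuous y -> itg (fun t => y t ^+ 2) 0 b = 0 ->
  forall x, 0 <= x <= b -> y x = 0.
Proof.
move=> b0 cy y0 x xb; apply/eqP; rewrite -sqrf_eq0; apply/eqP; move: x xb.
have cy2 : continuous (fun t => y t ^+ 2) by apply: continuous_mulf.
apply: continuous_itg_eq0 => // x /andP[x0 xb]; apply/eqP; rewrite eq_le.
rewrite itg_ge0 ?andbT//; last by move=> t _; exact: sqr_ge0.
by rewrite -[leRHS]y0 itg_mono//; [exact: locint_cont|move=> t; exact: sqr_ge0].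
Qed.

(** The integral of [(|f| - m) ^+ 2] is nonnegative, where [m] is the mean value of [|f|]. *)
Lemma itg_norm_sqr f b : 0 < b -> sqint f ->
  itg (fun t => `|f t|) 0 b ^+ 2 <= b * itg (fun t => f t ^+ 2) 0 b.
Proof.
move=> b0 sf; have [mf lf2] := sf; have lf := locint_norm (sqint_locint sf).
set S := itg _ 0 b.
pose m := S / b.
have : 0 <= itg (fun t => (f t ^+ 2 + m ^+ 2) - 2 * m * `|f t|) 0 b.
  apply: itg_ge0; first exact: ltW.
  move=> t _; rewrite -(real_normK (num_real (f t))).
  have := sqr_ge0 (`|f t| - m); rewrite sqrrB; lra.
have l1 : locint (fun t => f t ^+ 2 + m ^+ 2) by apply: locintD => //; exact: locint_cst.
have l2 : locint (fun t => 2 * m * `|f t|) by exact: locintZ.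
rewrite (itgB _ _ l1 l2) itgD//; last exact: locint_cst.
rewrite itgZ// itg_cst -/S subr0.
have -> : m ^+ 2 * b = S ^+ 2 / b by rewrite /m; field; rewrite gt_eqF.
have -> : 2 * m * S = 2 * (S ^+ 2 / b) by rewrite /m; ring.
have : S ^+ 2 = b * (S ^+ 2 / b) by field; rewrite gt_eqF.
nra.
Qed.

End ZeroIntegrals.

(** * The resolvent of the linearized boundary problem *)

Section Resolvent.
Context {R : realType}.
Local Notation mu := (@lebesgue_measure R).
Local Notation V := ((R -> R^o) * R^o)%type.
Variables (q : R -> R) (h H H1 H2 c : R).
Hypothesis sq : sqint q.
Hypothesis rho_gt0 : 0 < H * H1 - H2.
Local Notation rho := (H * H1 - H2).

Definition eigensolution l (y y1 : R -> R) := [/\ sl_sol (fun t => q t - l) (fun=> 0) y y1,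
  y1 0 = h * y 0 & l * (y1 pi + H * y pi) = H1 * y1 pi + H2 * y pi].

Hypothesis noneig : forall y y1, eigensolution c y y1 -> forall x, y x = 0.

(* The second component of [(y, y1 pi + H * y pi)] linearizes the [lam]-dependent boundary condition;
   with this product the problem is symmetric. *)
Definition ipE (F G : V) : R := itg (fun t => F.1 t * G.1 t) 0 pi + F.2 * G.2 / rho.
Definition sqpair (F : V) : Prop := sqint F.1.

(** The equation (L - c) Y = F for Y = (y, s), s = y'(pi) + H y(pi), where L sends Y to (- y'' + q
    y, H1 y'(pi) + H2 y(pi)); the boundary condition at pi of an eigenfunction is the second
    component of L Y = lam Y. *)
Definition resolves (F : V) (y y1 : R -> R) := [/\ sl_sol (fun t => q t - c) F.1 y y1,
  y1 0 = h * y 0 & (H1 - c) * y1 pi + (H2 - c * H) * y pi = F.2].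

Let pi0 : 0 < pi :> R := pi_gt0 R.
Let sp : sqint (fun t => q t - c).
Proof.
apply: (@sqintD _ q (fun=> - c)) => //; apply: sqint_continuous; exact: continuous_cstf.
Qed.
Let lp := sqint_locint sp.

Lemma resolves_lin F G y y1 z z1 k : sqpair F -> sqpair G -> resolves F y y1 -> resolves G z z1 ->
  resolves (F + k *: G) (fun t => y t + k * z t) (fun t => y1 t + k * z1 t).
Proof.
move=> EF EG [cy hy by_] [cz hz bz]; split.
- have := sl_lin k lp (sqint_locint EF) (sqint_locint EG) cy cz.
  by apply.
- by rewrite hy hz; ring.
- by rewrite /= -by_ -bz /GRing.scale/=; ring.
Qed.

Lemma sqpairD F G : sqpair F -> sqpair G -> sqpair (F + G).
Proof. exact: sqintD. Qed.

Lemma sqpairZ k F : sqpair F -> sqpair (k *: F).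
Proof. exact: sqintZ. Qed.

Lemma sqpair0 : sqpair 0.
Proof. exact/sqint_continuous/continuous_cstf. Qed.

Lemma resolves_zero y y1 : resolves 0 y y1 -> (forall x, y x = 0) /\ (forall x, y1 x = 0).
Proof.
move=> [cy hy by_].
have y0 : forall x, y x = 0.
  apply: (noneig (y1 := y1)); split => //.
  by move: by_ => /= /eqP; rewrite -[_ == 0]subr_eq0 => /eqP by0; apply/eqP; rewrite -subr_eq0; apply/eqP; rewrite -[RHS]oppr0 -[in RHS]by0; ring.
have [] := sl_zero sp (locint_cst 0) _ cy _ _.
- by move=> x _; rewrite itg_cst mul0r.
- exact: y0.
- by rewrite hy y0 mulr0.
by split.
Qed.

Lemma resolves_unique F y y1 z z1 : sqpair F -> resolves F y y1 -> resolves F z z1 -> y = z /\ y1 = z1.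
Proof.
move=> EF ry rz; have := resolves_lin (-1) EF EF ry rz.
rewrite scaleN1r subrr => /resolves_zero[e1 e2].
by split; apply/funext => x; apply/eqP; rewrite -subr_eq0 -mulN1r; apply/eqP.
Qed.

(** The quantity that controls solutions in the sup norm. It is in turn controlled by the norm of
    [ipE], so sequences bounded for [ipE] have uniformly bounded solutions. *)
Definition l1E (F : V) : R := `|F.2| + itg (fun t => `|F.1 t|) 0 pi.

Lemma l1E_ge0 F : 0 <= l1E F.
Proof. by rewrite /l1E addr_ge0// itg_ge0// ltW. Qed.

(** Shooting: to the solution with zero Cauchy data a multiple of the homogeneous solution [w],
    [w 0 = 1], [w1 0 = h], is added so as to meet the condition at pi. The multiple exists because
    [B w w1 = 0] would make [c] an eigenvalue. *)
Lemma resolves_exists : exists2 K, 0 <= K & forall F, sqpair F ->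
  exists y y1, resolves F y y1 /\ forall x, `|y x| <= K * l1E F /\ `|y1 x| <= K * l1E F.
Proof.
have [K K0 hK] := sl_exists sp.
have [w [w1 [cw w0 w10 bw]]] := hK (fun=> 0) 1 h (locint_cst 0).
pose B (y y1 : R -> R) := (H1 - c) * y1 pi + (H2 - c * H) * y pi.
have Bw : B w w1 != 0.
  apply/eqP => Bw.
  have : w 0 = 0.
    apply: (noneig (y1 := w1)); split => //; first by rewrite w0 w10 mulr1.
    by apply/eqP; rewrite -subr_eq0; apply/eqP; rewrite -[RHS]oppr0 -[in RHS]Bw /B; ring.
  by rewrite w0; apply/eqP; exact: oner_neq0.
pose Cw := `|1| + `|h| + itg (fun t : R => `|0 : R|) 0 pi.
pose b := `|H1 - c| + `|H2 - c * H|.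
pose M := (1 + b * K) / `|B w w1|.
have Bp : 0 < `|B w w1| by rewrite normr_gt0.
have b0 : 0 <= b by rewrite /b addr_ge0.
have M0 : 0 <= M.
  by rewrite /M divr_ge0// addr_ge0// mulr_ge0.
have KC0 : 0 <= K * Cw.
  by have [h1 _] := bw 0; apply: le_trans h1.
exists (K + M * (K * Cw)); first by rewrite addr_ge0// mulr_ge0.
move=> F EF; have lF := sqint_locint EF.
have [y [y1 [cy y0 y10 by_]]] := hK F.1 0 0 lF.
pose a := (F.2 - B y y1) / B w w1.
exists (fun t => y t + a * w t), (fun t => y1 t + a * w1 t).
have S0 := l1E_ge0 F.
have ry x : `|y x| <= K * l1E F /\ `|y1 x| <= K * l1E F.
  have := by_ x; rewrite normr0 !add0r => -[h1 h2].
  by split; [apply: le_trans h1 _|apply: le_trans h2 _]; apply: ler_wpM2l => //; rewrite /l1E lerDr.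
have aM : `|a| <= M * l1E F.
  rewrite /a normrM normfV /M mulrAC ler_pM2r ?invr_gt0// mulrDl mul1r.
  apply: le_trans (ler_normB _ _) _; apply: lerD.
    by rewrite /l1E lerDl itg_ge0// ltW.
  rewrite /B; apply: le_trans (ler_normD _ _) _; rewrite !normrM /b -mulrA mulrDl.
  by have [h1 h2] := ry pi; apply: lerD; exact: ler_wpM2l.
split.
  split.
  - have := sl_lin a lp lF (locint_cst 0) cy cw.
    by under [X in sl_sol _ X]eq_fun do rewrite mulr0 addr0.
  - by rewrite y0 y10 w0 w10; ring.
  - by rewrite /= /a; move: Bw; rewrite /B => Bw; field.
move=> x; have [h1 h2] := ry x; have [h3 h4] := bw x.
have aw (z : R -> R) : `|z x| <= K * Cw -> `|a * z x| <= M * (K * Cw) * l1E F.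
  move=> hz; rewrite normrM [M * _]mulrC -[_ * M * _]mulrA [leRHS]mulrC.
  exact: ler_pM.
by split; apply: le_trans (ler_normD _ _) _; rewrite mulrDl; apply: lerD => //; exact: aw.
Qed.

Lemma resolvent_function : exists (Y Y1 : V -> R -> R) (K : R), 0 <= K /\ forall F, sqpair F ->
  resolves F (Y F) (Y1 F) /\ forall x, `|Y F x| <= K * l1E F /\ `|Y1 F x| <= K * l1E F.
Proof.
have [K K0 hK] := resolves_exists.
have /choice[YY hY] : forall F, exists yy : (R -> R) * (R -> R), sqpair F ->
    resolves F yy.1 yy.2 /\ forall x, `|yy.1 x| <= K * l1E F /\ `|yy.2 x| <= K * l1E F.
  move=> F; have [EF|nEF] := pselect (sqpair F).
    by have [y [y1 hy]] := hK F EF; exists (y, y1).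
  by exists (fun=> 0, fun=> 0).
by exists (fun F => (YY F).1), (fun F => (YY F).2), K.
Qed.

(** Lagrange's identity leaves the Wronskian at pi, the one at 0 being zero by the condition
    [y1 0 = h * y 0]. The second components contribute [- rho] times that Wronskian, which is why
    the scalar part carries the weight [1 / rho]. *)
Lemma resolves_sym F G y y1 z z1 : sqpair F -> sqpair G -> resolves F y y1 -> resolves G z z1 ->
  ipE (y, y1 pi + H * y pi) G = ipE F (z, z1 pi + H * z pi).
Proof.
move=> EF EG [[cy cy1 ycl y1cl ye] hy by_] [[cz cz1 zcl z1cl ze] hz bz].
have lF := sqint_locint EF; have lG := sqint_locint EG.
pose p t := q t - c.
pose y2 t := p t * y t - F.1 t; pose z2 t := p t * z t - G.1 t.
have ly2 : locint y2 by apply: locintB => //; exact: locintM.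
have lz2 : locint z2 by apply: locintB => //; exact: locintM.
have I1 := itg_by_parts_ac (F := y1) (G := z) ly2 (locint_cont cz1) (ltW pi0)
  (fun x hx => (ye x hx).2) (fun x hx => (ze x hx).1).
have I2 := itg_by_parts_ac (F := z1) (G := y) lz2 (locint_cont cy1) (ltW pi0)
  (fun x hx => (ze x hx).2) (fun x hx => (ye x hx).1).
have l1 : locint (fun t => y2 t * z t + y1 t * z1 t).
  by apply: locintD; [exact: locintM|exact/locint_cont/continuous_mulf].
have l2 : locint (fun t => z2 t * y t + z1 t * y1 t).
  by apply: locintD; [exact: locintM|exact/locint_cont/continuous_mulf].
have lyG : locint (fun t => y t * G.1 t) by exact: locintMl.
have lFz : locint (fun t => F.1 t * z t) by exact: locintM.
have key : itg (fun t => y t * G.1 t) 0 pi - itg (fun t => F.1 t * z t) 0 pi =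
    y1 pi * z pi - z1 pi * y pi.
  rewrite -itgB//.
  have -> : (fun t => y t * G.1 t - F.1 t * z t) =
    (fun t => (y2 t * z t + y1 t * z1 t) - (z2 t * y t + z1 t * y1 t)).
    by apply/funext => t; rewrite /y2 /z2; ring.
  by rewrite itgB// I1 I2 hy hz; ring.
rewrite /ipE/= -by_ -bz.
have -> : itg (fun t => y t * G.1 t) 0 pi =
  itg (fun t => F.1 t * z t) 0 pi + (y1 pi * z pi - z1 pi * y pi) by rewrite -key; ring.
by field; rewrite gt_eqF.
Qed.

End Resolvent.

(** * Eigenvectors of the boundary problem are dense in the range of its resolvent *)

Section EigenExpansion.
Context {R : realType}.
Local Notation mu := (@lebesgue_measure R).
Local Notation V := ((R -> R^o) * R^o)%type.
Variables (q : R -> R) (h H H1 H2 c : R).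
Hypothesis sq : sqint q.
Hypothesis rho_gt0 : 0 < H * H1 - H2.
Local Notation rho := (H * H1 - H2).
Local Notation ip := (@ipE R H H1 H2).
Let pi0 : 0 < pi :> R := pi_gt0 R.

Let scaleRE (k : R) (x : R^o) : k *: x = k * x. Proof. by []. Qed.

Lemma sqint_sub_cst k : sqint (fun t => q t - k).
Proof.
apply: (@sqintD _ q (fun=> - k)) => //; apply: sqint_continuous; exact: continuous_cstf.
Qed.

(** The difference of [y] and [y 0 * z] has zero Cauchy data. This gives the simplicity of the
    eigenvalues. *)
Lemma sl_proportional p (y y1 z z1 : R -> R) : sqint p ->
  sl_sol p (fun=> 0) y y1 -> sl_sol p (fun=> 0) z z1 -> y1 0 = h * y 0 -> z 0 = 1 -> z1 0 = h ->
  (forall x, y x = y 0 * z x) /\ (forall x, y1 x = y 0 * z1 x).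
Proof.
move=> sp sy sz hy z0 z10; have lp := sqint_locint sp.
have := sl_lin (- y 0) lp (locint_cst 0) (locint_cst 0) sy sz.
under [X in sl_sol _ X]eq_fun do rewrite mulr0 addr0.
move=> /(sl_zero sp (locint_cst 0) _)[].
- by move=> x _; rewrite itg_cst mul0r.
- by rewrite z0; ring.
- by rewrite z10 hy; ring.
move=> e1 e2; split => x.
  by have := e1 x; move/eqP; rewrite mulNr subr_eq0 => /eqP.
by have := e2 x; move/eqP; rewrite mulNr subr_eq0 => /eqP.
Qed.

Hypothesis noneig : forall y y1, eigensolution q h H H1 H2 c y y1 -> forall x, y x = 0.
Variables (lam : nat -> R) (phi phi1 : nat -> R -> R).
Hypothesis phi_eig : forall n, eigensolution q h H H1 H2 (lam n) (phi n) (phi1 n).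
Hypothesis phi0 : forall n, phi n 0 = 1.
Hypothesis lam_inj : forall m n, m != n -> lam m != lam n.
Hypothesis lam_all : forall l y y1, eigensolution q h H H1 H2 l y y1 -> (exists x, y x != 0) ->
  exists n, l = lam n.

Definition eigvec n : V := (phi n, phi1 n pi + H * phi n pi).

Lemma ipE_sym F G : ip F G = ip G F.
Proof.
rewrite /ipE; congr (itg _ _ _ + _ / _); last exact: mulrC.
by apply/funext => t; exact: mulrC.
Qed.

Lemma ipE_addl F G W : sqpair F -> sqpair G -> sqpair W -> ip (F + G) W = ip F W + ip G W.
Proof.
move=> EF EG EW; rewrite /ipE /=.
have -> : (fun t => (F.1 + G.1) t * W.1 t) = (fun t => F.1 t * W.1 t + G.1 t * W.1 t).
  by apply/funext => t; rewrite -mulrDl.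
rewrite itgD; [|exact: sqint_locintM..].
by rewrite mulrDl mulrDl; ring.
Qed.

Lemma ipE_scalel k F W : sqpair F -> sqpair W -> ip (k *: F) W = k * ip F W.
Proof.
move=> EF EW; rewrite /ipE /=.
have -> : (fun t => (k *: F.1) t * W.1 t) = (fun t => k * (F.1 t * W.1 t)).
  by apply/funext => t; rewrite mulrA.
rewrite itgZ; last exact: sqint_locintM.
by rewrite /= ?scaleRE mulrDr !mulrA.
Qed.

Lemma ipE_ge0 F : 0 <= ip F F.
Proof.
rewrite /ipE addr_ge0//; first by apply: itg_ge0; [exact: ltW|move=> t _; rewrite -expr2 sqr_ge0].
by rewrite divr_ge0// ?(ltW rho_gt0)// -expr2 sqr_ge0.
Qed.

Lemma l1E_bound F : sqpair F -> l1E F ^+ 2 <= (2 * rho + 2 * pi) * ip F F.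
Proof.
move=> EF; have := itg_norm_sqr pi0 EF; rewrite /l1E /ipE.
have -> : (fun t => F.1 t * F.1 t) = (fun t => F.1 t ^+ 2) by apply/funext => t.
set S := itg (fun t => `|F.1 t|) 0 pi; set Q := itg _ 0 pi => SQ.
have Q0 : 0 <= Q by apply: itg_ge0; [exact: ltW|move=> t _; exact: sqr_ge0].
have d0 : 0 <= F.2 * F.2 / rho by rewrite divr_ge0// ?(ltW rho_gt0)// -expr2 sqr_ge0.
have : `|F.2| ^+ 2 = rho * (F.2 * F.2 / rho).
  by rewrite real_normK ?num_real//; field; rewrite gt_eqF.
have := sqr_ge0 (`|F.2| - S).
have := mulr_ge0 (ltW rho_gt0) Q0; have := mulr_ge0 (ltW pi0) d0.
nra.
Qed.

Lemma ip_sup_bound (F : V) M : continuous F.1 -> (forall x, `|F.1 x| <= M) -> `|F.2| <= M ->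
  ip F F <= (pi + rho^-1) * M ^+ 2.
Proof.
move=> cF hM h2; have M0 : 0 <= M by exact: le_trans (normr_ge0 _) h2.
have sqb (x : R) : `|x| <= M -> x * x <= M ^+ 2.
  by move=> hx; rewrite -expr2 -(real_normK (num_real x)) lerXn2r ?nnegrE.
rewrite /ipE mulrDl; apply: lerD.
  have -> : pi * M ^+ 2 = itg (fun=> M ^+ 2) 0 pi by rewrite itg_cst subr0 mulrC.
  apply: itg_le; [exact/locint_cont/continuous_mulf|exact: locint_cst|exact: ltW|].
  by move=> x _; exact: sqb.
by rewrite [leRHS]mulrC ler_pM2r ?invr_gt0// sqb.
Qed.

(** The abstract density statement for the resolvent [A] at [c]. Compactness holds because [Y] and
    its derivative are bounded by [l1E], so that images of a bounded sequence are equi-Lipschitz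
    with bounded scalar components. *)
Lemma eigvec_dense_range F y y1 e : sqpair F -> resolves q h H H1 H2 c F y y1 -> 0 < e ->
  exists n (a : nat -> R),
    ip ((y, y1 pi + H * y pi) - \sum_(i < n) a i *: eigvec i)
       ((y, y1 pi + H * y pi) - \sum_(i < n) a i *: eigvec i) < e.
Proof.
move=> EF rF e0.
have [Y [Y1 [K [K0 hY]]]] := resolvent_function sq noneig.
pose A (F : V) : V := (Y F, Y1 F pi + H * Y F pi).
have Yeq G z z1 : sqpair G -> resolves q h H H1 H2 c G z z1 -> A G = (z, z1 pi + H * z pi).
  by move=> EG rG; have [e1 e2] := resolves_unique sq noneig EG (hY G EG).1 rG; rewrite /A e1 e2.
rewrite -(Yeq _ _ _ EF rF).
have cY G : sqpair G -> continuous (Y G) by move=> /hY[[[]]].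
have AE G : sqpair G -> sqpair (A G) by move=> EG; apply: sqint_continuous; exact: cY.
have Alin G W k : sqpair G -> sqpair W -> A (G + k *: W) = A G + k *: A W.
  move=> EG EW; rewrite (Yeq _ _ _ _ (resolves_lin sq k EG EW (hY G EG).1 (hY W EW).1)).
    by rewrite /A; congr (_, _); rewrite /= ?scaleRE; ring.
  by apply: sqpairD => //; exact: sqpairZ.
have A0 : A 0 = 0.
  have := Alin 0 0 (-1) (@sqpair0 R) (@sqpair0 R).
  by rewrite !scaleN1r !subrr.
pose kap := (1 + `|H|) * K.
have kap0 : 0 <= kap by rewrite mulr_ge0// addr_ge0.
have Abound G : sqpair G -> (forall x, `|(A G).1 x| <= kap * l1E G) /\ `|(A G).2| <= kap * l1E G.
  move=> EG; have [_ b] := hY G EG; have S0 := l1E_ge0 G.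
  have KS : 0 <= K * l1E G by exact: mulr_ge0.
  split=> [x|].
    have [b1 _] := b x; apply: le_trans b1 _.
    by rewrite /kap -mulrA mulrDl mul1r lerDl mulr_ge0.
  have [b1 b2] := b pi; rewrite /A/=; apply: le_trans (ler_normD _ _) _.
  rewrite normrM /kap -mulrA mulrDl mul1r; apply: lerD => //.
  exact: ler_wpM2l.
pose K' := (pi + rho^-1) * kap ^+ 2 * (2 * rho + 2 * pi).
have pr0 : 0 <= pi + rho^-1 by rewrite addr_ge0 ?(ltW pi0)// invr_ge0 ltW.
have Abnd G : sqpair G -> ip (A G) (A G) <= K' * ip G G.
  move=> EG; have [b1 b2] := Abound G EG.
  apply: le_trans (@ip_sup_bound (A G) _ (cY G EG) b1 b2) _.
  rewrite exprMn /K' -[leRHS]mulrA -[_ * kap ^+ 2 * _]mulrA; apply: ler_wpM2l => //; apply: ler_wpM2l; first exact: sqr_ge0.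
  exact: l1E_bound.
have Anull G : sqpair G -> ip G G = 0 -> A G = 0.
  move=> EG G0; have S0 : l1E G = 0.
    apply/eqP; rewrite -sqrf_eq0 eq_le sqr_ge0 andbT.
    by have := l1E_bound EG; rewrite G0 mulr0.
  have [b1 b2] := Abound G EG; rewrite S0 mulr0 in b1 b2.
  have e1 : (A G).1 = 0.
    by apply/funext => x; apply/eqP; rewrite -normr_eq0 eq_le normr_ge0 andbT; exact: b1.
  have e2 : (A G).2 = 0.
    by apply/eqP; rewrite -normr_eq0 eq_le normr_ge0 andbT.
  by rewrite [LHS]surjective_pairing e1 e2.
have ip0 G : ip G G = 0 -> itg (fun t => G.1 t ^+ 2) 0 pi = 0 /\ G.2 = 0.
  rewrite /ipE => /eqP; rewrite paddr_eq0; last 2 first.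
  - by apply: itg_ge0; [exact: ltW|move=> t _; rewrite -expr2 sqr_ge0].
  - by rewrite divr_ge0// ?(ltW rho_gt0)// -expr2 sqr_ge0.
  move=> /andP[/eqP e1 /eqP e2]; split => //.
  move/eqP: e2; rewrite mulf_eq0 invr_eq0 (gt_eqF rho_gt0) orbF -expr2 sqrf_eq0.
  by move/eqP.
(* If [A G] is null then [Y G] vanishes on [0, pi] by continuity, hence so does its derivative. The
   equation then makes every integral of [G.1] from 0 vanish, so [G.1] is zero almost everywhere,
   and the condition at pi gives [G.2 = 0]. *)
have Ainj G : sqpair G -> ip (A G) (A G) = 0 -> ip G G = 0.
  move=> EG /ip0[e1 e2]; have [[sG _ bG] _] := hY G EG; have [cy cy1 ycl y1cl ye] := sG.
  have y0 := itg_sqr_eq0_continuous pi0 (cY _ EG) e1.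
  have y10 : forall x, 0 <= x <= pi -> Y1 G x = 0.
    apply: continuous_itg_eq0 => // x xpi.
    by have [+ _] := ye x xpi; rewrite (y0 x xpi) (y0 0) ?lexx ?(ltW pi0)// add0r.
  have lG := sqint_locint EG.
  have z0 x : 0 <= x <= pi -> itg G.1 0 x = 0.
    move=> xpi; have /andP[x0 xp] := xpi; have [_] := ye x xpi.
    rewrite (y10 x xpi) (y10 0) ?lexx ?(ltW pi0)// add0r.
    have -> : itg (fun t => (q t - c) * Y G t - G.1 t) 0 x = itg (fun t => - G.1 t) 0 x.
      apply: eq_itg => // t /andP[t0 tx]; rewrite [Y G t]y0 ?mulr0 ?add0r//.
      by rewrite t0 (le_trans tx).
    by rewrite itgN// => /esym/eqP; rewrite oppr_eq0 => /eqP.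
  have G20 : G.2 = 0.
    by rewrite -bG y10 ?y0 ?mulr0 ?addr0// ?lexx ?(ltW pi0).
  rewrite /ipE G20 mul0r mul0r addr0.
  have -> : itg (fun t => G.1 t * G.1 t) 0 pi = itg (fun=> 0) 0 pi; last by rewrite itg_cst mul0r.
  have [mG _] := EG.
  apply: ae_itg; [exact: measurable_funM|exact: measurable_cst|exact: ltW|].
  apply: (@filterS _ _ (ae_filter_ringOfSetsType mu) _ _ _ (itg_eq0_ae lG z0)) => x hx xpi.
  by rewrite hx// mul0r.
have Acomp (F' : nat -> V) B : (forall n, sqpair (F' n)) -> (forall n, ip (F' n) (F' n) <= B) ->
  exists2 G, sqpair G & forall e n0, 0 < e ->
    exists2 n, (n0 <= n)%N & ip (A (F' n) - G) (A (F' n) - G) < e.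
  move=> EF' F'B.
  pose M := kap * Num.sqrt ((2 * rho + 2 * pi) * B).
  have SM n : kap * l1E (F' n) <= M.
    apply: ler_wpM2l => //.
    rewrite -[leLHS]ger0_norm ?l1E_ge0// -sqrtr_sqr ler_wsqrtr//.
    apply: le_trans (l1E_bound (EF' n)) _; apply: ler_wpM2l => //.
    by rewrite addr_ge0// mulr_ge0// ?(ltW pi0)// ltW.
  have [] := @ascoli_lipschitz R (fun n => Y (F' n)) (fun n => (A (F' n)).2) M M.
  - by move=> n x; have [b1 _] := Abound _ (EF' n); apply: le_trans (b1 x) (SM n).
  - by move=> n; have [_ b2] := Abound _ (EF' n); apply: le_trans b2 (SM n).
  - move=> n x x'; have [[[cy cy1 ycl y1cl ye] _ _] b] := hY _ (EF' n).
    rewrite -ycl -(ycl x').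
    have [-> _] := ye _ (cl_itv x); have [-> _] := ye _ (cl_itv x').
    rewrite opprD addrACA subrr add0r.
    have -> : itg (Y1 (F' n)) 0 (cl x) - itg (Y1 (F' n)) 0 (cl x') = itg (Y1 (F' n)) (cl x') (cl x).
      by rewrite -(itg_split 0 (cl x') (cl x) (locint_cont cy1)) addrC addKr.
    apply: le_trans (itg_bound2 (M := M) _ _ (locint_cont cy1) _) _.
      move=> t; have [_ b1] := b t; apply: le_trans b1 _; apply: le_trans (SM n).
      rewrite ler_wpM2r ?l1E_ge0// /kap mulrDl mul1r lerDl mulr_ge0//.
    apply: ler_wpM2l; last exact: cl_lip.
    by apply: le_trans (SM n); rewrite mulr_ge0// l1E_ge0.
  - by move=> n x; have [[[]]] := hY _ (EF' n).
  move=> g [b [cg gcl hg]].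
  exists (g, b); first exact: sqint_continuous.
  move=> d n0 d0.
  have pr : 0 < pi + rho^-1 by rewrite addr_gt0// invr_gt0.
  pose m := Num.min 1 (d / (pi + rho^-1) / 2).
  have m0 : 0 < m by rewrite lt_min ltr01/= divr_gt0// divr_gt0.
  have [n [nn0 h1 h2]] := hg m n0 m0.
  exists n => //.
  apply: le_lt_trans (@ip_sup_bound (A (F' n) - (g, b)) m _ _ _) _.
  - by apply: continuous_subf => //; exact: cY.
  - by move=> x; apply: ltW; exact: h2.
  - exact: ltW.
  rewrite mulrC -ltr_pdivlMr//.
  have h3 : m <= 1 by rewrite ge_min lexx.
  have h4 : m <= d / (pi + rho^-1) / 2 by rewrite ge_min lexx orbT.
  have h5 : 0 < d / (pi + rho^-1) by exact: divr_gt0.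
  apply: (@le_lt_trans _ _ m); last by lra.
  by rewrite expr2 ler_piMl// ltW.
have lamc n : lam n - c != 0.
  apply/eqP => /eqP; rewrite subr_eq0 => /eqP e1.
  have := noneig (y := phi n) (y1 := phi1 n); rewrite -e1 => /(_ (phi_eig n) 0).
  by rewrite phi0; apply/eqP; exact: oner_neq0.
have EU n : sqpair (eigvec n) by apply: sqint_continuous; have [[]] := phi_eig n.
have AU n : A (eigvec n) = (lam n - c)^-1 *: eigvec n.
  pose k := (lam n - c)^-1.
  have [[cy cy1 ycl y1cl ye] hn bn] := phi_eig n.
  rewrite (Yeq _ (fun t => k * phi n t) (fun t => k * phi1 n t))//.
    by congr (_, _); rewrite /= ?scaleRE /k; ring.
  have lq := sqint_locint (sqint_sub_cst (lam n)).
  split.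
  - split.
    + by apply: continuous_mulf => //; exact: continuous_cstf.
    + by apply: continuous_mulf => //; exact: continuous_cstf.
    + by move=> x; rewrite ycl.
    + by move=> x; rewrite y1cl.
    + move=> x xpi; have [e1 e2] := ye x xpi; split.
        by rewrite itgZ ?e1 ?mulrDr//; exact: locint_cont.
      have -> : (fun t => (q t - c) * (k * phi n t) - (eigvec n).1 t) =
        (fun t => k * ((q t - lam n) * phi n t - 0)).
        by apply/funext => t; rewrite /k /eigvec/=; field.
      rewrite itgZ ?e2 ?mulrDr//.
      by under eq_fun do rewrite subr0; exact: locintM.
  - by rewrite hn; ring.
  - rewrite /eigvec/=; apply: (mulfI (lamc n)).
    have -> : (lam n - c) * ((H1 - c) * (k * phi1 n pi) + (H2 - c * H) * (k * phi n pi)) =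
      (H1 * phi1 n pi + H2 * phi n pi) - c * (phi1 n pi + H * phi n pi).
      by rewrite /k; field.
    by rewrite -bn; ring.
have Asym F1 G : sqpair F1 -> sqpair G -> ip (A F1) G = ip F1 (A G).
  by move=> EF1 EG; apply: (resolves_sym sq rho_gt0 EF1 EG (hY _ EF1).1 (hY _ EG).1).
have Uorth m n : m != n -> ip (eigvec m) (eigvec n) = 0.
  move=> /lam_inj lmn; have := Asym _ _ (EU m) (EU n).
  rewrite !AU ipE_scalel// [in RHS]ipE_sym ipE_scalel// [ip (eigvec n) _]ipE_sym.
  move/eqP; rewrite -subr_eq0 -mulrBl mulf_eq0 => /orP[|/eqP//].
  rewrite subr_eq0 => /eqP/invr_inj/eqP.
  by rewrite (inj_eq (addIr _)) (negbTE lmn).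
have Upos n : 0 < ip (eigvec n) (eigvec n).
  rewrite lt_def ipE_ge0 andbT; apply/eqP => /ip0[+ _].
  have [[cy _ _ _ _] _ _] := phi_eig n.
  move=> /(itg_sqr_eq0_continuous pi0 cy)/(_ 0); rewrite lexx ltW// => /(_ isT).
  by rewrite phi0; apply/eqP; exact: oner_neq0.
have Umax w l : sqpair w -> l != 0 -> A w = l *: w -> (forall n, ip w (eigvec n) = 0) -> ip w w = 0.
  move=> Ew l0 Aw wU; have [[[cy cy1 ycl y1cl ye] hw bw] _] := hY w Ew.
  have e1 t : w.1 t = l^-1 * Y w t.
    have -> : Y w t = l * w.1 t.
      have -> : Y w t = (A w).1 t by [].
      by rewrite Aw.
    by rewrite mulKf.
  have e2 : w.2 = l^-1 * (Y1 w pi + H * Y w pi).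
    have -> : Y1 w pi + H * Y w pi = l * w.2.
      have -> : Y1 w pi + H * Y w pi = (A w).2 by [].
      by rewrite Aw.
    by rewrite mulKf.
  (* An eigenvalue [l] of the resolvent at [c] corresponds to the eigenvalue [c + 1 / l] of the
     boundary problem. *)
  pose L := c + l^-1.
  have sL : eigensolution q h H H1 H2 L (Y w) (Y1 w).
    split => //; last first.
      by move: bw; rewrite e2 /L => bw; rewrite mulrDl -bw; ring.
    split => // x xpi; have [h1 h2] := ye x xpi; split => //.
    rewrite h2; congr (_ + itg _ _ _); apply/funext => t; rewrite e1 /L; ring.
  (* If [Y w] vanishes, so do both components of [w]. Otherwise [L] is some [lam n] and [w] is a
     multiple of [eigvec n], to which it is orthogonal. *)
  have [nz|z] := pselect (exists x, Y w x != 0); last first.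
    have Y0 x : Y w x = 0.
      by apply/eqP; apply/negPn/negP => hx; apply: z; exists x.
    have [_ Y10] := sl_zero (sqint_sub_cst L) (locint_cst 0)
      (fun x _ => etrans (itg_cst 0 0 x) (mul0r _)) (let: And3 a _ _ := sL in a)
      (Y0 0) (etrans hw (etrans (congr1 (GRing.mul h) (Y0 0)) (mulr0 h))).
    rewrite /ipE e2 Y0 Y10 mulr0 addr0 mulr0 mul0r mul0r addr0.
    have -> : (fun t => w.1 t * w.1 t) = (fun=> 0).
      by apply/funext => t; rewrite e1 Y0 mulr0 mul0r.
    by rewrite itg_cst mul0r.
  have [n Ln] := lam_all sL nz.
  have [sLy _ _] := sL; rewrite Ln in sLy; have [sn hn _] := phi_eig n.
  have [p1 p2] := sl_proportional (sqint_sub_cst (lam n)) sLy sn hw (phi0 n) (etrans hn (etrans (congr1 (GRing.mul h) (phi0 n)) (mulr1 h))).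
  have -> : ip w w = ip ((l^-1 * Y w 0) *: eigvec n) w.
    congr (ip _ w); rewrite [LHS]surjective_pairing; congr (_, _).
      by apply/funext => t; rewrite e1 p1 mulrA.
    by rewrite e2 p1 p2 /= ?scaleRE; ring.
  by rewrite ipE_scalel// ipE_sym wU mulr0.
have AD G W : sqpair G -> sqpair W -> A (G + W) = A G + A W.
  by move=> EG EW; have := Alin _ _ 1 EG EW; rewrite !scale1r.
have AZ k G : sqpair G -> A (k *: G) = k *: A G.
  by move=> EG; have := Alin 0 G k (@sqpair0 R) EG; rewrite A0 !add0r.
exact: (eigenvectors_dense_range (@sqpairD R) (@sqpairZ R) ipE_sym ipE_addl ipE_scalel ipE_ge0 AE AD AZ Asym Abnd
  Acomp Anull Ainj EU AU Uorth Upos Umax EF e0).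
Qed.

End EigenExpansion.

(** * Smooth approximation with vanishing Cauchy data at both end points *)

Section Smoothing.
Context {R : realType}.
Implicit Types (f g : R -> R) (a b d e x : R).

(** Uniform continuity in which the second point may leave [a, b]; averages over [[x, x + d]] reach
    beyond the end point. *)
Lemma continuous_unif f a b e : continuous f -> 0 < e ->
  exists2 d, 0 < d & forall x t, a <= x <= b -> `|t - x| < d -> `|f t - f x| < e.
Proof.
move=> cf e0.
have /compact_near_coveringP nc := @segment_compact R a b.
have := nc _ (0 : R)^'+ (fun d x => forall t, `|t - x| < d -> `|f t - f x| < e) _.
case.
  move=> x _.
  have [d d0 hd] := (continuousPe f).1 cf x _ (divr_gt0 e0 (@ltr0n R 2)).
  have d2 : 0 < d / 2 by exact: divr_gt0.
  exists (ball x (d / 2), [set d' | d' < d / 2]) => /=.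
    split; first exact: nbhsx_ballx.
    by near=> d'; near: d'; exact: nbhs_right_lt.
  move=> [y d'] /= [xy dd'] t ty.
  have h1 : `|f y - f x| < e / 2.
    by apply: hd; rewrite distrC (lt_trans xy)//; lra.
  have h2 : `|f t - f x| < e / 2.
    apply: hd; have -> : t - x = (t - y) + (y - x) by ring.
    apply: le_lt_trans (ler_normD _ _) _.
    by rewrite [ltRHS](splitr d) ltrD//; [exact: lt_trans dd'|rewrite distrC].
  have -> : f t - f y = (f t - f x) - (f y - f x) by ring.
  by apply: le_lt_trans (ler_normB _ _) _; rewrite [ltRHS](splitr e) ltrD.
move=> d /= d0 hd; exists (d / 2); first exact: divr_gt0.
move=> x t xab; apply: (hd (d / 2)).
- by rewrite /ball_ /= sub0r normrN gtr0_norm ?divr_gt0//; lra.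
- exact: divr_gt0.
- by rewrite /= in_itv.
Unshelve. all: by end_near. Qed.

(** Forward moving average. It gains one derivative, namely the difference quotient of [f] with step
    [d]. *)
Definition steklov d f x := d^-1 * itg f x (x + d).

Lemma is_derive_steklov d f x : continuous f ->
  is_derive x 1 (steklov d f) (d^-1 * (f (x + d) - f x)).
Proof.
move=> cf.
have -> : steklov d f = (fun y => d^-1 * (itg f 0 (y + d) - itg f 0 y)).
  apply/funext => y; rewrite /steklov -(itg_split 0 y (y + d) (locint_cont cf)); congr (_ * _).
  by rewrite [RHS]addrAC subrr add0r.
have d1 : is_derive x (1:R) (fun y => itg f 0 (y + d)) (f (x + d)).
  rewrite -[f _]mulr1.
  apply: (@is_derive1_comp _ (itg f 0) (fun t => t + d)); first exact: is_derive_itg.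
  by rewrite -[X in is_derive _ _ _ X]addr0; apply: is_deriveD.
have d2 := is_derive_itg 0 x cf.
exact: is_deriveZ.
Qed.

Lemma continuous_shift f d : continuous f -> continuous (fun x => f (x + d)).
Proof.
move=> cf; apply: continuous_compf => //.
by apply: continuous_addf; [exact: continuous_idf|exact: continuous_cstf].
Qed.

Lemma steklov_continuous d f : continuous f -> continuous (steklov d f).
Proof. by move=> cf; apply: is_derive_continuous => x; exact: is_derive_steklov. Qed.

Lemma steklov_close d f x k e : 0 < d -> continuous f ->
  (forall t, x <= t <= x + d -> `|f t - k| <= e) -> `|steklov d f x - k| <= e.
Proof.
move=> d0 cf h.
have xd : x <= x + d by rewrite lerDl ltW.
have -> : steklov d f x - k = d^-1 * itg (fun t => f t - k) x (x + d).
  rewrite /steklov itgB ?itg_cst; [|exact: locint_cont|exact: locint_cst].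
  by field; rewrite gt_eqF.
rewrite normrM gtr0_norm ?invr_gt0// mulrC ler_pdivrMr//.
have : `|itg (fun t => f t - k) x (x + d)| <= e * (x + d - x).
  apply: itg_bound => //; apply: locintB; [exact: locint_cont|exact: locint_cst].
by rewrite addrAC subrr add0r.
Qed.

Lemma steklov_eq0 d f x : 0 < d -> continuous f ->
  (forall t, x <= t <= x + d -> f t = 0) -> steklov d f x = 0.
Proof.
move=> d0 cf h; apply/eqP; rewrite -normr_eq0 eq_le normr_ge0 andbT -[X in `|X|]subr0.
by apply: steklov_close => // t /h ->; rewrite subr0 normr0.
Qed.

(** Piecewise linear cutoff, rising from 0 at [a] to 1 at [a + d]. *)
Definition ramp (a d x : R) := Num.min 1 (Num.max 0 ((x - a) / d)).

Lemma ramp_itv a d x : 0 <= ramp a d x <= 1.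
Proof. by rewrite /ramp le_min ler01 le_max lexx ge_min lexx. Qed.

Lemma ramp0 a d x : 0 < d -> x <= a -> ramp a d x = 0.
Proof.
move=> d0 xa; rewrite /ramp [Num.max _ _]max_l; first by rewrite min_r.
by rewrite pmulr_lle0 ?invr_gt0// subr_le0.
Qed.

Lemma ramp1 a d x : 0 < d -> a + d <= x -> ramp a d x = 1.
Proof.
move=> d0 xa; have h : 1 <= (x - a) / d by rewrite ler_pdivlMr//; lra.
by rewrite /ramp max_r ?min_l// (le_trans ler01).
Qed.

Lemma ramp_continuous a d : continuous (ramp a d).
Proof.
have c1 : continuous (fun x : R => (x - a) / d).
  apply: continuous_mulf; last exact: continuous_cstf.
  by apply: continuous_subf; [exact: continuous_idf|exact: continuous_cstf].
have c2 : continuous (fun x : R => Num.max 0 ((x - a) / d)).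
  by move=> x; exact: (@continuous_max R R (fun=> 0) _ x (@continuous_cstf R 0 x) (c1 x)).
by move=> x; exact: (@continuous_min R R (fun=> 1) _ x (@continuous_cstf R 1 x) (c2 x)).
Qed.

(* [z] is [f], cut off near the end points and then averaged twice. *)
Lemma smooth_approximation f e : continuous f -> 0 < e ->
  exists z z1 z2 : R -> R, [/\ forall x, is_derive x 1 z (z1 x), forall x, is_derive x 1 z1 (z2 x),
    continuous z2, [/\ z 0 = 0, z1 0 = 0, z pi = 0 & z1 pi = 0] &
    itg (fun t => (f t - z t) ^+ 2) 0 pi < e].
Proof.
move=> cf e0; have pi0 := @pi_gt0 R.
have [M M0 hM] := continuous_itv_bounded 0 pi cf.
have M1 : 0 < M ^+ 2 + 1 by rewrite ltr_wpDl// sqr_ge0.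
(* The cutoff alters [f] on two strips of width [3 * eta], by at most [M] in absolute value. This
   costs [6 * M ^+ 2 * eta], a quantity that is doubled in the last estimate; [6 * eta <= pi] makes
   the strips fit. *)
have [eta [eta0 eta1 eta2]] : exists eta : R, [/\ 0 < eta, 6 * eta <= pi & 12 * M ^+ 2 * eta <= e / 2].
  pose eta := Num.min (pi / 6) (e / 24 / (M ^+ 2 + 1)).
  have h0 : 0 < eta by rewrite lt_min divr_gt0//= !divr_gt0.
  have h1 : eta <= pi / 6 by rewrite ge_min lexx.
  have h2 : eta <= e / 24 / (M ^+ 2 + 1) by rewrite ge_min lexx orbT.
  exists eta; split => //; first lra.
  move: h2; rewrite ler_pdivlMr// => h2; have := sqr_ge0 M; nra.
(* [chi] vanishes within [2 * eta] of both end points, which leaves room for two forward averages of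
   step at most [eta / 2]. *)
pose chi x := ramp (2 * eta) eta x * ramp (2 * eta) eta (pi - x).
have cchi : continuous chi.
  apply: continuous_mulf; first exact: ramp_continuous.
  apply: continuous_compf; first exact: ramp_continuous.
  by apply: continuous_subf; [exact: continuous_cstf|exact: continuous_idf].
have chi01 x : 0 <= chi x <= 1.
  have /andP[a0 a1] := ramp_itv (2 * eta) eta x.
  have /andP[b0 b1] := ramp_itv (2 * eta) eta (pi - x).
  by rewrite /chi mulr_ge0//= mulr_ile1.
have chi0l x : x <= 2 * eta -> chi x = 0 by move=> hx; rewrite /chi ramp0// mul0r.
have chi0r x : pi - 2 * eta <= x -> chi x = 0.
  by move=> hx; rewrite /chi [X in _ * X]ramp0 ?mulr0//; lra.
have chi1 x : 3 * eta <= x <= pi - 3 * eta -> chi x = 1.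
  by move=> /andP[h1 h2]; rewrite /chi !ramp1 ?mulr1//; lra.
pose g x := f x * chi x.
have cg : continuous g by exact: continuous_mulf.
(* A uniform error [w] has a square integral of at most [e / 8] over [0, pi]. *)
pose w := Num.sqrt (e / 8 / pi).
have w0 : 0 < w by rewrite sqrtr_gt0 !divr_gt0.
have w2 : w ^+ 2 = e / 8 / pi by rewrite sqr_sqrtr// ltW// !divr_gt0.
have [d1 d10 hd1] := continuous_unif 0 pi cg w0.
pose d := Num.min (d1 / 3) (eta / 2).
have d0 : 0 < d by rewrite lt_min !divr_gt0.
have dd1 : d <= d1 / 3 by rewrite ge_min lexx.
have dde : d <= eta / 2 by rewrite ge_min lexx orbT.
pose s := steklov d g.
have cs : continuous s by exact: steklov_continuous.
have s0l x : x <= eta -> s x = 0.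
  move=> xe; apply: steklov_eq0 => // t /andP[xt tx]; rewrite /g chi0l ?mulr0//; lra.
have s0r x : pi - 2 * eta <= x -> s x = 0.
  move=> xe; apply: steklov_eq0 => // t /andP[xt tx]; rewrite /g chi0r ?mulr0//; lra.
pose z := steklov d s.
pose z1 x := d^-1 * (s (x + d) - s x).
pose s' x := d^-1 * (g (x + d) - g x).
pose z2 x := d^-1 * (s' (x + d) - s' x).
have cs' : continuous s'.
  apply: continuous_mulf; first exact: continuous_cstf.
  by apply: continuous_subf => //; exact: continuous_shift.
have dz x : is_derive x (1 : R) z (z1 x) by exact: is_derive_steklov.
have dz1 x : is_derive x (1 : R) z1 (z2 x).
  apply: is_deriveZ; apply: is_deriveB; last exact: is_derive_steklov.
  rewrite -[s' _]mulr1.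
  apply: (@is_derive1_comp _ s (fun t => t + d)); first exact: is_derive_steklov.
  by rewrite -[X in is_derive _ _ _ X]addr0; apply: is_deriveD.
exists z, z1, z2; split => //.
- apply: continuous_mulf; first exact: continuous_cstf.
  by apply: continuous_subf => //; exact: continuous_shift.
- split.
  + by apply: steklov_eq0 => // t /andP[xt tx]; rewrite s0l//; lra.
  + by rewrite /z1 !s0l ?subrr ?mulr0//; lra.
  + by apply: steklov_eq0 => // t /andP[xt tx]; rewrite s0r//; lra.
  + by rewrite /z1 !s0r ?subrr ?mulr0//; lra.
have cz : continuous z by exact: is_derive_continuous dz.
have zg x : 0 <= x <= pi -> (g x - z x) ^+ 2 <= e / 8 / pi.
  move=> xpi; rewrite -w2.
  rewrite -(real_normK (num_real (g x - z x))); apply: lerXn2r; rewrite ?nnegrE ?(ltW w0)//.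
  rewrite distrC; apply: steklov_close => // t /andP[xt tx].
  apply: steklov_close => // r /andP[tr rt]; apply: ltW; apply: hd1 => //.
  by rewrite ger0_norm ?subr_ge0; lra.
have fg x : 0 <= x <= pi -> (f x - g x) ^+ 2 <= M ^+ 2.
  move=> xpi; have /andP[c0 c1] := chi01 x.
  rewrite -(real_normK (num_real (f x - g x))); apply: lerXn2r; rewrite ?nnegrE//.
  apply: le_trans (hM x xpi).
  have -> : f x - g x = f x * (1 - chi x) by rewrite /g; ring.
  by rewrite normrM [X in _ * X]ger0_norm ?subr_ge0// ler_piMr// lerBlDr lerDl.
have cfg : continuous (fun t => (f t - g t) ^+ 2).
  by apply: continuous_mulf; exact: continuous_subf.
have cgz : continuous (fun t => (g t - z t) ^+ 2).
  by apply: continuous_mulf; exact: continuous_subf.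
have cfz : continuous (fun t => (f t - z t) ^+ 2).
  by apply: continuous_mulf; exact: continuous_subf.
have lfg := locint_cont cfg; have lgz := locint_cont cgz.
have I1 : itg (fun t => (g t - z t) ^+ 2) 0 pi <= e / 8.
  have -> : e / 8 = itg (fun=> e / 8 / pi) 0 pi.
    by rewrite itg_cst subr0 mulfVK// gt_eqF.
  by apply: itg_le => //; [exact: locint_cst|exact: ltW].
have I2 : itg (fun t => (f t - g t) ^+ 2) 0 pi <= 6 * M ^+ 2 * eta.
  rewrite -(itg_split 0 (3 * eta) pi lfg) -(itg_split (3 * eta) (pi - 3 * eta) pi lfg).
  have h0 : itg (fun t => (f t - g t) ^+ 2) (3 * eta) (pi - 3 * eta) = 0.
    rewrite (@eq_itg _ _ (fun=> 0)) ?itg_cst ?mul0r//; first by lra.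
    by move=> x hx; rewrite /g chi1// mulr1 subrr expr0n.
  have part a b : a <= b -> 0 <= a -> b <= pi -> itg (fun t => (f t - g t) ^+ 2) a b <= M ^+ 2 * (b - a).
    move=> ab a0 bpi; rewrite -itg_cst; apply: itg_le => //; first exact: locint_cst.
    by move=> x /andP[ax xb]; apply: fg; rewrite (le_trans a0)//= (le_trans xb).
  have := part 0 (3 * eta); have := part (pi - 3 * eta) pi; rewrite h0.
  have a1 : pi - 3 * eta <= pi by lra. have a2 : 0 <= pi - 3 * eta by lra.
  have a3 : 0 <= 3 * eta by lra. have a4 : 3 * eta <= pi by lra.
  rewrite a1 a2 a3 a4 !lexx => /(_ isT isT isT) p1 /(_ isT isT isT) p2.
  lra.
apply: (@le_lt_trans _ _ (itg (fun t => 2 * (f t - g t) ^+ 2 + 2 * (g t - z t) ^+ 2) 0 pi)).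
  apply: itg_le; [exact: locint_cont|by apply: locintD; exact: locintZ|exact: ltW|].
  move=> t _; have := sqr_ge0 ((f t - g t) - (g t - z t)); nra.
rewrite itgD ?itgZ//; try exact: locintZ.
lra.
Qed.

End Smoothing.

(** * Cosine and sine solutions for a real spectral parameter *)

Section CosineFamily.
Context {R : realType}.
Implicit Types (l k x s t : R).

(** [C] and [S] stand for cos(k x) and sin(k x) / k with k^2 = l, in their linear form for l = 0 and
    hyperbolic form for l < 0. The identities listed are common to the three cases, so the sign of
    an eigenvalue plays no part afterwards. *)
Definition cosine_family l (C S : R -> R) :=
  [/\ (forall x, is_derive x 1 C (- l * S x)) /\ (forall x, is_derive x 1 S (C x)), C 0 = 1 /\ S 0 = 0, forall x, C (- x) = C x,
   forall s x, C (s + x) + C (s - x) = 2 * (C s * C x) &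
   forall s x, S (s + x) - S (s - x) = 2 * (C s * S x)].

Lemma is_derive_scale_arg (f f' : R -> R) k x : (forall x, is_derive x 1 f (f' x)) ->
  is_derive x 1 (fun t => f (k * t)) (k * f' (k * x)).
Proof.
move=> df; rewrite mulrC.
have d1 : is_derive x (1 : R) (fun t => k * t) k.
  by rewrite -[X in is_derive _ _ _ X]mulr1; apply: is_deriveZ.
by apply: (@is_derive1_comp _ f (fun t => k * t)).
Qed.

Lemma cosine_family_exists l : exists C S, cosine_family l C S.
Proof.
have [l0|l0|l0] := ltgtP l 0; last first.
- exists (fun=> 1), (fun x => x); rewrite l0; split.
  + by split=> x; rewrite ?oppr0 ?mul0r; [exact: is_derive_cst|exact: is_derive_id].
  + by [].
  + by [].
  + by move=> s x; ring.
  + by move=> s x; ring.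
- pose k := Num.sqrt l.
  have k0 : k != 0 by rewrite gt_eqF// sqrtr_gt0.
  have kk : k * k = l by rewrite -expr2 sqr_sqrtr// ltW.
  exists (fun x => cos (k * x)), (fun x => k^-1 * sin (k * x)); split.
  + split=> x.
      have -> : - l * (k^-1 * sin (k * x)) = k * - sin (k * x).
        by rewrite -kk; field.
      exact: (is_derive_scale_arg (f' := fun x => - sin x)).
    have -> : cos (k * x) = k^-1 * (k * cos (k * x)) by field.
    by apply: is_deriveZ; exact: is_derive_scale_arg.
  + by rewrite mulr0 cos0 sin0 mulr0.
  + by move=> x; rewrite mulrN cosN.
  + by move=> s x; rewrite mulrDr mulrBr cosD cosB; ring.
  + by move=> s x; rewrite mulrDr mulrBr sinD sinB; ring.
- pose k := Num.sqrt (- l).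
  have k0 : k != 0 by rewrite gt_eqF// sqrtr_gt0 oppr_gt0.
  have kk : k * k = - l by rewrite -expr2 sqr_sqrtr// oppr_ge0 ltW.
  have de x m : is_derive x (1 : R) (fun t => expR (m * t)) (m * expR (m * x)).
    exact: (is_derive_scale_arg (f' := expR)).
  exists (fun x => 2^-1 * (expR (k * x) + expR (- k * x))),
    (fun x => (2 * k)^-1 * (expR (k * x) - expR (- k * x))); split.
  + split=> x.
      have -> : - l * ((2 * k)^-1 * (expR (k * x) - expR (- k * x))) =
        2^-1 * (k * expR (k * x) + - k * expR (- k * x)).
        by rewrite -kk; field.
      by apply: is_deriveZ; exact: is_deriveD.
    have -> : 2^-1 * (expR (k * x) + expR (- k * x)) =
        (2 * k)^-1 * (k * expR (k * x) - - k * expR (- k * x)) by field.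
    by apply: is_deriveZ; exact: is_deriveB.
  + by rewrite !mulr0 expR0 subrr mulr0; split=> //; field.
  + by move=> x; rewrite !mulrN !mulNr opprK addrC.
  + move=> s x; rewrite !mulrDr !mulrN !mulNr ?opprK !expRD ?opprK; by field.
  + move=> s x; rewrite !mulrDr !mulrN !mulNr ?opprK !expRD ?opprK; field.
    by [].
Qed.

End CosineFamily.

(** * The integral operator of the wave equation *)

Section WaveOperator.
Context {R : realType}.
Implicit Types (v : R * R -> R) (q f : R -> R) (x s t : R).

(** Bounded and uniformly continuous functions of the plane: a class that is stable under [wave] and
    under uniform limits, as the fixed point iteration requires. *)
Definition ucb v := (exists M, forall z, `|v z| <= M) /\
  forall e, 0 < e -> exists2 d, 0 < d &
    forall x x' s s', `|x - x'| < d -> `|s - s'| < d -> `|v (x, s) - v (x', s')| < e.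

(** Integral of [v] over the slice at time [t] of the backward light cone with vertex [(x, s)]. *)
Definition cone v x s t := itg (fun r => v (t, r)) (s - (x - t)) (s + (x - t)).

(* The Duhamel term of the wave equation [u_xx - u_ss = q u], with x in the role of time. *)
Definition wave q v (z : R * R) :=
  2^-1 * itg (fun t => q t * cone v (cl z.1) z.2 t) 0 (cl z.1).

Lemma itg_mul_bound q g K a b : locint q -> continuous g -> a <= b ->
  (forall t, a <= t <= b -> `|g t| <= K) ->
  `|itg (fun t => q t * g t) a b| <= K * itg (fun t => `|q t|) a b.
Proof.
move=> lq cg ab gK; have lqg : locint (fun t => q t * g t) by exact: locintM.
apply: le_trans (itg_norm lqg ab) _; rewrite -itgZ; last exact: locint_norm.
apply: itg_le => //; [exact: locint_norm|exact/locintZ/locint_norm|].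
by move=> t tab; rewrite normrM mulrC ler_wpM2r// gK.
Qed.

Lemma ucb_section v t : ucb v -> continuous (fun r => v (t, r)).
Proof.
move=> [_ uv]; apply/continuousPe => s e e0; have [d d0 hd] := uv e e0.
by exists d => // s' hs; apply: hd => //; rewrite subrr normr0.
Qed.

Lemma continuous_itg_ends f (a b : R -> R) : continuous f -> continuous a -> continuous b ->
  continuous (fun t => itg f (a t) (b t)).
Proof.
move=> cf ca cb; have lf := locint_cont cf.
have -> : (fun t => itg f (a t) (b t)) = (fun t => itg f 0 (b t) - itg f 0 (a t)).
  by apply/funext => t; rewrite -(itg_split 0 (a t) (b t) lf) [RHS]addrAC subrr add0r.
by apply: continuous_subf; apply: continuous_compf => //; exact: itg_continuous.
Qed.

Lemma cone_continuous v x s : ucb v -> continuous (cone v x s).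
Proof.
move=> uv; apply/continuousPe => t0 e e0.
have cA : continuous (fun t : R => s - (x - t)).
  by apply: continuous_subf; [exact: continuous_cstf|apply: continuous_subf; [exact: continuous_cstf|exact: continuous_idf]].
have cB : continuous (fun t : R => s + (x - t)).
  by apply: continuous_addf; [exact: continuous_cstf|apply: continuous_subf; [exact: continuous_cstf|exact: continuous_idf]].
have e2 : 0 < e / 2 by exact: divr_gt0.
have [d1 d10 h1] := (continuousPe _).1 (continuous_itg_ends (@ucb_section v t0 uv) cA cB) t0 _ e2.
pose L := 2 * (`|x - t0| + 2).
have L0 : 0 < L by rewrite mulr_gt0// ltr_wpDl.
have [d2 d20 h2] := uv.2 (e / 2 / L) (divr_gt0 e2 L0).
exists (Num.min 1 (Num.min d1 d2)); first by rewrite !lt_min ltr01 d10.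
move=> t; rewrite !lt_min => /and3P[t1 td1 td2].
have -> : cone v x s t - cone v x s t0 =
  itg (fun r => v (t, r) - v (t0, r)) (s - (x - t)) (s + (x - t)) +
  (itg (fun r => v (t0, r)) (s - (x - t)) (s + (x - t)) -
   itg (fun r => v (t0, r)) (s - (x - t0)) (s + (x - t0))).
  rewrite itgB; [|exact/locint_cont/ucb_section..]; rewrite /cone; ring.
have cd : continuous (fun r => v (t, r) - v (t0, r)) by apply: continuous_subf; exact: ucb_section.
have h3 : `|itg (fun r => v (t, r) - v (t0, r)) (s - (x - t)) (s + (x - t))| <=
    e / 2 / L * `|s + (x - t) - (s - (x - t))|.
  apply: itg_bound2; first exact: locint_cont.
  by move=> r; apply: ltW; apply: h2 => //; rewrite subrr normr0.
have h4 : `|s + (x - t) - (s - (x - t))| <= L.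
  have -> : s + (x - t) - (s - (x - t)) = 2 * ((x - t0) - (t - t0)) by ring.
  rewrite normrM ger0_norm// /L ler_pM2l//.
  apply: le_trans (ler_normB _ _) _; rewrite lerD2l; apply: le_trans (ltW t1) _; lra.
have h5 : e / 2 / L * `|s + (x - t) - (s - (x - t))| <= e / 2.
  by rewrite -[leRHS](mulfVK (lt0r_neq0 L0)) ler_wpM2l// ltW// divr_gt0.
apply: le_lt_trans (ler_normD _ _) _.
by rewrite [ltRHS](splitr e) ler_ltD//; [exact: le_trans h5|exact: h1].
Qed.

Lemma cone_bound v x s t M : ucb v -> (forall z, `|v z| <= M) -> `|cone v x s t| <= M * (2 * `|x - t|).
Proof.
move=> uv vM; apply: le_trans (itg_bound2 (M := M) _ _ _ _) _.
- exact/locint_cont/ucb_section.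
- by move=> r; exact: vM.
have -> : s + (x - t) - (s - (x - t)) = 2 * (x - t) by ring.
by rewrite normrM ger0_norm.
Qed.

(** [wave q v] is even Lipschitz: moving the vertex shifts each end point of a slice by at most
    [|x - x'| + |s - s'|] and adds the slices between [cl x'] and [cl x], so only the bound of [v]
    and the L1 norm of [q] enter. *)
Lemma wave_ucb q v : locint q -> ucb v -> ucb (wave q v).
Proof.
move=> lq uv; have [[M vM] _] := uv.
have M0 : 0 <= M by apply: le_trans (vM (0, 0)).
have pi0 := @pi_gt0 R.
pose Q := itg (fun t => `|q t|) 0 pi.
have Q0 : 0 <= Q by apply: itg_ge0 => //; exact: ltW.
have lc x s : locint (fun t => q t * cone v x s t).
  by apply: locintM => //; exact: cone_continuous.
have lnq := locint_norm lq.
split.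
  exists (2^-1 * (M * (2 * pi) * Q)) => -[x s]; rewrite /wave/=.
  have /andP[c0 c1] := cl_itv x.
  rewrite normrM ger0_norm// ler_pM2l//.
  apply: (@le_trans _ _ (M * (2 * pi) * itg (fun t => `|q t|) 0 (cl x))).
    apply: itg_mul_bound => //; first exact: cone_continuous.
    move=> t /andP[t0 tx]; apply: le_trans (cone_bound _ _ _ uv vM) _.
    by rewrite ler_wpM2l// ler_pM2l// ger0_norm ?subr_ge0//; lra.
  by apply: ler_wpM2l; [rewrite !mulr_ge0// ltW|exact: itg_mono].
have lip x x' s s' : cl x' <= cl x ->
    `|wave q v (x, s) - wave q v (x', s')| <= 2 * M * Q * (`|x - x'| + `|s - s'|).
  move=> xx'; have /andP[c0 c1] := cl_itv x; have /andP[c0' c1'] := cl_itv x'.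
  rewrite /wave/= -mulrBr -(itg_split 0 (cl x') (cl x) (lc _ _)).
  rewrite addrAC -itgB//.
  have dx := cl_lip x x'; rewrite ger0_norm ?subr_ge0// in dx.
  have h1 : `|itg (fun t => q t * cone v (cl x) s t - q t * cone v (cl x') s' t) 0 (cl x')| <=
      2 * M * (`|x - x'| + `|s - s'|) * itg (fun t => `|q t|) 0 (cl x').
    under eq_fun do rewrite -mulrBr.
    apply: itg_mul_bound => //; first by apply: continuous_subf; exact: cone_continuous.
    move=> t _; rewrite /cone.
    have lv := locint_cont (@ucb_section v t uv).
    set A := s - (cl x - t); set B := s + (cl x - t).
    set A' := s' - (cl x' - t); set B' := s' + (cl x' - t).
    have -> : itg (fun r => v (t, r)) A B - itg (fun r => v (t, r)) A' B' =
        itg (fun r => v (t, r)) A A' + itg (fun r => v (t, r)) B' B.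
      by rewrite -(itg_split A A' B lv) -(itg_split A' B' B lv); ring.
    apply: le_trans (ler_normD _ _) _.
    have b1 := itg_bound2 A A' lv (fun r => vM (t, r)).
    have b2 := itg_bound2 B' B lv (fun r => vM (t, r)).
    have k1 : `|A' - A| <= `|x - x'| + `|s - s'|.
      have -> : A' - A = (cl x - cl x') - (s - s') by rewrite /A /A'; ring.
      by apply: le_trans (ler_normB _ _) _; rewrite lerD2r ger0_norm ?subr_ge0.
    have k2 : `|B - B'| <= `|x - x'| + `|s - s'|.
      have -> : B - B' = (cl x - cl x') + (s - s') by rewrite /B /B'; ring.
      by apply: le_trans (ler_normD _ _) _; rewrite lerD2r ger0_norm ?subr_ge0.
    have := ler_wpM2l M0 k1; have := ler_wpM2l M0 k2; lra.
  have h2 : `|itg (fun t => q t * cone v (cl x) s t) (cl x') (cl x)| <=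
      2 * M * (`|x - x'| + `|s - s'|) * itg (fun t => `|q t|) (cl x') (cl x).
    apply: itg_mul_bound => //; first exact: cone_continuous.
    move=> t /andP[t0 tx]; apply: le_trans (cone_bound _ _ _ uv vM) _.
    rewrite ger0_norm ?subr_ge0// [M * _]mulrA [M * 2]mulrC ler_wpM2l ?mulr_ge0//.
    have := normr_ge0 (s - s'); lra.
  rewrite normrM ger0_norm//.
  have h3 : itg (fun t => `|q t|) 0 (cl x') + itg (fun t => `|q t|) (cl x') (cl x) <= Q.
    by rewrite itg_split//; exact: itg_mono.
  have k0 : 0 <= 2 * M * (`|x - x'| + `|s - s'|) by rewrite !mulr_ge0// addr_ge0.
  have := ler_wpM2l k0 h3; rewrite mulrDr => h4.
  have := le_trans (ler_normD _ _) (le_trans (lerD h1 h2) h4) => h5.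
  have z0 : 0 <= 2 * M * (`|x - x'| + `|s - s'|) * Q by exact: mulr_ge0.
  rewrite mulrAC; set N := `|_ + _|; move: h5; rewrite -/N; lra.
move=> e e0; pose L := 2 * M * Q + 1.
have L0 : 0 < L by rewrite /L ltr_wpDl// !mulr_ge0.
exists (e / L / 2); first by rewrite !divr_gt0.
move=> x x' s s' hx hs.
have key : 2 * M * Q * (`|x - x'| + `|s - s'|) < e.
  apply: (@le_lt_trans _ _ (L * (`|x - x'| + `|s - s'|))).
    by apply: ler_wpM2r; [exact: addr_ge0|rewrite /L lerDl].
  by rewrite mulrC -ltr_pdivlMr// (splitr (e / L)) ltrD.
apply: le_lt_trans key; case: (leP (cl x') (cl x)) => [|/ltW] cc; first exact: lip.
by rewrite distrC [`|x - _|]distrC [`|s - _|]distrC; exact: lip.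
Qed.

Lemma ucb_add v w : ucb v -> ucb w -> ucb (fun z => v z + w z).
Proof.
move=> [[M hM] uv] [[N hN] uw]; split.
  exists (M + N) => z; apply: le_trans (ler_normD _ _) _; exact: lerD.
move=> e e0; have e2 : 0 < e / 2 by exact: divr_gt0.
have [d1 d10 h1] := uv _ e2; have [d2 d20 h2] := uw _ e2.
exists (Num.min d1 d2); first by rewrite lt_min d10.
move=> x x' s s'; rewrite !lt_min => /andP[x1 x2] /andP[s1 s2].
have -> : v (x, s) + w (x, s) - (v (x', s') + w (x', s')) =
  (v (x, s) - v (x', s')) + (w (x, s) - w (x', s')) by ring.
apply: le_lt_trans (ler_normD _ _) _; rewrite (splitr e) ltrD//; [exact: h1|exact: h2].
Qed.

Lemma ucb_scale k v : ucb v -> ucb (fun z => k * v z).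
Proof.
move=> [[M hM] uv]; split.
  by exists (`|k| * M) => z; rewrite normrM ler_wpM2l.
have k0 : 0 < `|k| + 1 by rewrite ltr_wpDl.
move=> e e0; have [d d0 h] := uv (e / (`|k| + 1)) (divr_gt0 e0 k0).
exists d => // x x' s s' hx hs; rewrite -mulrBr normrM.
have := h _ _ _ _ hx hs; rewrite ltr_pdivlMr// => h1.
apply: le_lt_trans h1; rewrite mulrC ler_wpM2l// lerDl//.
Qed.

Lemma ucb_limit v : (forall e, 0 < e -> exists2 w, ucb w & forall z, `|v z - w z| <= e) -> ucb v.
Proof.
move=> h; split.
  have [w [[M hM] _] hw] := h 1 ltr01.
  exists (1 + M) => z; have := hw z; have := hM z; rewrite !ler_norml; lra.
move=> e e0; have e4 : 0 < e / 4 by exact: divr_gt0.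
have [w [_ uw] hw] := h _ e4; have [d d0 hd] := uw _ e4.
exists d => // x x' s s' hx hs.
have := hd _ _ _ _ hx hs; have := hw (x, s); have := hw (x', s').
rewrite !ler_norml !ltr_norml; lra.
Qed.

Lemma wave_sub q v w z : locint q -> ucb v -> ucb w ->
  wave q v z - wave q w z = wave q (fun z => v z - w z) z.
Proof.
move=> lq uv uw; rewrite /wave -mulrBr -itgB; [|apply: locintM => //; exact: cone_continuous..].
congr (_ * itg _ _ _); apply/funext => t; rewrite -mulrBr; congr (_ * _).
by rewrite /cone itgB//; exact/locint_cont/ucb_section.
Qed.

End WaveOperator.

(** * The wave with given initial data: existence, L1 bound and uniqueness *)

Section Transmutation.
Context {R : realType}.
Implicit Types (v : R * R -> R) (f g : R -> R) (x s t : R).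
Variables (q : R -> R) (h : R).
Hypothesis sq : sqint q.
Let lq := sqint_locint sq.
Let pi0 : 0 < pi :> R := pi_gt0 R.

(* The wave [u(x, s)] with [u(0, s) = f s], [u_x(0, s) = h f s] for the even extension of [f] is
   [travel f + v], where [v = source f + wave q v]; for [f] the cosine it is [phi x * f s]. *)
Definition evenx f s := f (cl `|s|).
Definition travel f (z : R * R) := 2^-1 * (evenx f (z.2 + cl z.1) + evenx f (z.2 - cl z.1)).
(** L1 norm of the extended initial data over the domain of dependence of [z], the base of its
    backward cone. At [s = 0] it is twice the integral of [|f|] over [0, x]. *)
Definition influence f (z : R * R) := itg (fun r => `|evenx f r|) (z.2 - cl z.1) (z.2 + cl z.1).
Definition source f (z : R * R) :=
  h / 2 * itg (evenx f) (z.2 - cl z.1) (z.2 + cl z.1) + wave q (travel f) z.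

Lemma unif_cl f : continuous f -> forall e, 0 < e -> exists2 d, 0 < d &
  forall s s', `|s - s'| < d -> `|f (cl s) - f (cl s')| < e.
Proof.
move=> cf e e0; have [d d0 hd] := continuous_unif 0 pi cf e0.
exists d => // s s' hs; apply: hd; first exact: cl_itv.
exact: le_lt_trans (cl_lip _ _) hs.
Qed.

Lemma evenx_unif f : continuous f -> forall e, 0 < e -> exists2 d, 0 < d &
  forall s s', `|s - s'| < d -> `|evenx f s - evenx f s'| < e.
Proof.
move=> cf e e0; have [d d0 hd] := unif_cl cf e0.
by exists d => // s s' hs; apply: hd; apply: le_lt_trans hs; exact: ler_dist_dist.
Qed.

Lemma evenx_bounded f : continuous f -> exists2 M, 0 <= M & forall s, `|evenx f s| <= M.
Proof.
move=> cf; have [M M0 h0] := continuous_itv_bounded 0 pi cf.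
by exists M => // s; apply: h0; exact: cl_itv.
Qed.

Lemma evenx_continuous f : continuous f -> continuous (evenx f).
Proof.
move=> cf; apply/continuousPe => s e e0; have [d d0 hd] := evenx_unif cf e0.
by exists d => // s'; exact: hd.
Qed.

Lemma evenxN f s : evenx f (- s) = evenx f s.
Proof. by rewrite /evenx normrN. Qed.

Lemma evenx_id f s : `|s| <= pi -> (forall x, f (- x) = f x) -> evenx f s = f s.
Proof.
move=> sp fe; rewrite /evenx cl_id ?normr_ge0//.
by have [s0|s0] := leP 0 s; [rewrite ger0_norm|rewrite ltr0_norm].
Qed.

Lemma travel_ucb f : continuous f -> ucb (travel f).
Proof.
move=> cf; have [M M0 hM] := evenx_bounded cf; split.
  exists M => z; rewrite /travel normrM ger0_norm//.
  have := ler_normD (evenx f (z.2 + cl z.1)) (evenx f (z.2 - cl z.1)).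
  have := hM (z.2 + cl z.1); have := hM (z.2 - cl z.1); lra.
move=> e e0; have [d d0 hd] := evenx_unif cf e0.
exists (d / 2); first exact: divr_gt0.
move=> x x' s s' hx hs; rewrite /travel /=.
have h1 : `|s + cl x - (s' + cl x')| < d.
  have -> : s + cl x - (s' + cl x') = (s - s') + (cl x - cl x') by ring.
  apply: le_lt_trans (ler_normD _ _) _; rewrite (splitr d) ltrD//.
  exact: le_lt_trans (cl_lip _ _) hx.
have h2 : `|s - cl x - (s' - cl x')| < d.
  have -> : s - cl x - (s' - cl x') = (s - s') - (cl x - cl x') by ring.
  apply: le_lt_trans (ler_normB _ _) _; rewrite (splitr d) ltrD//.
  exact: le_lt_trans (cl_lip _ _) hx.
move: (hd _ _ h1) (hd _ _ h2); rewrite !ltr_norml; lra.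
Qed.

Lemma ends_ucb f : continuous f ->
  ucb (fun z => itg (evenx f) (z.2 - cl z.1) (z.2 + cl z.1)).
Proof.
move=> cf; have [M M0 hM] := evenx_bounded cf.
have le := locint_cont (evenx_continuous cf).
split.
  exists (M * (2 * pi)) => z; apply: le_trans (itg_bound2 _ _ le hM) _.
  have /andP[c0 c1] := cl_itv z.1.
  have -> : z.2 + cl z.1 - (z.2 - cl z.1) = 2 * cl z.1 by ring.
  by rewrite ler_wpM2l// ger0_norm ?mulr_ge0// ler_pM2l.
move=> e e0; pose L := 4 * M + 1.
have L0 : 0 < L by rewrite ltr_wpDl// mulr_ge0.
exists (e / L); first exact: divr_gt0.
move=> x x' s s'; rewrite !ltr_pdivlMr// => hx hs /=.
set A := s - cl x; set B := s + cl x; set A' := s' - cl x'; set B' := s' + cl x'.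
have -> : itg (evenx f) A B - itg (evenx f) A' B' = itg (evenx f) A A' + itg (evenx f) B' B.
  by rewrite -(itg_split A A' B le) -(itg_split A' B' B le); ring.
apply: le_lt_trans (ler_normD _ _) _.
have b1 := itg_bound2 A A' le hM; have b2 := itg_bound2 B' B le hM.
have dx := cl_lip x x'.
have k1 : `|A' - A| <= `|x - x'| + `|s - s'|.
  have -> : A' - A = (cl x - cl x') - (s - s') by rewrite /A /A'; ring.
  by apply: le_trans (ler_normB _ _) _; rewrite lerD2r.
have k2 : `|B - B'| <= `|x - x'| + `|s - s'|.
  have -> : B - B' = (cl x - cl x') + (s - s') by rewrite /B /B'; ring.
  by apply: le_trans (ler_normD _ _) _; rewrite lerD2r.
have := ler_wpM2l M0 k1; have := ler_wpM2l M0 k2; rewrite /L in hx hs.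
have := normr_ge0 (x - x'); have := normr_ge0 (s - s'); nra.
Qed.

Lemma source_ucb f : continuous f -> ucb (source f).
Proof.
move=> cf; apply: ucb_add; first by apply: ucb_scale; exact: ends_ucb.
by apply: wave_ucb => //; exact: travel_ucb.
Qed.

Lemma influence_continuous f : continuous f -> continuous (fun r => `|evenx f r|).
Proof.
move=> cf r.
apply: (@continuous_comp _ _ _ (evenx f) (fun u : R => `|u|) r); [exact: evenx_continuous|exact: norm_continuous].
Qed.

Lemma influence_ge0 f z : 0 <= influence f z.
Proof.
have /andP[c0 c1] := cl_itv z.1.
by apply: itg_ge0 => //; lra.
Qed.

(** A point of the backward cone has a cone contained in the given one, hence a smaller base: finite
    speed of propagation. *)
Lemma influence_mono f x s t r : continuous f -> 0 <= t <= cl x ->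
  s - (cl x - t) <= r <= s + (cl x - t) -> influence f (t, r) <= influence f (x, s).
Proof.
move=> cf /andP[t0 tx] /andP[r0 r1]; have /andP[c0 c1] := cl_itv x.
rewrite /influence /= (@cl_id _ t) ?t0 ?(le_trans tx)//.
apply: itg_sub => //; [exact/locint_cont/influence_continuous|lra..].
Qed.

Lemma influence_bounded f : continuous f -> exists2 B, 0 <= B & forall z, influence f z <= B.
Proof.
move=> cf; have [M M0 hM] := evenx_bounded cf.
exists (M * (2 * pi)); first by rewrite !mulr_ge0// ltW.
move=> z; have /andP[c0 c1] := cl_itv z.1.
apply: le_trans (ler_norm _) _; rewrite /influence.
have hM' r : `| `|evenx f r| | <= M by rewrite normr_id.
apply: le_trans (itg_bound2 _ _ (locint_cont (influence_continuous cf)) hM') _.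
have -> : z.2 + cl z.1 - (z.2 - cl z.1) = 2 * cl z.1 by ring.
by rewrite ler_wpM2l// ger0_norm ?mulr_ge0// ler_pM2l.
Qed.

Let Q := itg (fun t => `|q t|) 0 pi.
Let Q0 : 0 <= Q. Proof. by apply: itg_ge0 => //; exact: ltW. Qed.

(** The bound is in L1 because each slice is integrated in the space variable first: [travel f] at
    time [t] is an average of translates of the data by [t] and [- t], and the translated slices
    stay within the base of the cone. *)
Lemma source_bound f z : continuous f -> `|source f z| <= (`|h| / 2 + Q / 2) * influence f z.
Proof.
case: z => x s cf; have /andP[c0 c1] := cl_itv x; rewrite /source.
have ce := evenx_continuous cf; have cne := influence_continuous cf.
have ord : s - cl x <= s + cl x by lra.
have h1 : `|itg (evenx f) (s - cl x) (s + cl x)| <= influence f (x, s).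
  by apply: itg_norm => //; exact: locint_cont.
have h2 : `|wave q (travel f) (x, s)| <= Q / 2 * influence f (x, s).
  rewrite /wave/= normrM ger0_norm//.
  apply: (@le_trans _ _ (2^-1 * (influence f (x, s) * itg (fun t => `|q t|) 0 (cl x)))).
    rewrite ler_pM2l//; apply: itg_mul_bound => //; first exact/cone_continuous/travel_ucb.
    move=> t /andP[t0 tx]; rewrite /cone.
    have cl_t : cl t = t by rewrite cl_id// t0 (le_trans tx).
    set A := s - (cl x - t); set B := s + (cl x - t).
    have AB : A <= B by rewrite /A /B; lra.
    have lt := locint_cont (@ucb_section _ _ t (travel_ucb cf)).
    apply: le_trans (itg_norm lt AB) _.
    have sh (c : R) : continuous (fun r : R => `|evenx f (r + c)|).
      apply: (@continuous_compf _ (fun u : R => `|evenx f u|) (fun r : R => r + c)); first exact: cne.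
      by apply: continuous_addf; [exact: continuous_idf|exact: continuous_cstf].
    apply: (@le_trans _ _ (itg (fun r => 2^-1 * `|evenx f (r + t)| + 2^-1 * `|evenx f (r + - t)|) A B)).
      apply: itg_le => //; [exact: locint_norm|by apply: locintD; apply: locintZ; exact: locint_cont|].
      move=> r _; rewrite /travel /= cl_t normrM ger0_norm// -mulrDr ler_pM2l//.
      exact: ler_normD.
    rewrite itgD; [|apply: locintZ; exact: locint_cont..].
    rewrite !itgZ; [|exact: locint_cont..].
    rewrite !(@itg_shift _ (fun r => `|evenx f r|))//.
    have p1 : itg (fun r => `|evenx f r|) (A + t) (B + t) <= influence f (x, s).
      by apply: itg_sub => //; [exact: locint_cont|rewrite /A /B /=; lra..].
    have p2 : itg (fun r => `|evenx f r|) (A + - t) (B + - t) <= influence f (x, s).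
      by apply: itg_sub => //; [exact: locint_cont|rewrite /A /B /=; lra..].
    lra.
  have : itg (fun t => `|q t|) 0 (cl x) <= Q by apply: itg_mono => //; exact: locint_norm.
  move=> /(ler_wpM2l (influence_ge0 f (x, s))); lra.
apply: le_trans (ler_normD _ _) _; rewrite mulrDl; apply: lerD => //.
rewrite normrM normrM [`|2^-1|]ger0_norm//.
by apply: ler_wpM2l => //; rewrite mulr_ge0.
Qed.

(** Slices have length at most [2 * pi], which the choice [e = 1 / (2 * pi)] in [itg_weighted_small]
    absorbs. The assumption bears on the cone of [(x, s)] only, so [K] may depend on that point and
    [v] may be controlled on a smaller domain. *)
Lemma wave_weight : exists2 k, 0 < k & forall v x s K, 0 <= K -> ucb v ->
  (forall t r, 0 <= t <= cl x -> s - (cl x - t) <= r <= s + (cl x - t) -> `|v (t, r)| <= K * expR (k * t)) ->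
  `|wave q v (x, s)| <= 2^-1 * K * expR (k * cl x).
Proof.
have [k k0 hk] := itg_weighted_small sq (ltW pi0) (divr_gt0 (@ltr01 R) (mulr_gt0 (@ltr0n R 2) pi0)).
exists k => // v x s K K0 uv hv; rewrite /wave/= normrM ger0_norm// -mulrA ler_pM2l//.
have /andP[c0 c1] := cl_itv x.
have lc : locint (fun t => q t * cone v (cl x) s t) by apply: locintM => //; exact: cone_continuous.
have lw : locint (fun t => `|q t| * expR (k * t)).
  by apply: locintM; [exact: locint_norm|exact: continuous_expRM].
apply: le_trans (itg_norm lc c0) _.
apply: (@le_trans _ _ (itg (fun t => 2 * pi * K * (`|q t| * expR (k * t))) 0 (cl x))).
  apply: itg_le => //; [exact: locint_norm|exact: locintZ|].
  move=> t /andP[t0 tx]; rewrite normrM mulrCA ler_wpM2l//.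
  have AB : s - (cl x - t) <= s + (cl x - t) by lra.
  apply: le_trans (itg_bound (M := K * expR (k * t)) _ AB _) _.
  - exact/locint_cont/ucb_section.
  - by move=> r hr; apply: hv => //; rewrite t0.
  have -> : s + (cl x - t) - (s - (cl x - t)) = 2 * (cl x - t) by ring.
  rewrite mulrC -[leRHS]mulrA ler_wpM2r ?mulr_ge0 ?expR_ge0// ler_pM2l//; lra.
rewrite itgZ//; apply: le_trans (ler_wpM2l _ (hk _ _)) _; rewrite ?c0//.
  by rewrite !mulr_ge0// ltW.
have gen (P E : R) : 0 < P -> 2 * P * K * (1 / (2 * P) * E) = K * E by move=> P0; field; rewrite gt_eqF.
by rewrite gen.
Qed.

Lemma ucb0 : ucb (fun=> 0 : R).
Proof.
split; first by exists 0 => z; rewrite normr0.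
by move=> e e0; exists 1 => // *; rewrite subrr normr0.
Qed.

Lemma ucb_sub v w : ucb v -> ucb w -> ucb (fun z => v z - w z).
Proof.
move=> uv uw; have := ucb_add uv (ucb_scale (-1) uw).
by under [X in ucb X]eq_fun do rewrite mulN1r.
Qed.

Lemma wave0 z : wave q (fun=> 0) z = 0.
Proof.
rewrite /wave /cone.
have -> : (fun t => q t * itg (fun=> 0) (z.2 - (cl z.1 - t)) (z.2 + (cl z.1 - t))) = (fun=> 0).
  by apply/funext => t; rewrite itg_cst mul0r mulr0.
by rewrite itg_cst mul0r mulr0.
Qed.

Lemma wave_add v w z : ucb v -> ucb w -> wave q (fun z => v z + w z) z = wave q v z + wave q w z.
Proof.
move=> uv uw; have := @wave_sub _ q _ _ z lq (ucb_add uv uw) uw.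
have -> : (fun z => v z + w z - w z) = v by apply/funext => y; rewrite addrK.
by move/eqP; rewrite subr_eq => /eqP.
Qed.

Lemma wave_scale k v z : ucb v -> wave q (fun z => k * v z) z = k * wave q v z.
Proof.
move=> uv; rewrite /wave mulrCA; congr (_ * _).
rewrite -itgZ; last by apply: locintM => //; exact: cone_continuous.
congr itg; apply/funext => t; rewrite mulrCA; congr (_ * _).
by rewrite /cone itgZ//; exact/locint_cont/ucb_section.
Qed.

(** The weight is [influence f] times an exponential. By [influence_mono] its first factor is
    largest at the vertex of a cone, so it acts as a constant there and the solution inherits the L1
    bound of the source. *)
Lemma wave_equation : exists2 M, 0 <= M & forall f, continuous f -> exists v,
  [/\ ucb v, forall z, v z = source f z + wave q v z & forall z, `|v z| <= M * influence f z].
Proof.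
have [k k0 hk] := wave_weight.
pose N := `|h| / 2 + Q / 2.
have N0 : 0 <= N by rewrite addr_ge0// divr_ge0.
exists (N / (1 - 2^-1) * expR (k * pi)).
  by rewrite mulr_ge0 ?expR_ge0// divr_ge0//; lra.
move=> f cf; have [B B0 hB] := influence_bounded cf.
have ebnd (z : R * R) := expR_cl_bounds z.1 k0.
have [] := @contraction_fixpoint R (R * R)%type (@ucb R) (wave q)
  (fun z => influence f z * expR (k * cl z.1)) (source f) 2^-1 N (B * expR (k * pi)) _ _ N0
  (source_ucb cf) _ ucb0 wave0 (@ucb_add R) (@ucb_limit R) (fun u uu => wave_ucb lq uu) _.
- lra.
- move=> z; have /andP[e1 e2] := ebnd z.
  by rewrite mulr_ge0 ?influence_ge0 ?expR_ge0//= ler_pM ?influence_ge0 ?expR_ge0.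
- move=> z; apply: le_trans (source_bound z cf) _; rewrite ler_wpM2l//.
  by have /andP[e1 e2] := ebnd z; rewrite ler_peMr ?influence_ge0.
- move=> u w K K0 uu uw huw [x s]; rewrite wave_sub//=.
  rewrite -[leRHS]mulrA [K * _]mulrA mulrA; apply: hk => //.
  + by rewrite mulr_ge0// influence_ge0.
  + exact: ucb_sub.
  + move=> t r tx rs; apply: le_trans (huw (t, r)) _; rewrite -mulrA ler_wpM2l//=.
    have /andP[t0 tx'] := tx; have /andP[c0 c1] := cl_itv x.
    rewrite (@cl_id _ t) ?t0 ?(le_trans tx')// ler_wpM2r ?expR_ge0//.
    exact: influence_mono.
move=> v [uv ev bv]; exists v; split=> // z.
apply: le_trans (bv z) _; have /andP[e1 e2] := ebnd z.
rewrite -[leRHS]mulrA [_ * influence f z]mulrC ler_wpM2l//.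
  by rewrite divr_ge0//; lra.
by rewrite ler_wpM2l ?influence_ge0.
Qed.

(** The triangle contains the cone of each of its points, so the contraction argument runs on [v]
    set to zero outside. The equation is assumed only there because the clamped even extension of
    the cosine is the cosine only up to distance pi from 0. *)
Lemma wave_zero v : ucb v ->
  (forall x s, 0 <= x <= pi -> `|s| <= pi - x -> v (x, s) = wave q v (x, s)) ->
  forall x s, 0 <= x <= pi -> `|s| <= pi - x -> v (x, s) = 0.
Proof.
move=> uv hv.
have [k k0 hk] := wave_weight.
pose D (z : R * R) := [&& 0 <= z.1, z.1 <= pi & `|z.2| <= pi - z.1].
pose d z := if D z then v z else 0.
have [M hM] := uv.1.
have M0 : 0 <= M by apply: le_trans (hM (0, 0)).
suff dz z : d z = 0.
  move=> x s /andP[x0 xp] sx; have := dz (x, s).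
  by rewrite /d /D /= x0 xp sx.
apply: (@contraction_zero R _ d (fun z => expR (k * cl z.1)) 2^-1 M) => //.
- lra.
- move=> N N0 hN [x s]; rewrite {1}/d; case: ifP => [|_]; last first.
    by rewrite normr0 !mulr_ge0 ?expR_ge0.
  move=> /and3P[/= x0 xp sx]; rewrite hv ?x0//; apply: hk => //.
  have clx : cl x = x by rewrite cl_id// x0.
  rewrite clx => t r /andP[t0 tx] /andP[r0 r1].
  have := hN (t, r); rewrite /d /D /= t0 (le_trans tx xp)/=.
  have -> : `|r| <= pi - t.
    by move: sx; rewrite !ler_norml => /andP[s0 s1]; lra.
  by rewrite cl_id// t0 (le_trans tx).
- move=> y; have /andP[e1 _] := expR_cl_bounds y.1 k0.
  apply: (@le_trans _ _ M); last by rewrite ler_peMr.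
  by rewrite /d; case: ifP => _; rewrite ?normr0.
Qed.

End Transmutation.

(** * The transmutation operator *)

Section TransmutationOperator.
Context {R : realType}.
Implicit Types (v : R * R -> R) (f g : R -> R) (x s t : R).
Variables (q : R -> R) (h : R).
Hypothesis sq : sqint q.
Let lq := sqint_locint sq.
Let pi0 : 0 < pi :> R := pi_gt0 R.

Lemma evenx_lin f g k s : evenx (fun x => f x + k * g x) s = evenx f s + k * evenx g s.
Proof. by []. Qed.

Lemma travel_lin f g k z : travel (fun x => f x + k * g x) z = travel f z + k * travel g z.
Proof. rewrite /travel !evenx_lin; ring. Qed.

Lemma source_lin f g k z : continuous f -> continuous g ->
  source q h (fun x => f x + k * g x) z = source q h f z + k * source q h g z.
Proof.
move=> cf cg; rewrite /source.
have -> : travel (fun x => f x + k * g x) = (fun z => travel f z + k * travel g z).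
  by apply/funext => y; exact: travel_lin.
have tf := travel_ucb cf; have tg := travel_ucb cg.
rewrite (wave_add sq z tf (ucb_scale k tg)) (wave_scale sq k z tg).
have -> : evenx (fun x => f x + k * g x) = (fun s => evenx f s + k * evenx g s) by [].
have lf := locint_cont (evenx_continuous cf); have lg := locint_cont (evenx_continuous cg).
rewrite (itgD _ _ lf (locintZ k lg)) (itgZ _ _ _ lg).
have gen (a b c d : R) : h / 2 * (a + k * b) + (c + k * d) = h / 2 * a + c + k * (h / 2 * b + d) by ring.
exact: gen.
Qed.

(** Variation of constants: the derivative in t of [phi1 t * S (x - t) + phi t * C (x - t)] is
    [q t * phi t * S (x - t)], the terms with [l] cancelling. As [q] is only square integrable, this
    is carried out by two integrations by parts. *)
Lemma volterra_representation l C S phi phi1 x : cosine_family l C S ->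
  sl_sol (fun t => q t - l) (fun=> 0) phi phi1 -> phi 0 = 1 -> phi1 0 = h -> 0 <= x <= pi ->
  phi x = C x + h * S x + itg (fun t => q t * phi t * S (x - t)) 0 x.
Proof.
move=> [[dC dS] [C0 S0] _ _ _] [cp cp1 _ _ pe] p0 p10 /andP[x0 xp].
have cC := is_derive_continuous dC; have cS := is_derive_continuous dS.
have crev (F : R -> R) : continuous F -> continuous (fun t => F (x - t)).
  move=> cF; apply: (@continuous_compf _ F (fun t => x - t)) => //.
  by apply: continuous_subf; [exact: continuous_cstf|exact: continuous_idf].
have drev (F F' : R -> R) t : (forall y : R, is_derive y (1 : R) F (F' y)) ->
    is_derive t (1 : R) (fun t => F (x - t)) (- F' (x - t)).
  move=> dF; rewrite -mulrN1.
  have d1 : is_derive t (1 : R) (fun t : R => x - t) (-1).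
    by rewrite -[X in is_derive _ _ _ X]add0r; apply: is_deriveB.
  exact: (@is_derive1_comp _ F (fun t => x - t) t (F' (x - t)) (-1) (dF (x - t)) d1).
have primS t : 0 <= t <= x -> S (x - t) = S (x - 0) + itg (fun t => - C (x - t)) 0 t.
  have cNC : continuous (fun t => - C (x - t)) by move=> y; apply: cvgN; exact: crev.
  by move=> _; rewrite (itg_FTC2 0 t (fun y => @drev S C y dS) cNC); ring.
have primC t : 0 <= t <= x -> C (x - t) = C (x - 0) + itg (fun t => l * S (x - t)) 0 t.
  have clS : continuous (fun t => l * S (x - t)).
    by apply: continuous_mulf; [exact: continuous_cstf|exact: crev].
  have dd y : is_derive y (1 : R) (fun t => C (x - t)) (l * S (x - y)).
    by have := @drev C _ y dC; rewrite mulNr opprK.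
  by move=> _; rewrite (itg_FTC2 0 t dd clS); ring.
have lql : locint (fun t => (q t - l) * phi t - 0).
  under eq_fun do rewrite subr0; apply: locintM => //.
  by apply: locintB => //; exact: locint_cst.
have lC : locint (fun t => - C (x - t)) by apply/locintN/locint_cont/crev.
have lS : locint (fun t => l * S (x - t)) by apply/locintZ/locint_cont/crev.
have sub t : 0 <= t <= x -> 0 <= t <= pi by move=> /andP[-> tx]; rewrite (le_trans tx).
have I1 := itg_by_parts_ac (F := phi1) (G := fun t => S (x - t)) lql lC x0
  (fun t ht => (pe t (sub t ht)).2) primS.
have I2 := itg_by_parts_ac (F := phi) (G := fun t => C (x - t)) (locint_cont cp1) lS x0
  (fun t ht => (pe t (sub t ht)).1) primC.
have l1 : locint (fun t => ((q t - l) * phi t - 0) * S (x - t) + phi1 t * - C (x - t)).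
  apply: locintD; first by apply: locintM => //; exact: crev.
  by apply: locintMl => //.
have l2 : locint (fun t => phi1 t * C (x - t) + phi t * (l * S (x - t))).
  apply: locintD; first by apply: locintM; [exact: locint_cont|exact: crev].
  by apply: locintMl.
have := itgD 0 x l1 l2; rewrite I1 I2 !subrr !subr0 C0 S0 p0 p10.
have -> : (fun t => (((q t - l) * phi t - 0) * S (x - t) + phi1 t * - C (x - t)) +
   (phi1 t * C (x - t) + phi t * (l * S (x - t)))) = (fun t => q t * phi t * S (x - t)).
  by apply/funext => t; ring.
by move=> ->; ring.
Qed.

(** [X f] is the trace at [s = 0] of the wave with initial data [f]. Linearity and the value at the
    cosine follow from uniqueness in the triangle; the last estimate is the bound by
    [influence f (x, 0)], whence [2 * M]. *)
Theorem transmutation_exists : exists (X : (R -> R) -> R -> R) (M : R), 0 <= M /\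
  [/\ forall f, continuous f -> continuous (X f) /\ forall x, X f (cl x) = X f x,
   forall f g k x, continuous f -> continuous g -> X (fun t => f t + k * g t) x = X f x + k * X g x,
   forall f x, continuous f -> 0 <= x <= pi -> `|X f x - f x| <= M * itg (fun t => `|f t|) 0 x &
   forall l C S phi phi1, cosine_family l C S -> sl_sol (fun t => q t - l) (fun=> 0) phi phi1 ->
     phi 0 = 1 -> phi1 0 = h -> forall x, X C x = phi x].
Proof.
have [M M0 hM] := wave_equation h sq.
have /choice[v hv] : forall f, exists v, continuous f ->
    [/\ ucb v, forall z, v z = source q h f z + wave q v z & forall z, `|v z| <= M * influence f z].
  move=> f; have [cf|ncf] := pselect (continuous f); last by exists (fun=> 0).
  by have [v hv] := hM f cf; exists v.
have unique w : ucb w -> (forall z, w z = wave q w z) -> forall x, 0 <= x <= pi -> w (x, 0) = 0.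
  move=> uw ew x xp; apply: (wave_zero sq uw) => //.
  by rewrite normr0 subr_ge0; have /andP[] := xp.
exists (fun f x => f (cl x) + v f (cl x, 0)), (2 * M); split; first by rewrite mulr_ge0.
split.
- move=> f cf; have [uv _ _] := hv f cf; split; last by move=> x; rewrite clcl.
  apply: continuous_addf; first by apply: continuous_compf => //; exact: cl_continuous.
  apply/continuousPe => x e e0; have [d d0 hd] := uv.2 e e0.
  exists d => // y xy; apply: hd; last by rewrite subrr normr0.
  by apply: le_lt_trans xy; exact: cl_lip.
- move=> f g k x cf cg.
  have cfg : continuous (fun t => f t + k * g t).
    by apply: continuous_addf => //; apply: continuous_mulf => //; exact: continuous_cstf.
  have [uf ef _] := hv _ cf; have [ug eg _] := hv _ cg; have [ufg efg _] := hv _ cfg.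
  have ukg := ucb_scale k ug.
  have us := ucb_add uf ukg.
  suff : v (fun t => f t + k * g t) (cl x, 0) - (v f (cl x, 0) + k * v g (cl x, 0)) = 0.
    by move/eqP; rewrite subr_eq0 => /eqP ->; rewrite mulrDr addrACA.
  apply: (unique (fun z => v (fun t => f t + k * g t) z - (v f z + k * v g z))); last exact: cl_itv.
    exact: ucb_sub.
  move=> z; rewrite -(wave_sub z lq ufg us).
  rewrite (wave_add sq z uf ukg) (wave_scale sq k z ug) efg source_lin// ef eg.
  have gen (a b c d e : R) : a + k * b + e - (a + c + k * (b + d)) = e - (c + k * d) by ring.
  exact: gen.
- move=> f x cf xp; rewrite cl_id// addrAC subrr add0r.
  have [_ _ b] := hv _ cf; apply: le_trans (b _) _.
  have /andP[x0 xpi] := xp.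
  rewrite /influence/= cl_id// !add0r.
  have cn := influence_continuous cf.
  rewrite -(itg_split (- x) 0 x (locint_cont cn)).
  have -> : itg (fun r => `|evenx f r|) (- x) 0 = itg (fun r => `|evenx f r|) 0 x.
    have := itg_opp 0 x cn; rewrite oppr0 -itgC => <-.
    by congr itg; apply/funext => t; rewrite evenxN.
  have -> : itg (fun r => `|evenx f r|) 0 x = itg (fun r => `|f r|) 0 x.
    apply: eq_itg => // t /andP[t0 tx]; rewrite /evenx [`|t|]ger0_norm// cl_id// t0.
    exact: le_trans xpi.
  have gen (a : R) : M * (a + a) = 2 * M * a by ring.
  by rewrite gen.
- move=> l C S phi phi1 cs sp p0 p10 x0.
  have rep x := volterra_representation cs sp p0 p10 (x := x).
  have [[dC dS] [C0 S0] Ce CC SS] := cs.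
  have cC := is_derive_continuous dC; have cS := is_derive_continuous dS.
  have [cp cp1 pcl p1cl pe] := sp.
  have [uv ev _] := hv C cC.
  rewrite -pcl; set x := cl x0; have xp : 0 <= x <= pi by exact: cl_itv.
  (* The separated wave, to be compared with the wave constructed from the data [C]. *)
  pose w (z : R * R) := phi (cl z.1) * evenx C z.2.
  have uw : ucb w.
    have [M1 M10 h1] := cl_continuous_bounded cp pcl.
    have [M2 M20 h2] := evenx_bounded cC.
    split; first by exists (M1 * M2) => z; rewrite normrM ler_pM.
    move=> e e0.
    have L1 : 0 < 2 * (M1 + 1) by lra. have L2 : 0 < 2 * (M2 + 1) by lra.
    have [d1 d10 hd1] := unif_cl cp (divr_gt0 e0 L2).
    have [d2 d20 hd2] := evenx_unif cC (divr_gt0 e0 L1).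
    exists (Num.min d1 d2); first by rewrite lt_min d10.
    move=> y y' s s'; rewrite !lt_min => /andP[y1 _] /andP[_ s2].
    have := hd1 _ _ y1; have := hd2 _ _ s2; rewrite !ltr_pdivlMr// /w/= => k1 k2.
    have -> : phi (cl y) * evenx C s - phi (cl y') * evenx C s' =
      phi (cl y) * (evenx C s - evenx C s') + (phi (cl y) - phi (cl y')) * evenx C s' by ring.
    apply: le_lt_trans (ler_normD _ _) _; rewrite !normrM.
    have := ler_wpM2r (normr_ge0 (evenx C s - evenx C s')) (h1 (cl y)).
    have := ler_wpM2l (normr_ge0 (phi (cl y) - phi (cl y'))) (h2 s').
    have := normr_ge0 (evenx C s - evenx C s'); have := normr_ge0 (phi (cl y) - phi (cl y')).
    lra.
  have ut := travel_ucb cC.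
  have utv := ucb_add ut uv.
  pose d z := travel C z + v C z - w z.
  have ud : ucb d by exact: ucb_sub.
  (* The representation of [phi] is multiplied by [C s]; the addition formulas turn the three
     products into the averaged data, the integral of the data and the cone slices of [w]. All
     arguments stay in [- pi, pi] inside the triangle. *)
  have eqw y s : 0 <= y <= pi -> `|s| <= pi - y -> w (y, s) =
      travel C (y, s) + h / 2 * itg (evenx C) (s - y) (s + y) + wave q w (y, s).
    move=> yp sy; have /andP[y0 ypi] := yp.
    have cly : cl y = y by rewrite cl_id.
    have Cid r : - pi <= r <= pi -> evenx C r = C r by rewrite -ler_norml => rp; apply: evenx_id.
    have /andP[s0 s1] : - (pi - y) <= s <= pi - y by rewrite -ler_norml.
    have Sint a b : - pi <= a -> a <= b -> b <= pi -> itg (evenx C) a b = S b - S a.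
      move=> pa ab bp; rewrite -(itg_FTC2 _ _ dS)//; apply: eq_itg => // r /andP[ar rb].
      by apply: Cid; lra.
    rewrite /w /= /wave /travel /= cly !Cid; [|lra..].
    rewrite CC Sint; [|lra..]; rewrite SS.
    have -> : itg (fun t => q t * cone w y s t) 0 y =
        itg (fun t => 2 * C s * (q t * phi t * S (y - t))) 0 y.
      apply: eq_itg => // t /andP[t0 ty].
      have tcl : cl t = t by rewrite cl_id// t0 (le_trans ty).
      rewrite /cone /w /= tcl itgZ; last exact/locint_cont/evenx_continuous.
      rewrite Sint; [|lra..]; rewrite SS; ring.
    rewrite itgZ; last first.
      apply: locintM; first exact: locintM.
      apply: (@continuous_compf _ S (fun t => y - t)) => //.
      by apply: continuous_subf; [exact: continuous_cstf|exact: continuous_idf].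
    have gen (a b c i : R) : (a + h * b + i) * c =
      2^-1 * (2 * (c * a)) + h / 2 * (2 * (c * b)) + 2^-1 * (2 * c * i) by field.
    by rewrite (rep y yp) gen.
  have dzero : d (x, 0) = 0.
    apply: (wave_zero sq ud) => //; last by rewrite normr0 subr_ge0; have /andP[] := xp.
    move=> y s yp sy; rewrite /d -(wave_sub _ lq utv uw) (wave_add sq _ ut uv).
    rewrite {1}eqw// ev /source/= (cl_id yp).
    have gen (a b c e i : R) : a + (b + c + e) - (a + b + i) = c + e - i by ring.
    exact: gen.
  have half (a : R) : 2^-1 * (a + a) = a by field.
  move/eqP: dzero; rewrite /d /w /= subr_eq0 => /eqP.
  have clx : cl x = x by rewrite /x clcl.
  rewrite /travel /= clx /evenx !add0r normrN ger0_norm; last by have /andP[] := xp.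
  rewrite clx normr0 (cl_id (_ : 0 <= 0 <= pi)) ?lexx ?(ltW pi0)// C0 mulr1 => <-.
  by rewrite [in RHS]half.
Qed.

End TransmutationOperator.

(** * Perturbations of the identity by Volterra terms, and isometries among them *)

Section VolterraOperators.
Context {R : realType}.
Implicit Types (f g a u : R -> R) (X : (R -> R) -> R -> R) (M x b t : R).
Let pi0 : 0 < pi :> R := pi_gt0 R.

(** Identity plus a Volterra operator with bounded kernel, expressed by an L1 bound over [0, x]
    instead of a kernel. *)
Definition volterra X M :=
  [/\ forall f, continuous f -> continuous (X f) /\ forall x, X f (cl x) = X f x,
   forall f g k x, continuous f -> continuous g -> X (fun t => f t + k * g t) x = X f x + k * X g x &
   forall f x, continuous f -> 0 <= x <= pi -> `|X f x - f x| <= M * itg (fun t => `|f t|) 0 x].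

Lemma continuous_normf f : continuous f -> continuous (fun t => `|f t|).
Proof.
move=> cf x.
apply: (@continuous_comp _ _ _ f (fun u : R => `|u|) x); [exact: cf|exact: norm_continuous].
Qed.

Lemma continuous_linf f g k : continuous f -> continuous g -> continuous (fun t => f t + k * g t).
Proof.
by move=> cf cg; apply: continuous_addf => //; apply: continuous_mulf => //; exact: continuous_cstf.
Qed.

(** Integrating the exponential weight gains [1 / k]; a nondecreasing factor [F] is bounded by its
    value at the upper limit. *)
Lemma itg_expR_le k N (u F : R -> R) y : 0 < k -> 0 <= N -> 0 <= y -> continuous u ->
  (forall s t, 0 <= s -> s <= t -> F s <= F t) -> (forall t, 0 <= t -> 0 <= F t) ->
  (forall t, 0 <= t <= y -> `|u t| <= N * (F t * expR (k * t))) ->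
  itg (fun t => `|u t|) 0 y <= k^-1 * N * (F y * expR (k * y)).
Proof.
move=> k0 N0 y0 cu Fm F0 hu.
apply: (@le_trans _ _ (itg (fun t => N * F y * expR (k * t)) 0 y)).
  apply: itg_le => //; [exact/locint_cont/continuous_normf|exact/locintZ/locint_cont/continuous_expRM|].
  move=> t /andP[t0 ty]; apply: le_trans (hu t _) _; first by rewrite t0.
  by rewrite mulrA ler_wpM2r ?expR_ge0// ler_wpM2l// Fm.
rewrite itgZ; last exact/locint_cont/continuous_expRM.
rewrite itg_expR//.
have -> : k^-1 * N * (F y * expR (k * y)) = N * F y * (expR (k * y) / k) by ring.
rewrite ler_wpM2l ?mulr_ge0 ?F0// ler_pM2r ?invr_gt0//.
by rewrite lerBlDr lerDl.
Qed.

Lemma volterra_lin X M f g k : volterra X M -> continuous f -> continuous g ->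
  X (fun t => f t + k * g t) = (fun t => X f t + k * X g t).
Proof. by move=> [_ h _] cf cg; apply/funext => x; exact: h. Qed.

Lemma volterra_sub X M f g : volterra X M -> continuous f -> continuous g ->
  X (fun t => f t - g t) = (fun t => X f t - X g t).
Proof.
move=> vX cf cg; have := volterra_lin (-1) vX cf cg.
under eq_fun do rewrite mulN1r; move=> ->.
by apply/funext => x; rewrite mulN1r.
Qed.

(* The inverse is sought as [g = f + d], where [d] is a fixed point in the norm weighted by
   [expR (k x)] and the running L1 norm of [f]. *)
Lemma volterra_inverse X M : 0 <= M -> volterra X M -> exists2 M', 0 <= M' & forall f, continuous f ->
  exists g, [/\ continuous g, forall x, 0 <= x <= pi -> X g x = f x &
    forall x, 0 <= x <= pi -> `|g x - f x| <= M' * itg (fun t => `|f t|) 0 x].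
Proof.
move=> M0 vX; have [Xc Xl Xb] := vX.
(* With this [k] the factor [M / k] is at most one half. *)
pose k := 2 * M + 1; have k0 : 0 < k by rewrite /k; lra.
exists (2 * M * expR (k * pi)); first by rewrite !mulr_ge0 ?expR_ge0.
move=> f cf; have cnf := continuous_normf cf; have lnf := locint_cont cnf.
pose F x := itg (fun t => `|f t|) 0 x.
have Fm s t : 0 <= s -> s <= t -> F s <= F t by move=> s0 st; exact: itg_mono.
have F0 t : 0 <= t -> 0 <= F t by move=> t0; exact: itg_ge0.
(* A fixed point [d = V fc + V d] says precisely that [X (fc + d) = fc] on [0, pi]. *)
pose V (u : R -> R) x := u (cl x) - X u x.
pose C (u : R -> R) := continuous u /\ forall x, u (cl x) = u x.
have ccl u : continuous u -> continuous (fun x => u (cl x)).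
  by move=> cu; apply: continuous_compf => //; exact: cl_continuous.
have CV u : continuous u -> C (V u).
  move=> cu; split; last by move=> x; rewrite /V clcl (Xc u cu).2.
  by apply: continuous_subf; [exact: ccl|exact: (Xc u cu).1].
have Vb u x : continuous u -> `|V u x| <= M * itg (fun t => `|u t|) 0 (cl x).
  by move=> cu; rewrite /V -(Xc u cu).2 distrC; apply: Xb => //; exact: cl_itv.
pose fc x := f (cl x).
have cfc : continuous fc by exact: ccl.
have ebnd x := expR_cl_bounds x k0.
have [] := @contraction_fixpoint R R C V (fun x => F (cl x) * expR (k * cl x)) (V fc) 2^-1 M
  (F pi * expR (k * pi)) _ _ M0 (CV fc cfc) _ _ _ _ _ _ _.
- lra.
- move=> x; have /andP[e1 e2] := ebnd x; have /andP[c0 c1] := cl_itv x.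
  by rewrite mulr_ge0 ?F0 ?expR_ge0//= ler_pM ?F0 ?expR_ge0// Fm.
- move=> x; apply: le_trans (Vb fc x cfc) _; rewrite ler_wpM2l//.
  have /andP[c0 c1] := cl_itv x; have /andP[e1 e2] := ebnd x.
  have -> : itg (fun t => `|fc t|) 0 (cl x) = F (cl x).
    by apply: eq_itg => // t /andP[t0 tx]; rewrite /fc cl_id// t0 (le_trans tx).
  by rewrite ler_peMr ?F0.
- by split=> //; exact: continuous_cstf.
- move=> x; apply/eqP; rewrite -normr_eq0 eq_le normr_ge0 andbT.
  apply: le_trans (Vb _ x (@continuous_cstf R 0)) _.
  by under eq_fun do rewrite normr0; rewrite itg_cst mul0r mulr0.
- by move=> u v [cu ul] [cv vl]; split; [exact: continuous_addf|move=> x; rewrite ul vl].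
- move=> u h; split.
    by apply: continuous_uniform_limit => e /h[v [cv _] hv]; exists v.
  move=> x; apply/eqP; rewrite -subr_eq0 -normr_eq0 eq_le normr_ge0 andbT.
  apply/ler_addgt0Pr => e e0; rewrite add0r.
  have [v [_ vcl] hv] := h (e / 2) (divr_gt0 e0 (@ltr0n R 2)).
  by have := hv x; have := hv (cl x); rewrite vcl !ler_norml; lra.
- by move=> u [cu _]; exact: CV.
- move=> u v N N0 [cu ul] [cv vl] huv x.
  have cuv : continuous (fun t => u t - v t) by exact: continuous_subf.
  have -> : V u x - V v x = V (fun t => u t - v t) x.
    by rewrite /V (volterra_sub vX)//; ring.
  have /andP[c0 c1] := cl_itv x.
  apply: le_trans (Vb _ x cuv) _.
  have h1 := @itg_expR_le k N (fun t => u t - v t) F (cl x) k0 N0 c0 cuv Fm F0.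
  have {}h1 := h1 ltac:(move=> t /andP[t0 tx]; have := huv t; rewrite (@cl_id _ t) ?t0 ?(le_trans tx)//).
  apply: le_trans (ler_wpM2l M0 h1) _.
  rewrite [M * _]mulrA; apply: ler_wpM2r; first by rewrite mulr_ge0 ?expR_ge0 ?F0.
  rewrite mulrA; apply: ler_wpM2r => //.
  by rewrite ler_pdivrMr// /k; lra.
move=> d [[cd dcl] ed bd].
exists (fun x => fc x + d x); split.
- exact: continuous_addf.
- move=> x xp; have := ed x; rewrite /V dcl.
  have := volterra_lin 1 vX cfc cd.
  under eq_fun do rewrite mul1r; move=> ->; rewrite mul1r.
  rewrite /fc clcl cl_id//; set p := X _ x; set r := X d x; lra.
- move=> x xp; rewrite /fc cl_id// addrAC subrr add0r.
  apply: le_trans (bd x) _; have /andP[e1 e2] := ebnd x; rewrite cl_id// in e2 *.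
  have /andP[x0 _] := xp.
  have -> : 2 * M * expR (k * pi) * itg (fun t => `|f t|) 0 x = M / (1 - 2^-1) * (F x * expR (k * pi)).
    by rewrite /F; set I := itg _ _ _; field; lra.
  rewrite ler_wpM2l//; first by rewrite divr_ge0//; lra.
  by rewrite ler_wpM2l// F0.
Qed.

(** Gronwall's lemma: against the weight [expR (k * x)] a bound on [a] improves by a factor of at
    least two each time it is inserted into the assumption. [a] is set to zero outside [0, b]. *)
Lemma volterra_zero M a b : 0 <= M -> 0 <= b <= pi -> continuous a ->
  (forall x, 0 <= x <= b -> `|a x| <= M * itg (fun t => `|a t|) 0 x) ->
  forall x, 0 <= x <= b -> a x = 0.
Proof.
move=> M0 /andP[b0 bp] ca ha.
pose k := 2 * M + 1; have k0 : 0 < k by rewrite /k; lra.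
pose d x := if (0 <= x <= b) then a x else 0.
have [B B0 hB] := continuous_itv_bounded 0 b ca.
suff dz x : d x = 0 by move=> x xb; have := dz x; rewrite /d xb.
apply: (@contraction_zero R R d (fun x => expR (k * cl x)) 2^-1 B) => //.
- lra.
- move=> N N0 hN y; rewrite {1}/d; case: ifP => [yb|_]; last by rewrite normr0 !mulr_ge0 ?expR_ge0.
  apply: le_trans (ha y yb) _; have /andP[y0 yb'] := yb.
  have cly t : 0 <= t <= y -> cl t = t.
    by move=> /andP[t0 ty]; rewrite cl_id// t0 (le_trans ty)// (le_trans yb').
  have h1 := @itg_expR_le k N a (fun=> 1) y k0 N0 y0 ca (fun s t _ _ => lexx 1) (fun t _ => ler01).
  have {}h1 := h1 ltac:(by move=> t ty; have := hN t; rewrite cly// mul1r /d; have /andP[-> ty'] := ty; rewrite (le_trans ty' yb')).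
  apply: le_trans (ler_wpM2l M0 h1) _.
  rewrite cly ?y0 ?lexx// mul1r mulrA; apply: ler_wpM2r; first exact: expR_ge0.
  rewrite mulrA; apply: ler_wpM2r => //.
  by rewrite ler_pdivrMr// /k; lra.
- move=> y; have /andP[e1 _] := expR_cl_bounds y k0.
  apply: (@le_trans _ _ B); last by rewrite ler_peMr.
  by rewrite /d; case: ifP => [/hB //|_]; rewrite normr0.
Qed.

Lemma volterra_eq0 X M a b : 0 <= M -> volterra X M -> 0 <= b <= pi -> continuous a ->
  (forall x, 0 <= x <= b -> X a x = 0) -> forall x, 0 <= x <= b -> a x = 0.
Proof.
move=> M0 [_ _ Xb] bp ca h; apply: (volterra_zero M0 bp ca) => x xb.
have /andP[x0 xb'] := xb; have /andP[b0 bp'] := bp.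
have := Xb a x ca; rewrite h// sub0r normrN; apply.
by rewrite x0 (le_trans xb').
Qed.

Lemma volterra_vanish X M a b : 0 <= M -> volterra X M -> 0 <= b <= pi -> continuous a ->
  (forall x, 0 <= x <= b -> a x = 0) -> forall x, 0 <= x <= b -> X a x = 0.
Proof.
move=> M0 [_ _ Xb] /andP[b0 bp] ca h x xb; have /andP[x0 xb'] := xb.
have := Xb a x ca; rewrite h// subr0 x0 (le_trans xb')// => /(_ isT).
have -> : itg (fun t => `|a t|) 0 x = itg (fun=> 0) 0 x.
  by apply: eq_itg => // t /andP[t0 tx]; rewrite h ?normr0// t0 (le_trans tx).
by rewrite itg_cst mul0r mulr0 normr_le0 => /eqP.
Qed.

Section Isometric.
Variables (X X' : (R -> R) -> R -> R) (M : R).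
Hypothesis M0 : 0 <= M.
Hypothesis vX : volterra X M.
Hypothesis vX' : volterra X' M.
Hypothesis iso : forall a, continuous a ->
  itg (fun t => X a t ^+ 2) 0 pi = itg (fun t => X' a t ^+ 2) 0 pi.

Let cX a : continuous a -> continuous (X a).
Proof. by move=> ca; have [h _ _] := vX; exact: (h a ca).1. Qed.

Let cX' a : continuous a -> continuous (X' a).
Proof. by move=> ca; have [h _ _] := vX'; exact: (h a ca).1. Qed.

Lemma isometric_polar (a b : R -> R) : continuous a -> continuous b ->
  itg (fun t => X a t * X b t) 0 pi = itg (fun t => X' a t * X' b t) 0 pi.
Proof.
move=> ca cb; have cab := @continuous_linf a b 1 ca cb.
have ex (f g : R -> R) : continuous f -> continuous g ->
    itg (fun t => (f t + 1 * g t) ^+ 2) 0 pi =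
    itg (fun t => f t ^+ 2) 0 pi + itg (fun t => g t ^+ 2) 0 pi + 2 * itg (fun t => f t * g t) 0 pi.
  move=> cf cg.
  have lf : locint (fun t => f t ^+ 2) by apply/locint_cont/continuous_mulf.
  have lg : locint (fun t => g t ^+ 2) by apply/locint_cont/continuous_mulf.
  have lfg : locint (fun t => f t * g t) by apply/locint_cont/continuous_mulf.
  rewrite -itgZ// -!itgD//; first by congr itg; apply/funext => t; ring.
  - exact: locintD.
  - exact: locintZ.
have := iso cab; rewrite (volterra_lin 1 vX ca cb) (volterra_lin 1 vX' ca cb).
rewrite !ex; [|exact: cX'|exact: cX'|exact: cX|exact: cX].
by rewrite (iso ca) (iso cb) => /addrI /(mulfI (_ : 2 != 0)); apply; rewrite pnatr_eq0.
Qed.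

(* Test the isometry against [v] with [X' v = (x - b)^+ X' a]; then [v], hence [X v], vanishes on [0, b]. *)
Lemma isometric_local a b : 0 <= b <= pi -> continuous a ->
  (forall x, b <= x <= pi -> X a x = 0) -> forall x, b < x <= pi -> X' a x = 0.
Proof.
move=> bp ca ha; have /andP[b0 bpi] := bp.
pose m x := Num.max 0 (x - b).
have cm : continuous m.
  move=> x; apply: (@continuous_max R R (fun=> 0) (fun x => x - b) x); first exact: (@continuous_cstf R 0 x).
  by apply: cvgB; [exact: cvg_id|exact: cvg_cst].
have m0 x : 0 <= m x by rewrite /m le_max lexx.
have mz x : x <= b -> m x = 0 by move=> xb; rewrite /m max_l// subr_le0.
pose w x := X' a x * m x.
have cw : continuous w by apply: continuous_mulf => //; exact: cX'.
have [M' M'0 inv] := volterra_inverse M0 vX'.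
have [v [cv ev _]] := inv w cw.
have v0 : forall x, 0 <= x <= b -> v x = 0.
  apply: (volterra_eq0 M0 vX' bp cv) => x /andP[x0 xb].
  by rewrite ev ?x0 ?(le_trans xb)// /w mz// mulr0.
have Xv0 := volterra_vanish M0 vX bp cv v0.
have e0 : itg (fun t => X' a t * w t) 0 pi = 0.
  have -> : itg (fun t => X' a t * w t) 0 pi = itg (fun t => X' a t * X' v t) 0 pi.
    by apply: eq_itg => // [|t tp]; [exact: ltW|rewrite ev].
  rewrite -isometric_polar//.
  have -> : itg (fun t => X a t * X v t) 0 pi = itg (fun=> 0) 0 pi; last by rewrite itg_cst mul0r.
  apply: eq_itg => [|t /andP[t0 tp]]; first exact: ltW.
  have [tb|/ltW bt] := leP t b; first by rewrite Xv0 ?mulr0// t0.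
  by rewrite ha ?mul0r// bt.
have cp : continuous (fun t => X' a t * w t) by apply: continuous_mulf => //; exact: cX'.
have nn t : 0 <= X' a t * w t by rewrite /w mulrA -expr2 mulr_ge0// sqr_ge0.
have z : forall x, 0 <= x <= pi -> X' a x * w x = 0.
  apply: continuous_itg_eq0 => // x /andP[x0 xp]; apply/eqP; rewrite eq_le.
  rewrite itg_ge0 ?andbT//.
  by rewrite -[leRHS]e0; apply: itg_mono => //; exact: locint_cont.
move=> x /andP[bx xp]; have := z x; rewrite xp (le_trans b0 (ltW bx)) => /(_ isT).
have mx : m x != 0 by rewrite /m max_r ?subr_eq0 ?gt_eqF// subr_ge0 ltW.
by move/eqP; rewrite /w mulrA mulf_eq0 (negbTE mx) orbF mulf_eq0 orbb => /eqP.
Qed.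

(* [a2] agrees with [a] near [x] as seen by [X] but vanishes up to [x - 2 d], so that
   both Volterra terms of [a2] are of order [d] at [x]. *)
Theorem isometric_volterra_eq a x : continuous a -> 0 <= x <= pi -> X a x = X' a x.
Proof.
move=> ca xp; have /andP[x0 xpi] := xp.
have [M' M'0 inv] := volterra_inverse M0 vX.
have [B B0 hB] := continuous_itv_bounded 0 pi (cX ca).
apply/eqP; rewrite -subr_eq0 -normr_eq0 eq_le normr_ge0 andbT.
have [Xc Xl Xb] := vX; have [Xc' Xl' Xb'] := vX'.
have [x00|xn0] := eqVneq x 0.
  have := Xb a x ca xp; have := Xb' a x ca xp; rewrite x00 itgxx mulr0.
  by rewrite !normr_le0 !subr_eq0 => /eqP -> /eqP ->.
have {xn0} {}x0 : 0 < x by rewrite lt_def xn0.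
(* [(1 + M' * pi) * B] bounds [a2] on [0, pi], and [a2] lives on an interval of length [2 * d] left
   of [x]; the final difference is thus at most [2 * D * d]. *)
pose D := 2 * M * ((1 + M' * pi) * B).
have D0 : 0 <= D by rewrite !mulr_ge0// addr_ge0// mulr_ge0// ltW.
apply/ler_addgt0Pr => e e0; rewrite add0r.
pose d := Num.min (x / 2) (e / (2 * (D + 1))).
have D1 : 0 < 2 * (D + 1) by lra.
have d0 : 0 < d by rewrite lt_min !divr_gt0.
have dx : d <= x / 2 by rewrite ge_min lexx.
have de : d <= e / (2 * (D + 1)) by rewrite ge_min lexx orbT.
pose r s := ramp (x - 2 * d) d s.
have cr : continuous r by exact: ramp_continuous.
have r0 s : s <= x - 2 * d -> r s = 0 by move=> hs; rewrite /r ramp0.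
have r1 s : x - d <= s -> r s = 1 by move=> hs; rewrite /r ramp1//; lra.
have rb s : 0 <= r s <= 1 by exact: ramp_itv.
(* The cutoff is applied to [X a] rather than to [a], so that [X (a - a2)] vanishes exactly on
   [[x - d, pi]]. *)
pose f2 s := X a s * r s.
have cf2 : continuous f2 by apply: continuous_mulf => //; exact: cX.
have [a2 [ca2 ea2 ba2]] := inv f2 cf2.
have ca1 : continuous (fun t => a t - a2 t) by exact: continuous_subf.
have bp : 0 <= x - d <= pi by lra.
(* Locality at [x - d], which lies strictly left of [x]: [X'] does not distinguish [a] from [a2] at
   [x] either. *)
have z1 : X' (fun t => a t - a2 t) x = 0.
  apply: (isometric_local bp ca1); last by rewrite xpi andbT; lra.
  move=> y /andP[y0 yp]; rewrite (volterra_sub vX)// ea2; last by lra.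
  by rewrite /f2 r1// mulr1 subrr.
have f2x : X a2 x = X a x by rewrite ea2// /f2 r1 ?mulr1//; lra.
move: z1; rewrite (volterra_sub vX')// => /eqP; rewrite subr_eq0 => /eqP ->.
rewrite -f2x.
have bp2 : 0 <= x - 2 * d <= pi by lra.
have a2z : forall s, 0 <= s <= x - 2 * d -> a2 s = 0.
  apply: (volterra_eq0 M0 vX bp2 ca2) => s /andP[s0 sx].
  by rewrite ea2 ?/f2 ?r0 ?mulr0//; lra.
have f2B s : 0 <= s <= pi -> `|f2 s| <= B.
  move=> sp; have /andP[k0 k1] := rb s.
  by rewrite /f2 normrM [`|r s|]ger0_norm// (le_trans _ (hB s sp))// ler_piMr.
have a2B s : 0 <= s <= pi -> `|a2 s| <= (1 + M' * pi) * B.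
  move=> sp; have /andP[s0 sp'] := sp.
  have h1 := ba2 s sp; have h2 := f2B s sp.
  have h3 : itg (fun t => `|f2 t|) 0 s <= B * pi.
    apply: le_trans (ler_norm _) _; apply: (@le_trans _ _ (B * (s - 0))).
      apply: itg_bound => //; first exact/locint_cont/continuous_normf.
      by move=> t /andP[t0 ts]; rewrite normr_id; apply: f2B; rewrite t0 (le_trans ts).
    by rewrite subr0 ler_wpM2l.
  have := ler_wpM2l M'0 h3.
  have : `|a2 s| <= `|a2 s - f2 s| + `|f2 s| by rewrite -[in leLHS](subrK (f2 s) (a2 s)) ler_normD.
  lra.
have cn2 := continuous_normf ca2; have l2 := locint_cont cn2.
have I2 : itg (fun t => `|a2 t|) 0 x <= (1 + M' * pi) * B * (2 * d).
  rewrite -(itg_split 0 (x - 2 * d) x l2).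
  have -> : itg (fun t => `|a2 t|) 0 (x - 2 * d) = itg (fun=> 0) 0 (x - 2 * d).
    apply: eq_itg; first by lra.
    by move=> t ht; rewrite a2z// normr0.
  rewrite itg_cst mul0r add0r; apply: le_trans (ler_norm _) _.
  rewrite [in leRHS](_ : 2 * d = x - (x - 2 * d)); last by ring.
  apply: itg_bound => //; first by lra.
  by move=> t ht; rewrite normr_id; apply: a2B; lra.
have h1 := Xb a2 x ca2 xp; have h2 := Xb' a2 x ca2 xp.
have h3 : `|X a2 x - X' a2 x| <= 2 * M * itg (fun t => `|a2 t|) 0 x.
  have -> : X a2 x - X' a2 x = (X a2 x - a2 x) - (X' a2 x - a2 x) by ring.
  apply: le_trans (ler_normB _ _) _; lra.
apply: le_trans h3 _.
apply: le_trans (ler_wpM2l (_ : 0 <= 2 * M) I2) _; first by rewrite mulr_ge0.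
have -> : 2 * M * ((1 + M' * pi) * B * (2 * d)) = 2 * D * d by rewrite /D; ring.
apply: le_trans (ler_wpM2l (_ : 0 <= 2 * D) de) _; first by rewrite mulr_ge0.
by rewrite mulrA ler_pdivrMr// mulrC ler_pM2l//; lra.
Qed.

End Isometric.
End VolterraOperators.

(** * Orthogonality and completeness of the eigenvectors *)

Section SpectralExpansion.
Context {R : realType}.
Local Notation V := ((R -> R^o) * R^o)%type.
Implicit Types (q f g y : R -> R) (h H l m t e x : R).
Let pi0 : 0 < pi :> R := pi_gt0 R.

Definition eigenbasis q h H (H1 H2 : R) (lam : nat -> R) (phi phi1 : nat -> R -> R) :=
  [/\ forall n, eigensolution q h H H1 H2 (lam n) (phi n) (phi1 n),
   forall n, phi n 0 = 1,
   {homo lam : m n / (m < n)%N >-> m < n} &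
   forall l y y1, eigensolution q h H H1 H2 l y y1 -> (exists x, y x != 0) -> exists n, l = lam n].

(** Taken at the parameter [l], the first vector solves the resolvent equation with zero right-hand
    side and the second with [m - l] times itself; symmetry makes [m - l] times their product
    vanish. *)
Lemma eigensolution_orth q h H (H1 H2 : R) l m y y1 z z1 : sqint q -> 0 < H * H1 - H2 -> l != m ->
  eigensolution q h H H1 H2 l y y1 -> eigensolution q h H H1 H2 m z z1 ->
  ipE H H1 H2 (y, y1 pi + H * y pi) (z, z1 pi + H * z pi) = 0.
Proof.
move=> sq rho0 lm [sy hy by_] [sz hz bz].
have [cy cy1 ycl y1cl ye] := sy; have [cz cz1 zcl z1cl ze] := sz.
have r1 : resolves q h H H1 H2 l 0 y y1.
  split => //=; apply/eqP; rewrite -subr_eq0; apply/eqP.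
  have -> : (H1 - l) * y1 pi + (H2 - l * H) * y pi - 0 =
    (H1 * y1 pi + H2 * y pi) - l * (y1 pi + H * y pi) by ring.
  by rewrite by_ subrr.
pose G : V := (m - l) *: (z, z1 pi + H * z pi).
have r2 : resolves q h H H1 H2 l G z z1.
  split => //=; last first.
    have -> : (H1 - l) * z1 pi + (H2 - l * H) * z pi =
      (H1 * z1 pi + H2 * z pi) - l * (z1 pi + H * z pi) by ring.
    by rewrite -bz -mulrBl.
  split => // x xp; have [e1 e2] := ze x xp; split => //; rewrite e2; congr (_ + itg _ _ _).
  apply/funext => t; transitivity ((q t - l) * z t - (m - l) * z t); [ring|by []].
have sG : sqpair G by apply: sqpairZ; exact: sqint_continuous.
have := resolves_sym sq rho0 (@sqpair0 R) sG r1 r2.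
rewrite ipE_sym ipE_scalel; [|exact: sqint_continuous..].
rewrite [RHS]/ipE /= mul0r mul0r addr0.
have -> : itg (fun t => (0 : R -> R^o) t * z t) 0 pi = itg (fun=> 0) 0 pi.
  by congr itg; apply/funext => t; exact: mul0r.
rewrite itg_cst mul0r ipE_sym => /eqP; rewrite mulf_eq0 subr_eq0 eq_sym (negbTE lm)/=.
by move/eqP.
Qed.

(** The square norm of [t *: F - G] is nonnegative. Small [t] keeps the coefficient of the main term
    close to 1 at the price of a large one on the error. *)
Lemma ipE_young H (H1 H2 : R) t (F G : V) : 0 < H * H1 - H2 -> 0 < t -> sqpair F -> sqpair G ->
  ipE H H1 H2 (F + G) (F + G) <= (1 + t) * ipE H H1 H2 F F + (1 + t^-1) * ipE H H1 H2 G G.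
Proof.
move=> rho0 t0 EF EG.
have EFG := sqpairD EF EG.
have EtF := sqpairZ t EF; have ENG := sqpairZ (-1) EG; have E3 := sqpairD EtF ENG.
have e1 : ipE H H1 H2 (F + G) (F + G) = ipE H H1 H2 F F + 2 * ipE H H1 H2 F G + ipE H H1 H2 G G.
  rewrite ipE_addl// ![ipE _ _ _ _ (F + G)]ipE_sym !ipE_addl//.
  by rewrite [ipE _ _ _ G F]ipE_sym; ring.
have e2 : ipE H H1 H2 (t *: F + -1 *: G) (t *: F + -1 *: G) =
    t ^+ 2 * ipE H H1 H2 F F - 2 * t * ipE H H1 H2 F G + ipE H H1 H2 G G.
  rewrite ipE_addl// !ipE_scalel// ![ipE _ _ _ _ (_ *: F + _)]ipE_sym !ipE_addl// !ipE_scalel//.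
  by rewrite [ipE _ _ _ G F]ipE_sym; ring.
have := ipE_ge0 rho0 (t *: F + -1 *: G); rewrite e2 e1.
move: (ipE H H1 H2 F F) (ipE H H1 H2 F G) (ipE H H1 H2 G G) => A B C hh.
have : 0 <= t^-1 * (t ^+ 2 * A - 2 * t * B + C) by rewrite mulr_ge0// invr_ge0 ltW.
have -> : t^-1 * (t ^+ 2 * A - 2 * t * B + C) = t * A - 2 * B + t^-1 * C by field; rewrite gt_eqF.
lra.
Qed.

(** A continuous [f] is replaced by a smooth [z] for which [(z, 0)] lies in the range of the
    resolvent, where density is known. *)
Lemma eigvec_dense q h H (H1 H2 : R) lam phi phi1 f e : sqint q -> 0 < H * H1 - H2 ->
  eigenbasis q h H H1 H2 lam phi phi1 -> continuous f -> 0 < e ->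
  exists n (a : nat -> R), ipE H H1 H2 ((f, 0) - \sum_(i < n) a i *: eigvec H phi phi1 i)
    ((f, 0) - \sum_(i < n) a i *: eigvec H phi phi1 i) < e.
Proof.
move=> sq rho0 [pe p0 lm la] cf e0.
(* A number below all eigenvalues, so that the resolvent at [c] exists. *)
pose c := lam 0%N - 1.
have noneig : forall y y1, eigensolution q h H H1 H2 c y y1 -> forall x, y x = 0.
  move=> y y1 ey x; apply/eqP; apply/negPn/negP => yx.
  have [n cn] := la _ _ _ ey (ex_intro _ x yx).
  have : lam 0%N <= lam n by case: n {cn} => // n; rewrite ltW// lm.
  by rewrite -cn /c; lra.
have lam_inj (m n : nat) : m != n -> lam m != lam n.
  by rewrite neq_ltn => /orP[/lm|/lm]; [move=> /lt_eqF ->|move=> /gt_eqF ->].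
have [z [z1 [z2 [dz dz1 cz2 [z0 z10 zpi z1pi] zf]]]] := smooth_approximation cf (divr_gt0 e0 (@ltr0n R 4)).
have cz := is_derive_continuous dz; have cz1 := is_derive_continuous dz1.
(* The image of [(z, 0)] under L - c. As [z] and [z1] vanish at 0 and pi, both boundary conditions
   hold whatever the coefficients, and the scalar components are zero. *)
pose F : V := (fun t => z t * (q t - c) + - 1 * z2 t, 0).
have sF : sqpair F.
  apply: (@sqintD _ (fun t => z t * (q t - c)) (fun t => -1 * z2 t)).
    by apply: (@sqintMl _ (fun t => q t - c)) => //; exact: sqint_sub_cst.
  exact/sqintZ/sqint_continuous.
have ccl g : continuous g -> continuous (fun x => g (cl x)).
  by move=> cg; apply: continuous_compf => //; exact: cl_continuous.
have cl0 : cl 0 = 0 :> R by rewrite cl_id// lexx ltW.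
have clpi : cl pi = pi :> R by rewrite cl_id// lexx ltW.
have rF : resolves q h H H1 H2 c F (fun x => z (cl x)) (fun x => z1 (cl x)).
  split; last 2 first.
  - by rewrite cl0 z10 z0 mulr0.
  - by rewrite clpi z1pi zpi !mulr0 addr0.
  split; [exact: ccl|exact: ccl|by move=> x; rewrite clcl|by move=> x; rewrite clcl|].
  move=> x xp; have /andP[x0 xpi] := xp; rewrite cl_id// cl0 z0 z10 !add0r.
  have sub t : 0 <= t <= x -> cl t = t by move=> /andP[t0 tx]; rewrite cl_id// t0 (le_trans tx).
  split.
    have -> : itg (fun x => z1 (cl x)) 0 x = itg z1 0 x.
      by apply: eq_itg => // t /sub ->.
    by rewrite (itg_FTC2 0 x dz cz1) z0 subr0.
  have -> : itg (fun t => (q t - c) * z (cl t) - F.1 t) 0 x = itg z2 0 x.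
    by apply: eq_itg => // t /sub ->; rewrite /F /=; ring.
  by rewrite (itg_FTC2 0 x dz1 cz2) z10 subr0.
have [n [a ha]] := eigvec_dense_range sq rho0 noneig pe p0 lam_inj la sF rF (divr_gt0 e0 (@ltr0n R 4)).
exists n, a.
set P := \sum_(i < n) _ in ha *.
have EP : sqpair P.
  rewrite /P; elim/big_ind: _ => [|u v|i _]; [exact: sqpair0|exact: sqpairD|].
  by apply: sqpairZ; apply: sqint_continuous; have [[]] := pe i.
pose y : V := (fun x => z (cl x), 0).
have Ey : sqpair y by apply: sqint_continuous; exact: ccl.
have yE : (fun x => z (cl x), z1 (cl pi) + H * z (cl pi)) = y.
  by rewrite clpi z1pi zpi mulr0 addr0.
rewrite yE in ha.
have Ef : sqpair (f, 0) by exact: sqint_continuous.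
have ENy := sqpairZ (-1) Ey; have ENP := sqpairZ (-1) EP.
have -> : (f, 0) - P = ((f, 0) + -1 *: y) + (y + -1 *: P).
  by rewrite !scaleN1r addrA subrK.
apply: le_lt_trans (ipE_young rho0 ltr01 (sqpairD Ef ENy) (sqpairD Ey ENP)) _.
rewrite scaleN1r invr1.
have -> : ipE H H1 H2 ((f, 0) - y) ((f, 0) - y) = itg (fun t => (f t - z t) ^+ 2) 0 pi.
  rewrite /ipE /= subr0 mul0r mul0r addr0; apply: eq_itg; first exact: ltW.
  move=> t tp; transitivity ((f t - z (cl t)) * (f t - z (cl t))); first by [].
  by rewrite cl_id// expr2.
rewrite scaleN1r; lra.
Qed.

(** Pythagoras. The norm involves only the coefficients and the norming constants, hence agrees for
    the two problems when the same coefficients are used. *)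
Lemma eigvec_sum_norm q h H (H1 H2 : R) lam phi phi1 n (a : nat -> R) : sqint q -> 0 < H * H1 - H2 ->
  eigenbasis q h H H1 H2 lam phi phi1 ->
  sqpair (\sum_(i < n) a i *: eigvec H phi phi1 i) /\
  ipE H H1 H2 (\sum_(i < n) a i *: eigvec H phi phi1 i) (\sum_(i < n) a i *: eigvec H phi phi1 i) =
  \sum_(i < n) a i ^+ 2 * ipE H H1 H2 (eigvec H phi phi1 i) (eigvec H phi phi1 i).
Proof.
move=> sq rho0 [pe p0 lm la].
have EU i : sqpair (eigvec H phi phi1 i).
  by apply: sqint_continuous; have [[]] := pe i.
have ES k : sqpair (\sum_(i < k) a i *: eigvec H phi phi1 i).
  elim/big_ind: _ => [|u v|i _]; [exact: sqpair0|exact: sqpairD|exact: sqpairZ _ (EU i)].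
split => //.
have orth k j : (k <= j)%N -> ipE H H1 H2 (\sum_(i < k) a i *: eigvec H phi phi1 i) (eigvec H phi phi1 j) = 0.
  elim: k => [_|k IH kj].
    by rewrite big_ord0 -(scale0r (eigvec H phi phi1 j)) ipE_scalel// mul0r.
  rewrite big_ord_recr/= (ipE_addl _ _ _ (ES k) (sqpairZ _ (EU k)) (EU j)).
  rewrite IH; last exact: ltnW.
  rewrite (ipE_scalel _ _ _ _ (EU k) (EU j)) add0r (eigensolution_orth (l := lam k) (m := lam j) sq rho0 _ (pe k) (pe j)) ?mulr0//.
  by rewrite lt_eqF// lm.
elim: n => [|n IH].
  by rewrite !big_ord0 -(scale0r (eigvec H phi phi1 0%N)) (ipE_scalel _ _ _ _ (EU 0%N) (sqpairZ 0 (EU 0%N))) mul0r.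
rewrite !big_ord_recr/=.
set S := \sum_(i < n) _ in IH *; set U := eigvec H phi phi1 n.
have EaU : sqpair (a n *: U) := sqpairZ _ (EU n).
have ESa := sqpairD (ES n) EaU.
rewrite (ipE_addl _ _ _ (ES n) EaU ESa) ![ipE _ _ _ _ (S + _)]ipE_sym.
rewrite (ipE_addl _ _ _ (ES n) EaU (ES n)) (ipE_addl _ _ _ (ES n) EaU EaU) IH.
rewrite ![ipE _ _ _ _ (a n *: U)]ipE_sym [ipE _ _ _ (a n *: U) S](ipE_scalel _ _ _ _ (EU n) (ES n)).
rewrite [ipE _ _ _ U S]ipE_sym orth// mulr0 addr0 add0r.
rewrite (ipE_scalel _ _ _ _ (EU n) EaU) ipE_sym (ipE_scalel _ _ _ _ (EU n) (EU n)) mulrA -expr2.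
by [].
Qed.

End SpectralExpansion.

(** * Equal spectral data make the two operators isometric to each other *)

Section Comparison.
Context {R : realType}.
Local Notation V := ((R -> R^o) * R^o)%type.
Implicit Types (q f g y u : R -> R) (h H l m t e x M : R) (X : (R -> R) -> R -> R).
Let pi0 : 0 < pi :> R := pi_gt0 R.
Local Notation nsq f := (itg (fun t => f t ^+ 2) 0 pi).

(** L_2 boundedness of X' X^-1, which transfers approximation errors from one problem to the other.
    Both [X u] and [X' u] are compared with [u]; the difference is bounded by [C] times the L1 norm
    of [X u], and the L1 norm by the L_2 norm. *)
Lemma volterra_L2 X X' M : 0 <= M -> volterra X M -> volterra X' M ->
  exists2 K, 0 <= K & forall u, continuous u -> nsq (X' u) <= K * nsq (X u).
Proof.
move=> M0 vX vX'.
have [M' M'0 inv] := volterra_inverse M0 vX.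
pose C := M' + M * (1 + M' * pi).
have C0 : 0 <= C by rewrite addr_ge0// mulr_ge0// addr_ge0// mulr_ge0// ltW.
exists (2 + 2 * pi ^+ 2 * C ^+ 2); first by rewrite addr_ge0// -mulrA mulr_ge0// mulr_ge0 ?sqr_ge0.
move=> u cu; have [Xc _ _] := vX; have [Xc' _ Xb'] := vX'.
have cXu := (Xc u cu).1; have cXu' := (Xc' u cu).1.
have [g [cg eg bg]] := inv _ cXu.
have ug x : 0 <= x <= pi -> u x = g x.
  have cug : continuous (fun t => u t - g t) by exact: continuous_subf.
  move=> xp; apply/eqP; rewrite -subr_eq0; apply/eqP.
  have pp : 0 <= (pi : R) <= pi by rewrite lexx ltW.
  apply: (volterra_eq0 M0 vX pp cug) => // y yp.
  by rewrite (volterra_sub vX)// eg// subrr.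
pose I := itg (fun t => `|X u t|) 0 pi.
have cn := continuous_normf cXu; have ln := locint_cont cn.
have I0 : 0 <= I by apply: itg_ge0 => //; exact: ltW.
have cnu := continuous_normf cu; have lnu := locint_cont cnu.
have b1 x : 0 <= x <= pi -> `|u x - X u x| <= M' * I.
  move=> xp; have /andP[x0 xpi] := xp; rewrite ug//; apply: le_trans (bg x xp) _.
  by rewrite ler_wpM2l// itg_mono.
have b2 : itg (fun t => `|u t|) 0 pi <= (1 + M' * pi) * I.
  apply: (@le_trans _ _ (itg (fun t => `|X u t| + M' * I) 0 pi)).
    apply: itg_le => //; [by apply: locintD => //; exact: locint_cst|exact: ltW|].
    move=> t tp; have := b1 t tp => h1.
    have -> : u t = X u t + (u t - X u t) by ring.
    by apply: le_trans (ler_normD _ _) _; rewrite lerD2l.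
  rewrite itgD//; last exact: locint_cst.
  by rewrite itg_cst subr0 -/I; lra.
have b3 x : 0 <= x <= pi -> `|X' u x - X u x| <= C * I.
  move=> xp; have /andP[x0 xpi] := xp.
  have -> : X' u x - X u x = (X' u x - u x) + (u x - X u x) by ring.
  apply: le_trans (ler_normD _ _) _; have h1 := b1 x xp; have h2 := Xb' u x cu xp.
  have h3 : itg (fun t => `|u t|) 0 x <= itg (fun t => `|u t|) 0 pi by apply: itg_mono.
  have := ler_wpM2l M0 (le_trans h3 b2); rewrite /C; lra.
have c2 : continuous (fun t => X u t ^+ 2) by apply: continuous_mulf.
apply: (@le_trans _ _ (itg (fun t => 2 * X u t ^+ 2 + 2 * (C * I) ^+ 2) 0 pi)).
  apply: itg_le; [exact/locint_cont/continuous_mulf| |exact: ltW|].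
    by apply: locintD; [apply: locintZ; exact: locint_cont|exact: locint_cst].
  move=> t tp; have h1 := b3 t tp.
  have h2 : (X' u t - X u t) ^+ 2 <= (C * I) ^+ 2.
    rewrite -(real_normK (num_real (X' u t - X u t))); apply: lerXn2r; rewrite ?nnegrE// mulr_ge0//.
  have := sqr_ge0 (X u t - (X' u t - X u t)); nra.
rewrite itgD; [|by apply: locintZ; exact: locint_cont|exact: locint_cst].
rewrite itgZ; last exact: locint_cont.
rewrite itg_cst subr0.
have := itg_norm_sqr pi0 (sqint_continuous cXu); rewrite -/I => h1.
have h2 : 0 <= 2 * C ^+ 2 * pi by rewrite mulr_ge0 ?(ltW pi0)// mulr_ge0 ?sqr_ge0.
have := ler_wpM2l h2 h1; nra.
Qed.

Lemma itg_young f g t : 0 < t -> continuous f -> continuous g ->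
  nsq (fun s => f s + g s) <= (1 + t) * nsq f + (1 + t^-1) * nsq g.
Proof.
move=> t0 cf cg.
have lf : locint (fun s => f s ^+ 2) by apply/locint_cont/continuous_mulf.
have lg : locint (fun s => g s ^+ 2) by apply/locint_cont/continuous_mulf.
have lfg : locint (fun s => (f s + g s) ^+ 2).
  by apply/locint_cont/continuous_mulf; exact: continuous_addf.
rewrite -!itgZ// -itgD; [|exact: locintZ..].
apply: itg_le => //; [by apply: locintD; exact: locintZ|exact: ltW|].
move=> s _; have : 0 <= t^-1 * (t * f s - g s) ^+ 2 by rewrite mulr_ge0 ?sqr_ge0// invr_ge0 ltW.
have -> : t^-1 * (t * f s - g s) ^+ 2 = t * f s ^+ 2 - 2 * (f s * g s) + t^-1 * g s ^+ 2.
  by field; rewrite gt_eqF.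
lra.
Qed.

Lemma volterra_sum X M n (a : nat -> R) (C : nat -> R -> R) : volterra X M ->
  (forall i, continuous (C i)) ->
  continuous (fun t => \sum_(i < n) a i * C i t) /\
  X (fun t => \sum_(i < n) a i * C i t) = (fun t => \sum_(i < n) a i * X (C i) t).
Proof.
move=> vX cC; elim: n => [|n [IHc IH]].
  have -> : (fun t => \sum_(i < 0) a i * C i t) = (fun=> 0) by apply/funext => t; rewrite big_ord0.
  have c0 := @continuous_cstf R 0.
  split => //; have := volterra_lin (-1) vX c0 c0.
  have -> : (fun _ : R => 0 + -1 * 0 : R) = (fun=> 0) by apply/funext => t; ring.
  by move=> ->; apply/funext => t; rewrite big_ord0 mulN1r subrr.
have -> : (fun t => \sum_(i < n.+1) a i * C i t) = (fun t => \sum_(i < n) a i * C i t + a n * C n t).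
  by apply/funext => t; rewrite big_ord_recr.
split; first by apply: continuous_linf.
rewrite (volterra_lin _ vX IHc (cC n)) IH; apply/funext => t.
by rewrite big_ord_recr.
Qed.

Lemma eigvec_sum_fst H (phi phi1 : nat -> R -> R) n (a : nat -> R) t :
  (\sum_(i < n) a i *: eigvec H phi phi1 i).1 t = \sum_(i < n) a i * phi i t.
Proof.
elim: n => [|n IH]; first by rewrite !big_ord0.
by rewrite !big_ord_recr/= -IH.
Qed.

(** [(X a, 0)] is approximated by a sum [S] of eigenvectors, whose function part is [X b] for the
    same combination [b] of cosines. The sum [S'] of the other problem has function part [X' b] and
    the norm of [S]; discarding its scalar part gives the inequality. *)
Lemma eigenbasis_comparison q q' h h' H H' (H1 H2 H1' H2' : R) (lam lam' : nat -> R)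
    (phi phi1 phi' phi1' C : nat -> R -> R) X X' M :
  sqint q -> sqint q' -> 0 < H * H1 - H2 -> 0 < H' * H1' - H2' ->
  eigenbasis q h H H1 H2 lam phi phi1 -> eigenbasis q' h' H' H1' H2' lam' phi' phi1' ->
  (forall n, ipE H H1 H2 (eigvec H phi phi1 n) (eigvec H phi phi1 n) =
    ipE H' H1' H2' (eigvec H' phi' phi1' n) (eigvec H' phi' phi1' n)) ->
  0 <= M -> volterra X M -> volterra X' M -> (forall n, continuous (C n)) ->
  (forall n, X (C n) = phi n) -> (forall n, X' (C n) = phi' n) ->
  forall a, continuous a -> nsq (X' a) <= nsq (X a).
Proof.
move=> sq sq' rho0 rho0' eb eb' gam M0 vX vX' cC XC XC' a ca.
have [K K0 hK] := volterra_L2 M0 vX vX'.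
have [Xc _ _] := vX; have [Xc' _ _] := vX'.
set A := nsq (X' a); set B := nsq (X a).
have B0 : 0 <= B by apply: itg_ge0 => [|t _]; [exact: ltW|exact: sqr_ge0].
have key t e : 0 < t -> 0 < e ->
    A <= (1 + t) * ((1 + t) * B + (1 + t^-1) * e) + (1 + t^-1) * (K * e).
  move=> t0 e0.
  have [n [c hc]] := eigvec_dense sq rho0 eb (Xc a ca).1 e0.
  have [sS nS] := eigvec_sum_norm n c sq rho0 eb.
  have [sS' nS'] := eigvec_sum_norm n c sq' rho0' eb'.
  set S := \sum_(i < n) c i *: eigvec H phi phi1 i in hc sS nS.
  set S' := \sum_(i < n) c i *: eigvec H' phi' phi1' i in sS' nS'.
  have [cb Xb] := volterra_sum n c vX cC; have [_ Xb'] := volterra_sum n c vX' cC.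
  set b := (fun s => \sum_(i < n) c i * C i s) in cb Xb Xb'.
  have S1 s : S.1 s = X b s.
    by rewrite Xb /S eigvec_sum_fst; apply: eq_bigr => i _; rewrite XC.
  have S1' s : S'.1 s = X' b s.
    by rewrite Xb' /S' eigvec_sum_fst; apply: eq_bigr => i _; rewrite XC'.
  have SS : ipE H' H1' H2' S' S' = ipE H H1 H2 S S.
    by rewrite nS nS'; apply: eq_bigr => i _; rewrite gam.
  have le_fst (h0 k1 k2 : R) (F : V) : 0 < h0 * k1 - k2 -> nsq F.1 <= ipE h0 k1 k2 F F.
    move=> r0; rewrite /ipE.
    have -> : (fun t => F.1 t * F.1 t) = (fun t => F.1 t ^+ 2) by apply/funext.
    by rewrite lerDl divr_ge0// ?(ltW r0)// -expr2 sqr_ge0.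
  have cab : continuous (fun s => a s - b s) by exact: continuous_subf.
  have Ea : sqpair (X a, 0) by apply: sqint_continuous; exact: (Xc a ca).1.
  have h1 : nsq (X' b) <= ipE H H1 H2 S S.
    rewrite -SS; apply: le_trans (le_fst _ _ _ S' rho0').
    by under eq_fun do rewrite -S1'.
  have h2 : ipE H H1 H2 S S <= (1 + t) * B + (1 + t^-1) * e.
    have sd : sqpair ((X a, 0) - S).
      by have := sqpairD Ea (sqpairZ (-1) sS); rewrite scaleN1r.
    have := ipE_young rho0 t0 Ea (sqpairZ (-1) sd).
    rewrite scaleN1r opprB addrC subrK => /le_trans; apply.
    apply: lerD.
      rewrite ler_wpM2l//; first by rewrite addr_ge0// ltW.
      by rewrite /ipE /= mul0r mul0r addr0 /B.
    rewrite ler_wpM2l//; first by rewrite addr_ge0// invr_ge0 ltW.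
    rewrite -opprB -scaleN1r (ipE_scalel _ _ _ _ sd (sqpairZ (-1) sd)) ipE_sym (ipE_scalel _ _ _ _ sd sd).
    by rewrite !mulN1r opprK ltW.
  (* The approximation error is known for [X (a - b)]; [volterra_L2] carries it over to
     [X' (a - b)]. *)
  have h3 : nsq (X' (fun s => a s - b s)) <= K * e.
    apply: le_trans (hK _ cab) _; apply: ler_wpM2l => //; apply: le_trans (ltW hc).
    apply: le_trans (le_fst _ _ _ ((X a, 0) - S) rho0).
    rewrite (volterra_sub vX)//.
    have -> : (fun t0 => (X a t0 - X b t0) ^+ 2) = (fun t0 => ((X a, 0) - S).1 t0 ^+ 2); last by [].
    by apply/funext => s; rewrite -S1.
  have := itg_young t0 (Xc' b cb).1 (Xc' _ cab).1.
  have -> : (fun s => (X' b s + X' (fun s => a s - b s) s) ^+ 2) = (fun s => X' a s ^+ 2).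
    by apply/funext => s; rewrite (volterra_sub vX')// addrC subrK.
  move=> /le_trans; apply; apply: lerD; apply: ler_wpM2l.
  - by rewrite addr_ge0// ltW.
  - exact: le_trans h2.
  - by rewrite addr_ge0// invr_ge0 ltW.
  - exact: h3.
apply/ler_addgt0Pr => d d0.
have B1 : 0 < 3 * B + 1 by lra.
(* Since [t <= 1], [(1 + t) ^+ 2 * B] exceeds [B] by at most [3 * t * B], hence by at most [d / 2].
   With [t] fixed, the error [d / 2 / L] makes the remaining terms equal to [d / 2]. *)
pose t := Num.min 1 (d / 2 / (3 * B + 1)).
have t0 : 0 < t by rewrite lt_min ltr01/= !divr_gt0.
have t1 : t <= 1 by rewrite ge_min lexx.
have td : t * (3 * B + 1) <= d / 2 by rewrite -ler_pdivlMr// ge_min lexx orbT.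
pose L := (1 + t) * (1 + t^-1) + (1 + t^-1) * K.
have ti : 0 < t^-1 by rewrite invr_gt0.
have L0 : 0 < L by rewrite /L ltr_pwDl// ?mulr_gt0 ?mulr_ge0//; lra.
have := key t (d / 2 / L) t0 (divr_gt0 (divr_gt0 d0 (@ltr0n R 2)) L0).
have -> : (1 + t) * ((1 + t) * B + (1 + t^-1) * (d / 2 / L)) + (1 + t^-1) * (K * (d / 2 / L)) =
  (1 + t) ^+ 2 * B + L * (d / 2 / L) by rewrite [in X in _ = _ + X * _]/L; ring.
have -> : L * (d / 2 / L) = d / 2 by rewrite mulrC divfK// gt_eqF.
nra.
Qed.

End Comparison.

(** * Passage between solutions on [0, pi] and integral equations for clamped functions *)

Section Conversion.
Context {R : realType}.
Local Notation mu := (@lebesgue_measure R).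
Implicit Types (q f g y : R -> R) (h H l t e x : R).
Let pi0 : 0 < pi :> R := pi_gt0 R.

(** Values outside the interval are arbitrary, and [q] need not even be measurable there; extension
    by zero gives a coefficient that is square integrable on every compact interval. *)
Definition inner q : R -> R := q \_ `]0, pi[.

Lemma innerE q x : 0 < x < pi -> inner q x = q x.
Proof. by move=> xp; rewrite /inner patchE mem_set//= in_itv. Qed.

Lemma L2_sqint q : L2_0pi q -> sqint (inner q).
Proof.
move=> qL; have mq : measurable_fun setT (inner q).
  by move: qL; rewrite /L2_0pi inE => /andP[]; rewrite inE.
split => // a b; have := Lfun2_integrable_sqr qL.
by move=> /integrableS; apply.
Qed.

Lemma sqint_L2 f : sqint f -> L2_0pi f.
Proof.
move=> [mf lf]; rewrite /L2_0pi inE; apply/andP; split; rewrite inE/=.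
  apply/(measurable_restrictT _ _).1 => //; exact: measurable_funS mf.
rewrite /finite_norm unlock poweR_lty//=.
rewrite [ltLHS](_ : _ = \int[mu]_(x in `]0%R, pi[) (f x ^+ 2)%:E)%E; last first.
  rewrite [RHS]integral_mkcond; apply: eq_integral => x _.
  rewrite !patchE; case: ifPn => _.
    by rewrite powR_mulrn ?normr_ge0// real_normK// num_real.
  by rewrite normr0 powR0// pnatr_eq0.
apply: integrable_lty => //.
by apply: integrableS (lf 0 pi) => //; exact: subset_itv_oo_cc.
Qed.

Lemma derivative_0piP (y y1 : R -> R) : derivative_0pi y y1 <->
  forall x e, 0 <= x <= pi -> 0 < e -> exists2 d, 0 < d &
    forall t, 0 <= t <= pi -> t != x -> `|t - x| < d -> `|(y t - y x) / (t - x) - y1 x| < e.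
Proof.
split=> [dy x e xp e0|h x].
  have /cvgrPdist_lt/(_ e e0) := dy x ltac:(by rewrite in_itv).
  rewrite near_withinE near_withinE => /nbhs_ballP[d /= d0 hd].
  exists d => // t tp tx td; rewrite distrC; apply: hd => //.
  by rewrite /ball/= distrC.
rewrite in_itv/= => xp; apply/cvgrPdist_lt => e e0.
have [d d0 hd] := h x e xp e0.
rewrite near_withinE near_withinE; apply/nbhs_ballP; exists d => //= t xt tx.
rewrite in_itv/= => tp; rewrite distrC; apply: hd => //.
by move: xt; rewrite /ball/= distrC.
Qed.

(** The clamped [y] has an ordinary derivative only inside the interval, so the mean value theorem
    is applied to [y] minus the primitive of [y1]; continuity up to the end points comes from the
    one-sided difference quotients. *)
Lemma derivative_0pi_itg (y y1 : R -> R) x : continuous (fun x => y1 (cl x)) -> derivative_0pi y y1 ->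
  continuous (fun x => y (cl x)) /\ (0 <= x <= pi -> y x = y 0 + itg (fun x => y1 (cl x)) 0 x).
Proof.
move=> cy1 /derivative_0piP dy.
have cy : continuous (fun x => y (cl x)).
  apply/continuousPe => s e e0.
  have [d d0 hd] := dy (cl s) 1 (cl_itv s) ltr01.
  have L0 : 0 < `|y1 (cl s)| + 1 by rewrite ltr_wpDl.
  exists (Num.min d (e / (`|y1 (cl s)| + 1))); first by rewrite lt_min d0 divr_gt0.
  move=> t; rewrite lt_min => /andP[t1 t2].
  have tcl := cl_lip t s.
  have [->|ne] := eqVneq (cl t) (cl s); first by rewrite subrr normr0.
  have := hd (cl t) (cl_itv t) ne (le_lt_trans tcl t1).
  have nz : cl t - cl s != 0 by rewrite subr_eq0.
  move=> h1.
  have h2 : `|(y (cl t) - y (cl s)) / (cl t - cl s)| <= `|y1 (cl s)| + 1.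
    rewrite -[X in `|X|](subrK (y1 (cl s))) addrC.
    by apply: le_trans (ler_normD _ _) _; rewrite lerD2l ltW.
  rewrite -[X in `|X|](divfK nz) normrM.
  apply: le_lt_trans (ler_pM _ _ h2 tcl) _ => //.
  by rewrite mulrC -ltr_pdivlMr.
split=> // /andP[x0 xpi].
pose G s := y (cl s) - itg (fun x => y1 (cl x)) 0 s.
have dG s : s \in `]0, x[%R -> is_derive s (1 : R) G 0.
  rewrite in_itv/= => /andP[s0 sx].
  have spi : s < pi by exact: lt_le_trans xpi.
  have scl : cl s = s by rewrite cl_id// !ltW.
  have dY : is_derive s (1 : R) (fun x => y (cl x)) (y1 (cl s)).
    have H : (fun k : R => k^-1 *: (y (cl (k *: (1 : R) + s)) - y (cl s))) @ 0^' --> y1 (cl s).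
      apply/cvgrPdist_lt => e e0.
      have [d d0 hd] := dy s e ltac:(by rewrite !ltW) e0.
      rewrite near_withinE; apply/nbhs_ballP.
      (* The distances to 0 and pi keep the incremented point inside the interval. *)
      exists (Num.min d (Num.min s (pi - s))) => /=.
        by rewrite !lt_min d0 s0 subr_gt0.
      move=> k; rewrite /ball/= sub0r normrN !lt_min => /and3P[k1 k2 k3] k0.
      have kE : k *: (1 : R) = k by exact: mulr1.
      have ksp : 0 <= k + s <= pi by move: k2 k3; rewrite !ltr_norml; lra.
      rewrite kE (cl_id ksp) scl distrC.
      have := hd (k + s) ksp; rewrite addrK => /(_ _ k1).
      rewrite -subr_eq0 addrK => /(_ k0).
      by rewrite mulrC.
    by split; [apply/cvg_ex; exists (y1 (cl s))|exact: cvg_lim].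
  rewrite -(subrr (y1 (cl s))); apply: is_deriveB.
  by apply: is_derive_itg.
have cG : {within `[0, x], continuous G}.
  apply: continuous_subspaceT; apply: continuous_subf => //.
  exact/itg_continuous/locint_cont.
have [z _] := MVT_segment x0 dG cG.
rewrite mul0r /G itgxx subr0 (@cl_id _ x) ?x0// (@cl_id _ 0) ?lexx ?(ltW pi0)// => /eqP.
by rewrite subr_eq0 => /eqP <-; rewrite subrK.
Qed.

Lemma Rintegral_inner f x : L2_0pi f -> 0 <= x <= pi ->
  \int[mu]_(t in `[0, x]) f t = itg (inner f) 0 x.
Proof.
move=> fL /andP[x0 xp]; have [mf _] := L2_sqint fL.
have eqoo t : t \in `]0, x[%classic -> f t = inner f t.
  rewrite inE/= in_itv/= => /andP[t0 tx]; rewrite innerE// t0.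
  exact: lt_le_trans xp.
have mo : measurable_fun `]0, x[ f.
  apply: eq_measurable_fun (_ : measurable_fun `]0, x[ (inner f)); last exact: measurable_funS mf.
  by move=> t /eqoo.
have key g : measurable_fun `]0, x[ g ->
    \int[mu]_(t in `[0, x]) g t = \int[mu]_(t in `]0, x[) g t.
  move=> mg; rewrite /Rintegral -integral_itv_obnd_cbnd; last first.
    by apply/measurable_EFinP; exact: measurable_fun_itv_oc mg.
  by rewrite -integral_itv_bndo_bndc//; exact/measurable_EFinP.
rewrite itgE// !key//; last exact: measurable_funS mf.
by apply: eq_Rintegral => t /eqoo.
Qed.

Lemma solution_sl q l (y y1 : R -> R) : L2_0pi q -> solution q l y y1 ->
  sl_sol (fun t => inner q t - l) (fun=> 0) (fun x => y (cl x)) (fun x => y1 (cl x)).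
Proof.
move=> qL [y2 [dy y2L ey1] ey2].
have sy2 := L2_sqint y2L; have ly2 := sqint_locint sy2.
have sq := L2_sqint qL; have lq := sqint_locint sq.
have ey1' x : 0 <= x <= pi -> y1 x = y1 0 + itg (inner y2) 0 x.
  by move=> xp; rewrite ey1 ?in_itv// Rintegral_inner.
have cl0 : cl 0 = 0 :> R by rewrite cl_id// lexx ltW.
have cy1 : continuous (fun x => y1 (cl x)).
  have -> : (fun x => y1 (cl x)) = (fun x => y1 0 + itg (inner y2) 0 (cl x)).
    by apply/funext => x; rewrite ey1'// cl_itv.
  apply: continuous_addf; first exact: continuous_cstf.
  by apply: continuous_compf; [exact: itg_continuous|exact: cl_continuous].
have cy : continuous (fun x => y (cl x)) := (derivative_0pi_itg 0 cy1 dy).1.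
split => //; [by move=> x; rewrite clcl|by move=> x; rewrite clcl|].
move=> x xp; have /andP[x0 xpi] := xp; rewrite cl0 cl_id//; split.
  exact: (derivative_0pi_itg x cy1 dy).2.
rewrite ey1'//; congr (_ + _).
have lr : locint (fun t => (inner q t - l) * y (cl t) - 0).
  under eq_fun do rewrite subr0.
  by apply: locintM => //; apply: locintB => //; exact: locint_cst.
apply: ae_itg => //; [exact: sy2.1|exact: locint_measurable|].
apply: (@filterS _ _ (ae_filter_ringOfSetsType mu) _ _ _ ey2) => t ht.
rewrite in_itv/= => /andP[t0 tx]; have tp : 0 < t < pi by rewrite t0 (lt_le_trans tx).
have := ht ltac:(by rewrite in_itv); rewrite !innerE// cl_id; last by rewrite !ltW//; case/andP: tp.
lra.
Qed.

Lemma sl_solution q l (y y1 : R -> R) : L2_0pi q ->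
  sl_sol (fun t => inner q t - l) (fun=> 0) y y1 -> solution q l y y1.
Proof.
move=> qL [cy cy1 ycl y1cl ye].
have sq := L2_sqint qL.
exists (fun t => y t * (inner q t - l)).
  split.
  - apply/derivative_0piP => x e xp e0.
    have e2 : 0 < e / 2 by exact: divr_gt0.
    have [d d0 hd] := (continuousPe y1).1 cy1 x _ e2.
    exists d => // t tp tx td.
    have nz : t - x != 0 by rewrite subr_eq0.
    have l1 := locint_cont cy1; have lc := @locint_cst R (y1 x).
    have -> : (y t - y x) / (t - x) - y1 x = itg (fun s => y1 s - y1 x) x t / (t - x).
      rewrite itgB// itg_cst (ye t tp).1 (ye x xp).1 -(itg_split 0 x t l1); field; exact: nz.
    rewrite normrM normfV ltr_pdivrMr ?normr_gt0//.
    apply: (@le_lt_trans _ _ (e / 2 * `|t - x|)); last first.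
      by rewrite ltr_pM2r ?normr_gt0//; lra.
    have lb : locint (fun s => y1 s - y1 x) by exact: locintB.
    move: td; rewrite ltr_norml => /andP[td1 td2].
    have [xt|/ltW tx'] := leP x t.
      rewrite [`|t - x|]ger0_norm ?subr_ge0//; apply: itg_bound => // s /andP[s1 s2].
      by apply/ltW/hd; rewrite ltr_norml; lra.
    rewrite itgC normrN distrC [`|x - t|]ger0_norm ?subr_ge0//; apply: itg_bound => // s /andP[s1 s2].
    by apply/ltW/hd; rewrite ltr_norml; lra.
  - by apply/sqint_L2/sqintMl => //; exact: sqint_sub_cst.
  - move=> x; rewrite in_itv/= => xp; have /andP[x0 _] := xp.
    rewrite (ye x xp).2 itgE//; congr (_ + _); apply: eq_Rintegral => t _.
    by rewrite subr0 mulrC.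
apply: aeW => x; rewrite in_itv/= => xp; rewrite innerE//; ring.
Qed.

Lemma bvp_eigenvalueP q h H (H1 H2 : R) l : L2_0pi q -> bvp_eigenvalue q h H H1 H2 l <->
  exists y y1, eigensolution (inner q) h H H1 H2 l y y1 /\ exists x, y x != 0.
Proof.
move=> qL; have cl0 : cl 0 = 0 :> R by rewrite cl_id// lexx ltW.
have clpi : cl pi = pi :> R by rewrite cl_id// lexx ltW.
split=> [[y [y1 [sy [x xp yx] hy by_]]]|[y [y1 [[sy hy by_] [x yx]]]]].
  exists (fun x => y (cl x)), (fun x => y1 (cl x)); split.
    split; [exact: solution_sl|by rewrite cl0; apply/eqP; rewrite -subr_eq0 hy|by rewrite clpi].
  by exists x; rewrite cl_id//; move: xp; rewrite in_itv.
exists y, y1; split => //; first exact: sl_solution.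
  by exists (cl x); [rewrite in_itv/= cl_itv|have [_ _ -> _ _] := sy].
by rewrite hy subrr.
Qed.

End Conversion.

(** * Recovery of the potential and of the boundary coefficients *)

Section Uniqueness.
Context {R : realType}.
Local Notation mu := (@lebesgue_measure R).
Implicit Types (q f g y : R -> R) (h H l t e x : R) (lam gam : nat -> R).
Let pi0 : 0 < pi :> R := pi_gt0 R.

(** The functions in the norming constants are specified by their Cauchy data at 0 alone. They
    satisfy the condition at pi because some eigenfunction for [lam n] does and is a nonzero
    multiple of them. *)
Lemma spectral_data_eigenbasis q h H (H1 H2 : R) lam gam : L2_0pi q ->
  spectral_data q h H H1 H2 lam gam -> exists phi phi1, eigenbasis (inner q) h H H1 H2 lam phi phi1 /\
    forall n, gam n = ipE H H1 H2 (eigvec H phi phi1 n) (eigvec H phi phi1 n).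
Proof.
move=> qL [lm le ln].
have cl0 : cl 0 = 0 :> R by rewrite cl_id// lexx ltW.
have clpi : cl pi = pi :> R by rewrite cl_id// lexx ltW.
have /choice[p hp] : forall n, exists p : (R -> R) * (R -> R),
    phi_solution q h (lam n) p.1 p.2 /\ gam n = (\int[mu]_(x in `[0, pi]) (p.1 x ^+ 2))
        + (p.2 pi + H * p.1 pi) ^+ 2 / (H * H1 - H2).
  by move=> n; have [f [f1 hf]] := ln n; exists (f, f1).
exists (fun n x => (p n).1 (cl x)), (fun n x => (p n).2 (cl x)); split; last first.
  move=> n; have [_ ->] := hp n; rewrite /ipE /eigvec /= clpi -expr2 itgE ?(ltW pi0)//.
  congr (_ + _); apply: eq_Rintegral => x; rewrite inE/= in_itv/= => xp.
  by rewrite cl_id// expr2.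
have sl n : sl_sol (fun t => inner q t - lam n) (fun=> 0) (fun x => (p n).1 (cl x)) (fun x => (p n).2 (cl x)).
  by have [[sn _ _] _] := hp n; exact: solution_sl.
split => //.
- move=> n; have [[_ p0 p10] _] := hp n; split; [exact: sl|by rewrite cl0 p0 p10 mulr1|].
  have /(bvp_eigenvalueP _ _ _ _ _ qL)[y [y1 [[sy hy by_] [x yx]]]] : bvp_eigenvalue q h H H1 H2 (lam n).
    by apply/le; exists n.
  have sq := sqint_sub_cst (L2_sqint qL) (lam n).
  have [ey ey1] := sl_proportional sq sy (sl n) hy (etrans (congr1 _ cl0) p0) (etrans (congr1 _ cl0) p10).
  have y0 : y 0 != 0 by apply: contra_neq yx => y0; rewrite ey y0 mul0r.
  apply: (mulfI y0); rewrite mulrCA mulrDr [y 0 * (H1 * _ + _)]mulrDr.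
  by rewrite ![y 0 * (_ * _)]mulrCA -!ey -!ey1.
- by move=> n; have [[_ p0 _] _] := hp n; rewrite cl0.
- by move=> l y y1 ey yx; apply/le/(bvp_eigenvalueP _ _ _ _ _ qL); exists y, y1.
Qed.

(** As the integrals vanish for every upper limit x, it suffices to approximate the constant 1 by a
    combination [P] of the [phi n]: the integral of [f] over [0, x] equals that of [f * (1 - P)]. *)
Lemma eigenbasis_total q h H (H1 H2 : R) lam (phi phi1 : nat -> R -> R) f : sqint q -> 0 < H * H1 - H2 ->
  eigenbasis q h H H1 H2 lam phi phi1 -> sqint f ->
  (forall n x, 0 <= x <= pi -> itg (fun t => f t * phi n t) 0 x = 0) ->
  forall x, 0 <= x <= pi -> itg f 0 x = 0.
Proof.
move=> sq rho0 eb sf f0 x xp; have /andP[x0 xpi] := xp.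
have [_ lf2] := sf; have lf := sqint_locint sf.
set N := itg (fun t => f t ^+ 2) 0 pi.
have N0 : 0 <= N by apply: itg_ge0 => [|t _]; [exact: ltW|exact: sqr_ge0].
apply/eqP; rewrite -normr_le0; apply/ler_addgt0Pr => d d0; rewrite add0r.
(* Parameter of the bound of [|f * v|] by [t * f ^+ 2 + t^-1 * v ^+ 2]: the first term integrates to
   at most [d / 2], and the approximation error [t * (d / 2)] gives the same for the second. *)
pose t := d / 2 / (N + 1).
have t0 : 0 < t by rewrite !divr_gt0// ltr_wpDl.
have c1 := @continuous_cstf R 1.
have [n [a ha]] := eigvec_dense sq rho0 eb c1 (mulr_gt0 t0 (divr_gt0 d0 (@ltr0n R 2))).
set S := \sum_(i < n) _ in ha.
have cphi i : continuous (phi i) by have [/(_ i)[[]]] := eb.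
pose P s := \sum_(i < n) a i * phi i s.
have [cP fP] : continuous P /\ itg (fun s => f s * P s) 0 x = 0.
  rewrite /P; elim: (n) => [|m [IHc IH]].
    have -> : (fun s => \sum_(i < 0) a i * phi i s) = (fun=> 0) by apply/funext => s; rewrite big_ord0.
    split; first exact: continuous_cstf.
    under eq_fun do rewrite big_ord0 mulr0.
    by rewrite itg_cst mul0r.
  have -> : (fun s => \sum_(i < m.+1) a i * phi i s) = (fun s => \sum_(i < m) a i * phi i s + a m * phi m s).
    by apply/funext => s; rewrite big_ord_recr.
  split; first exact: continuous_linf.
  under eq_fun do rewrite big_ord_recr/= mulrDr mulrCA.
  by rewrite itgD ?itgZ ?IH ?f0 ?mulr0 ?addr0//; [exact: locintM..|apply: locintZ; exact: locintM].
pose v s := 1 - P s.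
have cv : continuous v by exact: continuous_subf.
have lv : locint (fun s => v s ^+ 2) by apply/locint_cont/continuous_mulf.
have nv : itg (fun s => v s ^+ 2) 0 pi <= t * (d / 2).
  apply: le_trans (ltW ha); rewrite /ipE.
  have -> : (fun s => ((cst 1, 0) - S).1 s * ((cst 1, 0) - S).1 s) = (fun s => v s ^+ 2).
    by apply/funext => s; rewrite /v /P -(eigvec_sum_fst H phi phi1) expr2.
  by rewrite lerDl divr_ge0// ?(ltW rho0)// -expr2 sqr_ge0.
have lfv : locint (fun s => f s * v s) by exact: locintM.
have -> : itg f 0 x = itg (fun s => f s * v s) 0 x.
  have -> : (fun s => f s * v s) = (fun s => f s - f s * P s) by apply/funext => s; rewrite /v; ring.
  by rewrite itgB ?fP ?subr0//; exact: locintM.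
apply: le_trans (itg_norm lfv x0) _.
apply: (@le_trans _ _ (itg (fun s => t * f s ^+ 2 + t^-1 * v s ^+ 2) 0 x)).
  apply: itg_le => //; [exact: locint_norm|by apply: locintD; exact: locintZ|].
  move=> s _; rewrite normrM -(real_normK (num_real (f s))) -(real_normK (num_real (v s))).
  move: (`|f s|) (`|v s|) (normr_ge0 (f s)) (normr_ge0 (v s)) => F G F0 G0.
  have : 0 <= t^-1 * (t * F - G) ^+ 2 by rewrite mulr_ge0 ?sqr_ge0// invr_ge0 ltW.
  have -> : t^-1 * (t * F - G) ^+ 2 = t * F ^+ 2 - 2 * (F * G) + t^-1 * G ^+ 2.
    by field; rewrite gt_eqF.
  have := mulr_ge0 F0 G0; lra.
rewrite itgD ?itgZ//; try exact: locintZ.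
have h1 : itg (fun s => f s ^+ 2) 0 x <= N by apply: itg_mono => // s; exact: sqr_ge0.
have h2 : itg (fun s => v s ^+ 2) 0 x <= t * (d / 2).
  by apply: le_trans nv; apply: itg_mono => // s; exact: sqr_ge0.
have h3 : t * N <= d / 2.
  by rewrite /t mulrAC ler_pdivrMr ?ltr_wpDl//; nra.
have h4 : t^-1 * itg (fun s => v s ^+ 2) 0 x <= d / 2.
  by rewrite mulrC ler_pdivrMr// mulrC.
have := ler_wpM2l (ltW t0) h1; lra.
Qed.

(* If both boundary values at [pi] vanished, so would the Wronskian with the
   solution [w], [w 0 = 0], [w1 0 = 1]. *)
Lemma eigensolution_end_neq0 q h H (H1 H2 : R) l (y y1 : R -> R) : sqint q -> 0 < H * H1 - H2 ->
  eigensolution q h H H1 H2 l y y1 -> y 0 = 1 -> y1 pi + H * y pi != 0.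
Proof.
move=> sq rho0 [sy hy by_] y0; apply/eqP => s0.
have y1E : y1 pi = - (H * y pi) by apply/eqP; rewrite -addr_eq0 s0.
have yp : y pi = 0.
  apply/eqP; move/eqP: by_; rewrite s0 mulr0 y1E eq_sym.
  have -> : H1 * - (H * y pi) + H2 * y pi = - ((H * H1 - H2) * y pi) by ring.
  by rewrite oppr_eq0 mulf_eq0 gt_eqF.
have y1p : y1 pi = 0 by rewrite y1E yp mulr0 oppr0.
have sp := sqint_sub_cst sq l; have lp := sqint_locint sp.
have [K _ /(_ (fun=> 0) 0 1 (locint_cst 0))] := sl_exists sp.
move=> [w [w1 [[cw cw1 _ _ we] w0 w10 _]]].
have [cy cy1 _ _ ye] := sy.
have pp : 0 <= (pi : R) by exact: ltW.
have ly := locint_cont cy1; have lw := locint_cont cw1.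
have ly2 : locint (fun t => (q t - l) * y t - 0).
  by under eq_fun do rewrite subr0; exact: locintM.
have lw2 : locint (fun t => (q t - l) * w t - 0).
  by under eq_fun do rewrite subr0; exact: locintM.
have e1 := itg_by_parts_ac ly lw2 pp (fun x xp => (ye x xp).1) (fun x xp => (we x xp).2).
have e2 := itg_by_parts_ac ly2 lw pp (fun x xp => (ye x xp).2) (fun x xp => (we x xp).1).
have : itg (fun t => y1 t * w1 t + y t * ((q t - l) * w t - 0)) 0 pi =
    itg (fun t => ((q t - l) * y t - 0) * w t + y1 t * w1 t) 0 pi.
  by congr itg; apply/funext => t; ring.
rewrite e1 e2 yp y1p y0 w0 w10 !mul0r mulr0 !sub0r mulr1 oppr0 => /eqP.
by rewrite oppr_eq0 oner_eq0.
Qed.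

(** A nonconstant affine function takes values with a given square at no more than two points: if
    two distinct points share the square, the values there are opposite, which cannot happen for two
    pairs with a common point. *)
Lemma sqr_affine_eq3 (k c r l0 l1 l2 : R) : l0 < l1 -> l1 < l2 ->
  (1 + k * (c - l0)) ^+ 2 = r -> (1 + k * (c - l1)) ^+ 2 = r -> (1 + k * (c - l2)) ^+ 2 = r ->
  k = 0.
Proof.
move=> l01 l12 e0 e1 e2; apply/eqP/negPn/negP => k0.
have h m n : m < n -> (1 + k * (c - m)) ^+ 2 = r -> (1 + k * (c - n)) ^+ 2 = r ->
    2 + k * (2 * c - m - n) = 0.
  move=> mn em en; have : k * (n - m) * (2 + k * (2 * c - m - n)) = 0.
    have -> : k * (n - m) * (2 + k * (2 * c - m - n)) = (1 + k * (c - m)) ^+ 2 - (1 + k * (c - n)) ^+ 2.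
      by ring.
    by rewrite em en subrr.
  by move/eqP; rewrite !mulf_eq0 (negbTE k0) subr_eq0 gt_eqF//= => /eqP.
have a1 := h _ _ l01 e0 e1; have a2 := h _ _ (lt_trans l01 l12) e0 e2.
have : k * (l2 - l1) = 0.
  have -> : k * (l2 - l1) = (2 + k * (2 * c - l0 - l1)) - (2 + k * (2 * c - l0 - l2)) by ring.
  by rewrite a1 a2 subrr.
by move/eqP; rewrite mulf_eq0 (negbTE k0) subr_eq0 gt_eqF.
Qed.

(** Write s_n = [b n + H * a n]. The condition at pi reads r a_n = (H1 - l_n) s_n, so replacing [H]
    by [H'] multiplies s_n by 1 + k (H1 - l_n) with k = (H' - H) / r. Equality of the scalar parts
    of the norming constants makes the square of this factor equal to r' / r for every n, whence k =
    0. *)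
Lemma boundary_coefficients_unique (H H1 H2 H' H1' H2' : R) (l a b : nat -> R) :
  0 < H * H1 - H2 -> 0 < H' * H1' - H2' -> {homo l : m n / (m < n)%N >-> m < n} ->
  (forall n, b n + H * a n != 0) ->
  (forall n, l n * (b n + H * a n) = H1 * b n + H2 * a n) ->
  (forall n, l n * (b n + H' * a n) = H1' * b n + H2' * a n) ->
  (forall n, (b n + H * a n) ^+ 2 / (H * H1 - H2) = (b n + H' * a n) ^+ 2 / (H' * H1' - H2')) ->
  [/\ H = H', H1 = H1' & H2 = H2'].
Proof.
move=> r0 r0' lm s0 e e' g.
set r := H * H1 - H2 in r0 g *; set r' := H' * H1' - H2' in r0' g *.
have rn : r != 0 by rewrite gt_eqF.
have rn' : r' != 0 by rewrite gt_eqF.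
have aE n : r * a n = (H1 - l n) * (b n + H * a n).
  by rewrite [RHS]mulrBl e /r; ring.
have aE' n : r' * a n = (H1' - l n) * (b n + H' * a n).
  by rewrite [RHS]mulrBl e' /r'; ring.
pose k := (H' - H) / r.
have sE n : b n + H' * a n = (b n + H * a n) * (1 + k * (H1 - l n)).
  have -> : (b n + H * a n) * (1 + k * (H1 - l n)) =
    b n + H * a n + k * ((H1 - l n) * (b n + H * a n)) by ring.
  by rewrite -aE /k mulrA divfK//; ring.
have key n : (1 + k * (H1 - l n)) ^+ 2 = r' / r.
  have := g n; rewrite sE exprMn => h.
  have s2 : (b n + H * a n) ^+ 2 != 0 by rewrite expf_neq0.
  apply: (mulfI s2).
  have -> : (b n + H * a n) ^+ 2 * (1 + k * (H1 - l n)) ^+ 2 =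
    (b n + H * a n) ^+ 2 * (1 + k * (H1 - l n)) ^+ 2 / r' * r' by rewrite divfK.
  by rewrite -h; rewrite mulrCA mulrC mulrA mulrAC.
have k0 := sqr_affine_eq3 (lm 0 1 isT) (lm 1 2 isT) (key 0%N) (key 1%N) (key 2%N).
have HE : H = H'.
  move/eqP: k0; rewrite mulf_eq0 invr_eq0 (negbTE rn) orbF subr_eq0 => /eqP ->.
  by [].
have rE : r' = r.
  have := key 0%N; rewrite k0 mul0r addr0 expr1n => h.
  by rewrite -[LHS](divfK rn) -h mul1r.
have H1E : H1 = H1'.
  have := aE' 0%N; rewrite rE aE -HE => /(mulIf (s0 0%N)) /addIr.
  by [].
by split => //; move: rE; rewrite /r /r' -HE -H1E; lra.
Qed.

End Uniqueness.

Unset Implicit Arguments.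

Theorem theorem4p1 (R : realType)
  (q q' : R -> R) (h H H1 H2 h' H' H1' H2' : R)
  (lam gam lam' gam' : nat -> R)
  (q_L2 : L2_0pi q) (q'_L2 : L2_0pi q')
  (rho_gt0 : 0 < H * H1 - H2) (rho'_gt0 : 0 < H' * H1' - H2')
  (data : spectral_data q h H H1 H2 lam gam)
  (data' : spectral_data q' h' H' H1' H2' lam' gam')
  (lam_eq : forall n, lam n = lam' n)
  (gam_eq : forall n, gam n = gam' n) :
  {ae (@lebesgue_measure R), forall x, x \in `]0, pi[ -> q x = q' x} /\
  [/\ h = h', H = H', H1 = H1' & H2 = H2'].
Proof.
have pi0 : 0 < pi :> R := pi_gt0 R.
have e_lam : lam' = lam by apply/funext => n.
rewrite e_lam in data'.
have [phi [phi1 [eb ng]]] := spectral_data_eigenbasis q_L2 data.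
have [psi [psi1 [eb' ng']]] := spectral_data_eigenbasis q'_L2 data'.
have sq := L2_sqint q_L2; have sq' := L2_sqint q'_L2.
have [pe p0 lm _] := eb; have [pe' p0' _ _] := eb'.
have /choice[C hC] : forall n, exists C, exists S, cosine_family (lam n) C S.
  by move=> n; exact: cosine_family_exists.
have cC n : continuous (C n).
  by have [S [[dC _] _ _ _ _]] := hC n; exact: is_derive_continuous dC.
have [X [M [M0 [X1 X2 X3 X4]]]] := transmutation_exists h sq.
have [X' [M' [M0' [X1' X2' X3' X4']]]] := transmutation_exists h' sq'.
pose N := M + M'.
have N0 : 0 <= N by exact: addr_ge0.
have ge0_itg (f : R -> R) (x : R) : 0 <= x <= pi -> 0 <= itg (fun t => `|f t|) 0 x.
  by move=> /andP[x0 _]; exact: itg_ge0.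
have vX : volterra X N.
  split => // f x cf xp; apply: le_trans (X3 f x cf xp) _.
  by rewrite ler_wpM2r ?ge0_itg// lerDl.
have vX' : volterra X' N.
  split => // f x cf xp; apply: le_trans (X3' f x cf xp) _.
  by rewrite ler_wpM2r ?ge0_itg// lerDr.
have XC n : X (C n) = phi n.
  have [S cS] := hC n; have [sp hp _] := pe n.
  by apply/funext => x; apply: (X4 _ _ _ _ _ cS sp) => //; rewrite hp p0 mulr1.
have XC' n : X' (C n) = psi n.
  have [S cS] := hC n; have [sp hp _] := pe' n.
  by apply/funext => x; apply: (X4' _ _ _ _ _ cS sp) => //; rewrite hp p0' mulr1.
have gE n : ipE H H1 H2 (eigvec H phi phi1 n) (eigvec H phi phi1 n) =
    ipE H' H1' H2' (eigvec H' psi psi1 n) (eigvec H' psi psi1 n).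
  by rewrite -ng -ng' gam_eq.
(* The comparison is applied in both directions; each one alone is only an inequality. *)
have iso a : continuous a -> itg (fun t => X a t ^+ 2) 0 pi = itg (fun t => X' a t ^+ 2) 0 pi.
  move=> ca; apply/eqP; rewrite eq_le.
  rewrite (eigenbasis_comparison sq sq' rho_gt0 rho'_gt0 eb eb' gE N0 vX vX' cC XC XC' ca) andbT.
  exact: (eigenbasis_comparison sq' sq rho'_gt0 rho_gt0 eb' eb (fun n => esym (gE n)) N0 vX' vX cC XC' XC ca).
have phiE n (x : R) : 0 <= x <= pi -> phi n x = psi n x.
  by move=> xp; rewrite -XC -XC'; exact: (isometric_volterra_eq N0 vX vX' iso).
have le0pi (x : R) : 0 <= x <= pi -> forall t : R, 0 <= t <= x -> 0 <= t <= pi.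
  by move=> /andP[_ xp] t /andP[-> tx]; exact: le_trans xp.
(* Equal functions have derivatives with equal primitives, and these derivatives are continuous. *)
have phi1E n (x : R) : 0 <= x <= pi -> phi1 n x = psi1 n x.
  have [[[_ c1 _ _ e] _ _] [[_ c1' _ _ e'] _ _]] := (pe n, pe' n).
  move=> xp; apply/eqP; rewrite -subr_eq0; apply/eqP; move: x xp.
  apply: continuous_itg_eq0 => //; first exact: continuous_subf.
  move=> x xp; rewrite itgB; [|exact: locint_cont..].
  have := (e x xp).1; rewrite phiE// (e' x xp).1 p0 p0' => /addrI ->.
  by rewrite subrr.
have p00 : 0 <= (0 : R) <= pi by rewrite lexx ltW.
have ppi : 0 <= (pi : R) <= pi by rewrite lexx ltW.
have hE : h = h'.
  have := phi1E 0%N 0 p00; have [_ -> _] := pe 0%N; have [_ -> _] := pe' 0%N.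
  by rewrite p0 p0' !mulr1.
split.
  pose D t := inner q t - inner q' t.
  have sD : sqint D.
    have := sqintD sq (sqintZ (-1) sq').
    by under eq_fun do rewrite mulN1r.
  (* Subtracting the two integrated equations for [phi n = psi n] cancels the terms with [lam n] and
     the initial values, so the integral of [D * phi n] over [0, x] vanishes for every x. *)
  have D0 : forall x, 0 <= x <= pi -> itg D 0 x = 0.
    apply: (eigenbasis_total sq rho_gt0 eb sD) => n x xp; have /andP[x0 _] := xp.
    have [[[c _ _ _ e] hp _] [[c' _ _ _ e'] hp' _]] := (pe n, pe' n).
    have lq := sqint_locint (sqint_sub_cst sq (lam n)).
    have lq' := sqint_locint (sqint_sub_cst sq' (lam n)).
    have l1 : locint (fun t => (inner q t - lam n) * phi n t) by exact: locintM.
    have l2 : locint (fun t => (inner q' t - lam n) * psi n t) by exact: locintM.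
    have -> : itg (fun t => D t * phi n t) 0 x =
        itg (fun t => (inner q t - lam n) * phi n t - (inner q' t - lam n) * psi n t) 0 x.
      by apply: eq_itg => // t tx; rewrite -(phiE n t (le0pi x xp t tx)) -mulrBl /D opprB addrA subrK.
    rewrite itgB//; apply/eqP; rewrite subr_eq0; apply/eqP.
    have := (e x xp).2; rewrite phi1E// (e' x xp).2 hp hp' p0 p0' !mulr1 hE => /addrI.
    by under eq_fun do rewrite subr0; move=> ->; congr itg; apply/funext => t; rewrite subr0.
  have := itg_eq0_ae (sqint_locint sD) D0.
  apply: (@filterS _ _ (ae_filter_ringOfSetsType _)) => x hx xp.
  have := hx xp; move: xp; rewrite in_itv/= /D => xp; rewrite !innerE// => /eqP.
  by rewrite subr_eq0 => /eqP.
suff [] : [/\ H = H', H1 = H1' & H2 = H2'] by [].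
apply: (@boundary_coefficients_unique R H H1 H2 H' H1' H2' lam (fun n => phi n pi) (fun n => phi1 n pi)) => //.
- by move=> n; exact: eigensolution_end_neq0 sq rho_gt0 (pe n) (p0 n).
- by move=> n; have [] := pe n.
- by move=> n; rewrite phiE// phi1E//; have [] := pe' n.
(* The L_2 parts of the norming constants agree because the functions do, which leaves the equality
   of the scalar parts. *)
- move=> n; have := gE n; rewrite /ipE /eigvec /= !phiE// !phi1E//.
  have -> : itg (fun t => phi n t * phi n t) 0 pi = itg (fun t => psi n t * psi n t) 0 pi.
    by apply: eq_itg => [|t tp]; [exact: ltW|rewrite phiE].
  by move=> /addrI; rewrite -!expr2.
Qed.
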